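(* Assume that $X=l^2(\mathbb{R})$ or $X=\mathbb{R}^N$ for some $N\geq 2$. Let $s\geq 1$, and let $\mathscr{V}=(V_k,\rho_k)_{k\geq 0}$ be a sequence of finite nonempty sets $V_k\subset X$ and numbers $\rho_k>0$ that, together with $x_0\in X$, $r_0>0$, $C^*\geq 1$, $0<\xi_1\leq\xi_2<1$, numbers $\alpha_{k,v}\geq 0$ and lines $\ell_{k,v}$, satisfy properties (V0)--(V5) written out in the context. Let $$\alpha_1:=\min\left\{\frac1{16},\left(\frac{\xi_1(1-\xi_2)}{42\,C^*}\right)^{1/2}\right\}.$$ If $\alpha_0\in(0,\alpha_1]$ and $$S^s_{\mathscr{V}}:=\sum_{k=0}^{\infty}\sum_{(v,v')\in\mathsf{Flat}(k)}\tau_s(k,v,v')\,\rho_k^s+\sum_{k=0}^{\infty}\sum_{\substack{v\in V_k\\ \alpha_{k,v}\geq\alpha_0}}\rho_k^s<\infty,$$ then there exists a map $f:[0,1]\to X$ such that $f([0,1])\supset\bigcup_{k\geq 0}V_k$ and $|f(x)-f(y)|\leq H|x-y|^{1/s}$ for all $x,y\in[0,1]$, where $H\leq C\,r_0(1+S^s_{\mathscr{V}})$ and $C$ is a constant depending only on $s,C^*,\xi_1,\xi_2$.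
   Context: $(X,|\cdot|)$ is the Hilbert space $l^2(\mathbb{R})$ of square-summable real sequences or $\mathbb{R}^N$, $N\geq2$. $B(x,r)$ is the open ball. Properties, for $x_0\in X$, $r_0>0$, $C^*\geq1$, $0<\xi_1\leq\xi_2<1$, and $A^*:=C^*/(1-\xi_2)$: (V0) $\rho_0=1$, and $\xi_1\rho_k\leq\rho_{k+1}\leq\xi_2\rho_k$ for all $k\geq0$. (V1) $V_0\subset B(x_0,C^*r_0)$. (V2) $V_k\subset V_{k+1}$ for all $k\geq0$. (V3) $|v-v'|\geq\rho_kr_0$ for all $k\geq 0$ and all distinct $v,v'\in V_k$. (V4) For all $k\geq0$ and $v\in V_{k+1}$ there is $v'\in V_k$ with $|v-v'|<C^*\rho_{k+1}r_0$. (V5) For each $k\geq0$ and $v\in V_k$ we are given a number $\alpha_{k,v}\geq0$ and a straight line $\ell_{k,v}$ in $X$ with $\operatorname{dist}(x,\ell_{k,v})\leq\alpha_{k,v}\,\rho_{k+1}r_0$ for all $x\in V_{k+1}\cap B(v,30A^*\rho_kr_0)$. Ordering: if $\alpha_{k,v}\leq1/16$, identify $\ell_{k,v}$ with $\mathbb{R}$ (choice of orientation); the points of $V_{k+1}\cap B(v,30A^*\rho_kr_0)$ are then linearly ordered by their orthogonal projections onto $\ell_{k,v}$ (distinct points have distinct projections). ''Left'', ''right'' and ''between'' (inclusive) refer to this order. Flat pairs: for a fixed $\alpha_0\in(0,1/16]$, $\mathsf{Flat}(k)$ is the set of pairs $(v,v')\in V_k\times V_k$ such that (1) $\rho_kr_0\leq|v-v'|<14A^*\rho_kr_0$,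 and (2) $\alpha_{k,v}<\alpha_0$ and $v'$ is the first point of $V_k\cap B(v,14A^*\rho_kr_0)$ to the left or to the right of $v$ with respect to the order induced by $\ell_{k,v}$. For $(v,v')\in\mathsf{Flat}(k)$, $V_{k+1}(v,v')$ is the set of $x\in V_{k+1}\cap B(v,14A^*\rho_kr_0)$ lying between $v$ and $v'$ (including $v$ and $v'$). Variation excess: for $s\geq1$ and $(v,v')\in\mathsf{Flat}(k)$, $\tau_s(k,v,v')$ is defined by $$\tau_s(k,v,v')|v-v'|^s=\max\left\{\Big(\sum_{i=1}^{n-1}|v_{i+1}-v_i|^s\Big)-|v-v'|^s,\,0\right\},$$ where $V_{k+1}(v,v')=\{v_1,\dots,v_n\}$ is enumerated consecutively in the order, with $v_1=v$ and $v_n=v'$. *)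

(* Defs.v *)
From HB Require Import structures.
From mathcomp Require Import all_boot all_order all_algebra.
From mathcomp Require Import finmap.
From mathcomp Require Import all_classical all_reals all_analysis.
From mathcomp Require Import ring lra.

Set Implicit Arguments.
Unset Strict Implicit.
Unset Printing Implicit Defensive.

Import Order.TTheory GRing.Theory Num.Theory.
Import numFieldNormedType.Exports.

Local Open Scope classical_set_scope.
Local Open Scope ring_scope.

(** * Real inner product spaces *)

HB.mixin Record NormedModule_hasInner (R : realType) V & NormedModule R V := {
  inner : V -> V -> R ;
  innerC : forall x y, inner x y = inner y x ;
  innerPl : forall a x y z, inner (a *: x + y) z = a * inner x z + inner y z ;
  inner_norm : forall x, inner x x = `|x| ^+ 2
}.

#[short(type="innerProductType")]
HB.structure Definition InnerProduct (R : realType) :=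
  {V of NormedModule R V & NormedModule_hasInner R V}.

(* An inner product on a bare vector space; the norm is sqrt (inner x x). *)
HB.factory Record Lmodule_hasInner (R : realType) V & GRing.Lmodule R V := {
  inner : V -> V -> R ;
  innerC : forall x y, inner x y = inner y x ;
  innerPl : forall a x y z, inner (a *: x + y) z = a * inner x z + inner y z ;
  inner_ge0 : forall x, 0 <= inner x x ;
  inner_eq0 : forall x, inner x x = 0 -> x = 0
}.

HB.builders Context R V & Lmodule_hasInner R V.

Let nrm (x : V) : R := Num.sqrt (inner x x).

Let innerDl x y z : inner (x + y) z = inner x z + inner y z.
Proof. by rewrite -[x]scale1r innerPl mul1r scale1r. Qed.

Let inner0l z : inner 0 z = 0.
Proof. by apply: (addrI (inner 0 z)); rewrite -innerDl !addr0. Qed.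

Let innerZl a x z : inner (a *: x) z = a * inner x z.
Proof. by rewrite -[a *: x]addr0 innerPl inner0l addr0. Qed.

Let innerDr x y z : inner z (x + y) = inner z x + inner z y.
Proof. by rewrite innerC innerDl !(innerC z). Qed.

Let innerZr a x z : inner z (a *: x) = a * inner z x.
Proof. by rewrite innerC innerZl innerC. Qed.

Let cauchy_schwarz x y : inner x y ^+ 2 <= inner x x * inner y y.
Proof.
have [/inner_eq0 ->|y0] := eqVneq (inner y y) 0.
  by rewrite innerC inner0l expr0n/= mulr_ge0 ?inner_ge0.
have yp : 0 < inner y y by rewrite lt_neqAle eq_sym y0 inner_ge0.
have := inner_ge0 (inner y y *: x + (- inner x y) *: y).
rewrite innerDl !innerDr !innerZl !innerZr (innerC y x).
set a := inner x x; set b := inner x y; set c := inner y y.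
rewrite [X in 0 <= X](_ : _ = c * (a * c - b ^+ 2)); last by ring.
by rewrite pmulr_rge0 ?subr_ge0.
Qed.

Let nrmD x y : nrm (x + y) <= nrm x + nrm y.
Proof.
rewrite /nrm -(ler_pXn2r (n := 2%N)) ?nnegrE ?addr_ge0 ?sqrtr_ge0//.
rewrite sqr_sqrtr ?inner_ge0// sqrrD !sqr_sqrtr ?inner_ge0//.
rewrite innerDl !innerDr (innerC y x).
suff : inner x y <= Num.sqrt (inner x x) * Num.sqrt (inner y y) by lra.
rewrite -sqrtrM ?inner_ge0// (le_trans (ler_norm _))//.
by rewrite -sqrtr_sqr ler_wsqrtr// cauchy_schwarz.
Qed.

Let nrmZ (a : R) x : nrm (a *: x) = `|a| * nrm x.
Proof.
by rewrite /nrm innerZl innerZr mulrA -expr2 sqrtrM ?sqr_ge0// sqrtr_sqr.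
Qed.

Let nrm_eq0 x : nrm x = 0 -> x = 0.
Proof.
move=> /eqP; rewrite /nrm sqrtr_eq0 => x0; apply: inner_eq0.
by apply/eqP; rewrite eq_le x0 inner_ge0.
Qed.

HB.instance Definition _ := Lmodule_isNormed.Build R V nrmD nrmZ nrm_eq0.

Let inner_nrm (x : V) : inner x x = `|x| ^+ 2.
Proof. by rewrite /Num.norm/= /nrm sqr_sqrtr ?inner_ge0. Qed.

HB.instance Definition _ :=
  NormedModule_hasInner.Build R V innerC innerPl inner_nrm.

HB.end.

(** * R^N with the Euclidean norm *)

(* An alias, because 'rV[R]_N carries the sup norm. *)
Definition euclid (R : realType) (N : nat) : Type := 'rV[R]_N.

Section euclid.
Variables (R : realType) (N : nat).

HB.instance Definition _ := GRing.Lmodule.on (euclid R N).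

Let dotu (x y : euclid R N) : R := \sum_(i < N) x 0 i * y 0 i.

Let dotuC x y : dotu x y = dotu y x.
Proof. by apply: eq_bigr => i _; rewrite mulrC. Qed.

Let dotuPl a x y z : dotu (a *: x + y) z = a * dotu x z + dotu y z.
Proof.
rewrite /dotu mulr_sumr -big_split/=; apply: eq_bigr => i _.
by rewrite !mxE mulrDl mulrA.
Qed.

Let dotu_ge0 x : 0 <= dotu x x.
Proof. by apply: sumr_ge0 => i _; rewrite -expr2 sqr_ge0. Qed.

Let dotu_eq0 x : dotu x x = 0 -> x = 0.
Proof.
move=> /eqP; rewrite psumr_eq0 => [/allP x0|i _]; last by rewrite -expr2 sqr_ge0.
apply/rowP => i; rewrite mxE; apply/eqP.
by have := x0 i (mem_index_enum _); rewrite mulf_eq0 orbb.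
Qed.

HB.instance Definition _ :=
  Lmodule_hasInner.Build R (euclid R N) dotuC dotuPl dotu_ge0 dotu_eq0.

End euclid.

(** * The Hilbert space of square-summable real sequences *)

Definition sqr_summable {R : realType} : {pred nat -> R^o} :=
  fun x => `[< cvgn (series (fun n => x n ^+ 2)) >].

Record l2 (R : realType) := L2 {
  l2val :> nat -> R^o ;
  l2valP : l2val \in sqr_summable
}.

Section l2.
Variable R : realType.

Let cvg_prod (x y : nat -> R^o) : x \in sqr_summable -> y \in sqr_summable ->
  cvgn (series (fun n => x n * y n)).
Proof.
move=> /asboolP cx /asboolP cy; apply: normed_cvg.
apply: (series_le_cvg (v_ := (fun n => x n ^+ 2) \+ (fun n => y n ^+ 2))).
- by move=> n; rewrite normr_ge0.
- by move=> n; rewrite addr_ge0 ?sqr_ge0.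
- move=> n /=; rewrite ler_norml; apply/andP; split.
    by have := sqr_ge0 (x n + y n); rewrite sqrrD; nra.
  by have := sqr_ge0 (x n - y n); rewrite sqrrB; nra.
- by rewrite seriesD; exact: is_cvgD.
Qed.

Let sqr_summable_submod : submod_closed (@sqr_summable R).
Proof.
split=> [|a x y sx sy]; apply/asboolP.
  rewrite (_ : series _ = cst 0); first exact: is_cvg_cst.
  apply/funext => n; rewrite /series/= big1// => i _.
  by rewrite expr0n.
have -> : (fun n => (a *: x + y) n ^+ 2) =
    (a ^+ 2 *: (fun n => x n * x n : R^o)) +
    ((2 * a) *: (fun n => x n * y n : R^o) + (fun n => y n * y n)).
  apply/funext => n.
  have -> : (a *: x + y) n = a * x n + y n :> R by [].
  transitivity (a ^+ 2 * (x n * x n) + (2 * a * (x n * y n) + y n * y n) : R) => //.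
  by ring.
rewrite !seriesD !seriesZ.
apply: is_cvgD; first by apply: is_cvgZr; exact: cvg_prod.
apply: is_cvgD; last exact: cvg_prod.
by apply: is_cvgZr; exact: cvg_prod.
Qed.

HB.instance Definition _ :=
  GRing.isSubmodClosed.Build R (nat -> R^o) sqr_summable sqr_summable_submod.
HB.instance Definition _ := [isSub for @l2val R].
HB.instance Definition _ := [Choice of l2 R by <:].
HB.instance Definition _ := [SubChoice_isSubLmodule of l2 R by <:].

Let dotl (x y : l2 R) : R := limn (series (fun n => x n * y n)).

Let dotlC x y : dotl x y = dotl y x.
Proof.
by congr (limn (series _)); apply/funext => n; rewrite mulrC.
Qed.

Let dotlPl a x y z : dotl (a *: x + y) z = a * dotl x z + dotl y z.
Proof.
rewrite /dotl.
have -> : (fun n => (a *: x + y : l2 R) n * z n) =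
    (a *: (fun n => x n * z n : R^o)) + (fun n => y n * z n).
  apply/funext => n.
  have -> : (a *: x + y : l2 R) n = a * x n + y n :> R by [].
  transitivity (a * (x n * z n) + y n * z n : R) => //.
  by ring.
have cx := cvg_prod (l2valP x) (l2valP z).
have cy := cvg_prod (l2valP y) (l2valP z).
rewrite seriesD seriesZ limD//; last exact: is_cvgZr.
by rewrite limZr.
Qed.

Let dotl_ge0 x : 0 <= dotl x x.
Proof.
apply: limr_ge; first exact: cvg_prod (l2valP x) (l2valP x).
by apply: nearW => n; apply: sumr_ge0 => i _; rewrite -expr2 sqr_ge0.
Qed.

Let dotl_eq0 x : dotl x x = 0 -> x = 0.
Proof.
move=> x0; apply: val_inj; apply/funext => n /=.
have cx := cvg_prod (l2valP x) (l2valP x).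
have nd : nondecreasing_seq (series (fun n => x n * x n)).
  apply/nondecreasing_seqP => m.
  by rewrite /series/= big_nat_recr//= lerDl -expr2 sqr_ge0.
have := nondecreasing_cvgn_le nd cx n.+1.
rewrite -/(dotl x x) x0 /series/= big_nat_recr//= => le0.
have s0 : 0 <= \sum_(0 <= i < n) x i * x i :> R.
  by apply: sumr_ge0 => i _; rewrite -expr2 sqr_ge0.
have : x n * x n <= 0 by lra.
by rewrite -expr2 real_exprn_even_le0 ?num_real//= => /eqP.
Qed.

HB.instance Definition _ :=
  Lmodule_hasInner.Build R (l2 R) dotlC dotlPl dotl_ge0 dotl_eq0.

End l2.

(** * Straight lines *)

(* The base point and the unit direction identify the line with R; every line
   arises in this way, with both orientations. *)
Record line (R : realType) (X : innerProductType R) := Line {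
  line_pt : X ;
  line_dir : X ;
  line_dir1 : `|line_dir| = 1
}.

Section lines.
Context {R : realType} {X : innerProductType R}.
Implicit Types (l : line X) (x v w : X) (A : set X).

Definition line_set l : set X := [set line_pt l + t *: line_dir l | t in [set: R]].

Definition dist_line x l : R := inf [set `|x - y| | y in line_set l].

(* The coordinate on the line of the orthogonal projection of x. *)
Definition line_pos l x : R := inner (x - line_pt l) (line_dir l).

Definition first_right l A v v' :=
  [/\ A v', line_pos l v < line_pos l v' &
      forall w, A w -> line_pos l v < line_pos l w ->
        line_pos l v' <= line_pos l w].

Definition first_left l A v v' :=
  [/\ A v', line_pos l v' < line_pos l v &
      forall w, A w -> line_pos l w < line_pos l v ->
        line_pos l w <= line_pos l v'].

Definition between l v v' x : Prop :=
  Num.min (line_pos l v) (line_pos l v') <= line_pos l x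
    <= Num.max (line_pos l v) (line_pos l v').

(* The finite set A enumerated in the order of l, from the side of v to the
   side of v'. *)
Definition line_enum l A v v' : seq X :=
  let e := sort (fun x y => line_pos l x <= line_pos l y) (fset_set A) in
  if line_pos l v <= line_pos l v' then e else rev e.

End lines.

(** * Nets, flat pairs and variation excess *)

Definition Astar {R : realType} (Cstar xi2 : R) : R := Cstar / (1 - xi2).

Definition alpha1 {R : realType} (Cstar xi1 xi2 : R) : R :=
  Num.min 16^-1 (Num.sqrt (xi1 * (1 - xi2) / (42 * Cstar))).

Section nets.
Context {R : realType} {X : innerProductType R}.
Variables (Cstar xi1 xi2 : R) (x0 : X) (r0 : R).
Variables (V : nat -> set X) (rho : nat -> R).
Variables (alpha : nat -> X -> R) (ell : nat -> X -> line X).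

Record flat_nets : Prop := FlatNets {
  nets_finite : forall k, finite_set (V k) ;
  nets_nonempty : forall k, V k !=set0 ;
  rho_gt0 : forall k, 0 < rho k ;
  nets_V0 : rho 0%N = 1 /\
    forall k, xi1 * rho k <= rho k.+1 <= xi2 * rho k ;
  nets_V1 : V 0%N `<=` ball x0 (Cstar * r0) ;
  nets_V2 : forall k, V k `<=` V k.+1 ;
  nets_V3 : forall k v v', V k v -> V k v' -> v <> v' ->
    rho k * r0 <= `|v - v'| ;
  nets_V4 : forall k v, V k.+1 v ->
    exists2 v', V k v' & `|v - v'| < Cstar * rho k.+1 * r0 ;
  nets_V5 : forall k v, V k v -> 0 <= alpha k v /\
    forall x, (V k.+1 `&` ball v (30 * Astar Cstar xi2 * rho k * r0)) x ->
      dist_line x (ell k v) <= alpha k v * rho k.+1 * r0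
}.

Definition near_ball k (v : X) : set X :=
  ball v (14 * Astar Cstar xi2 * rho k * r0).

Definition Flat (alpha0 : R) k : set (X * X) :=
  [set p | let: (v, v') := p in
    [/\ V k v, V k v',
        rho k * r0 <= `|v - v'| < 14 * Astar Cstar xi2 * rho k * r0,
        alpha k v < alpha0 &
        first_left (ell k v) (V k `&` near_ball k v) v v' \/
        first_right (ell k v) (V k `&` near_ball k v) v v']].

Definition Vbetween k (v v' : X) : set X :=
  V k.+1 `&` near_ball k v `&` between (ell k v) v v'.

(* For flat pairs v <> v', so the division below is a genuine one. *)
Definition tau (s : R) k (v v' : X) : R :=
  let e := line_enum (ell k v) (Vbetween k v v') v v' in
  Num.max (\sum_(i < (size e).-1) `|e`_i.+1 - e`_i| `^ s - `|v - v'| `^ s) 0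
    / `|v - v'| `^ s.

Definition S_sum (s alpha0 : R) : \bar R :=
  (\sum_(0 <= k <oo)
     (\sum_(p \in Flat alpha0 k) tau s k p.1 p.2 * rho k `^ s)%R%:E +
   \sum_(0 <= k <oo)
     (\sum_(v \in V k `&` [set v | (alpha0 <= alpha k v)%R]) rho k `^ s)%R%:E)%E.

End nets.

(* Main.v *)
Require Import Defs.
From HB Require Import structures.
From mathcomp Require Import all_boot all_order all_algebra.
From mathcomp Require Import finmap.
From mathcomp Require Import all_classical all_reals all_analysis.
From mathcomp Require Import ring lra zify.

Set Implicit Arguments.
Unset Strict Implicit.
Unset Printing Implicit Defensive.

Import Order.TTheory GRing.Theory Num.Theory.
Import numFieldNormedType.Exports.

Local Open Scope classical_set_scope.
Local Open Scope ring_scope.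

(** The curve is a limit of closed tours. The tour of level k is a chain of nodes,
    each leading from a source to a target at distance O(rho_k r0), and it visits
    every point of V_k. The next tour replaces each node by a chain with the same
    two ends. A node carries a base cost, at least (rho_k r0)^s as soon as its two
    ends differ, and the replacement of a node costs at most the node itself plus
    a payment. If the payments of all levels have a finite sum, an interval can be
    shared out once and for all: a node gets its base cost and all later payments
    of its descendants, and the children of a node divide its length. A move of
    size rho_k r0 then takes time at least (rho_k r0)^s, so the limit is
    1/s-Hölder, with a constant of the order of the s-th root of the total length
    ([tours_holder]). The space must be complete for the limit to exist
    ([l2_complete], [euclid_complete]); the image is compact, so it contains every
    point visited by all tours from some level on.

    The total length has to be of order r0^s (1 + S). Four kinds of nodes suffice;
    a vertex v of level k is good when alpha_{k,v} < alpha0.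

    - [Edge]: a flat pair (u, u') traversed in one direction, of cost
      3 |u - u'|^s. It is replaced by a walk through V_{k+1}(u, u'), and what the
      walk costs in addition is paid by the variation excess.
    - [Loose]: a side of a good vertex that is not known to be covered by an edge,
      of cost a multiple of (rho_k r0)^s. It is replaced by a walk out and back
      through the points of V_{k+1} close to the vertex on that side, with one
      loose side at the far end; the geometric decrease of the scale pays
      for this ([ray_budget]).
    - [Stop]: a visit to a vertex, free of charge. At a bad vertex it is replaced
      by a star of its children. A good child has boundedly many siblings
      ([few_near_good]), so the star costs a multiple of (rho_k r0)^s and of the
      sum of (rho_{k+1} r0)^s over the bad children; both belong to the second
      sum in S ([sum_pay_Stop]).
    - [Bridge]: a segment that is only subdivided from then on. Its cost
      |x - y| (rho_k r0)^(s-1) does not increase.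

    When a walk crosses a gap of length L at least 14 A rho_{k+1} r0, where
    A = Cstar / (1 - xi2), no edge can be kept there. The gap is bridged at cost
    at most L^s and leaves loose sides at its two ends, which take the remaining
    2 L^s; this fixes the cost of a loose side ([step_base]).

    No point is missed ([discovered], [covered]). Let w be a new point whose
    nearest point v in V_k is good. On the side of v where w lies, v is either
    loose, and w is close enough to be found from v, or joined by an edge to some
    u, and w lies between v and u because u is not nearer to w than v. The
    argument compares the orders induced by different lines; they agree because
    for separated points close to a line, y lies between x and z exactly when the
    inner product of x - y and z - y is negative, which does not involve the line
    ([flat_inner_lt0]).

    Walks from different places may meet. The second occurrence of a stop or of an
    edge in a tour is turned into a bridge ([dedup]), so that nothing is paid
    twice. *)

(** * Completeness of the two spaces *)

(* Linear arithmetic with the norms taken as atoms. *)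
Ltac nlra :=
  repeat match goal with H : is_true _ |- _ => revert H end;
  repeat match goal with
    R : Real.type |- context [@Num.norm ?A ?B ?x] =>
      let n := fresh "n" in set n : Real.sort R := (@Num.norm A B x); clearbody n end;
  move=> *; lra.

Definition seq_complete (R : realType) (X : normedModType R) : Prop :=
  forall u : nat -> X,
    (forall e : R, 0 < e -> exists N, forall m n, (N <= m)%N -> (N <= n)%N ->
      `|u m - u n| <= e) ->
    exists l, forall e : R, 0 < e -> exists N, forall n, (N <= n)%N -> `|u n - l| <= e.

Section completeness.
Variable R : realType.

Lemma real_cauchy (u : nat -> R) :
  (forall e : R, 0 < e -> exists N, forall m n, (N <= m)%N -> (N <= n)%N ->
      `|u m - u n| <= e) -> cvgn u.
Proof.
move=> uC; apply/cauchy_cvgP/cauchy_ballP => e e0.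
have e2 : 0 < e / 2 by lra.
have [N NP] := uC _ e2.
pose A := u @` [set n | (N <= n)%N].
have AF : (u @ \oo) A by exists N => // n Nn; exists n.
exists (A, A) => //= -[x y] /= [[m Nm <-] [n Nn <-]].
by rewrite -ball_normE /= (le_lt_trans (NP m n Nm Nn))//; lra.
Qed.

Lemma l2_normE (x : l2 R) : `|x| ^+ 2 = limn (series (fun n => x n * x n)).
Proof. by rewrite -inner_norm. Qed.

Lemma euclid_normE N (x : euclid R N) : `|x| ^+ 2 = \sum_(i < N) x 0 i * x 0 i.
Proof. by rewrite -inner_norm. Qed.

Lemma l2_summable (x : l2 R) : cvgn (series (fun n => x n * x n)).
Proof. exact/asboolP/(l2valP x). Qed.

Lemma l2_partial (x : l2 R) n : \sum_(0 <= i < n) x i * x i <= `|x| ^+ 2.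
Proof.
have nd : nondecreasing_seq (series (fun i => x i * x i : R)).
  apply/nondecreasing_seqP => m.
  by rewrite /series/= big_nat_recr//= lerDl -expr2 sqr_ge0.
by rewrite l2_normE; exact: nondecreasing_cvgn_le nd (@l2_summable x) n.
Qed.

Lemma l2_coord (x : l2 R) n : `|x n : R| <= `|x|.
Proof.
rewrite -(ler_pXn2r (n := 2)) ?nnegrE// real_normK ?num_real//.
rewrite (le_trans _ (l2_partial x n.+1))// big_nat_recr//= -expr2 lerDr.
by apply: sumr_ge0 => i _; rewrite -expr2 sqr_ge0.
Qed.

Lemma euclid_coord N (x : euclid R N) i : `|x 0 i| <= `|x|.
Proof.
rewrite -(ler_pXn2r (n := 2)) ?nnegrE// real_normK ?num_real// euclid_normE.
rewrite (bigD1 i)//= -expr2 lerDl.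
by apply: sumr_ge0 => j _; rewrite -expr2 sqr_ge0.
Qed.

Lemma euclid_complete N : seq_complete (euclid R N).
Proof.
move=> u uC.
have uc i : cvgn (fun k => u k 0 i).
  apply: real_cauchy => e e0; have [K KP] := uC e e0; exists K => m n Km Kn.
  by rewrite (le_trans _ (KP m n Km Kn))// (le_trans _ (euclid_coord _ i))// !mxE.
pose l : euclid R N := \row_i limn (fun k => u k 0 i).
exists l => e e0; have [K KP] := uC e e0; exists K => m Km.
rewrite -(ler_pXn2r (n := 2)) ?nnegrE ?(ltW e0)// euclid_normE.
have cv : (\sum_(i < N) (u m 0 i - u n 0 i) * (u m 0 i - u n 0 i)) @[n --> \oo] -->
    \sum_(i < N) (u m - l) 0 i * (u m - l) 0 i.
  apply: cvg_big => [|i _]; first exact: add_continuous.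
  have ci : (u m 0 i - u n 0 i) @[n --> \oo] --> (u m - l) 0 i.
    by rewrite !mxE; apply: cvgB; [exact: cvg_cst|exact: uc].
  exact: (cvgM ci ci).
rewrite -(cvg_lim _ cv)//; apply: limr_le; first by apply: cvgP; exact: cv.
exists K => // n /= Kn; have := KP m n Km Kn.
rewrite -(ler_pXn2r (n := 2)) ?nnegrE ?(ltW e0)// euclid_normE.
by apply: le_trans; apply: ler_sum => i _; rewrite !mxE.
Qed.

(** The limit is taken coordinatewise. It is square summable because a bound on
    all partial sums of squares of u m - u n survives the limit in n; the same
    bounds give convergence in norm. *)
Lemma l2_complete : seq_complete (l2 R).
Proof.
move=> u uC.
have uc i : cvgn (fun k => u k i : R).
  apply: real_cauchy => e e0; have [K KP] := uC e e0; exists K => m n Km Kn.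
  exact: le_trans (l2_coord (u m - u n) i) (KP m n Km Kn).
pose l i : R^o := limn (fun k => u k i : R).
have part (e : R) : 0 < e -> exists K, forall m, (K <= m)%N -> forall n,
    \sum_(0 <= i < n) (u m i - l i) * (u m i - l i) <= e ^+ 2.
  move=> e0; have [K KP] := uC e e0; exists K => m Km n.
  have cv : (\sum_(0 <= i < n) (u m i - u j i) * (u m i - u j i) : R) @[j --> \oo] -->
      (\sum_(0 <= i < n) (u m i - l i) * (u m i - l i) : R).
    apply: cvg_big => [|i _]; first exact: add_continuous.
    have ci : (u m i - u j i : R) @[j --> \oo] --> (u m i - l i : R).
      by apply: cvgB; [exact: cvg_cst|exact: uc].
    exact: (cvgM ci ci).
  rewrite -(cvg_lim _ cv)//; apply: limr_le; first by apply: cvgP; exact: cv.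
  exists K => // j /= Kj; apply: le_trans (l2_partial (u m - u j) n) _.
  by rewrite ler_pXn2r ?nnegrE ?(ltW e0)//; exact: KP.
have sqc (v : nat -> R^o) (e : R) :
    (forall n, \sum_(0 <= i < n) v i * v i <= e) ->
    cvgn (series (fun n => v n * v n)) /\
    limn (series (fun n => v n * v n)) <= e.
  move=> ve; have c : cvgn (series (fun n => v n * v n)).
    apply: nondecreasing_is_cvgn; last by exists e => _ [n _ <-]; exact: ve.
    apply/nondecreasing_seqP => m.
    by rewrite /series/= big_nat_recr//= lerDl -expr2 sqr_ge0.
  by split => //; apply: limr_le => //; apply: nearW => n; exact: ve.
have [K0 K0P] := part 1 ltr01.
have dl : (fun i => u K0 i - l i) \in @sqr_summable R.
  by apply/asboolP; case: (sqc _ _ (K0P K0 (leqnn _))).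
pose l' : l2 R := u K0 - L2 dl.
have l'E i : l' i = l i.
  have -> : l' i = u K0 i - (u K0 i - l i) by [].
  by rewrite opprB addrC subrK.
exists l' => e e0; have [K KP] := part e e0; exists K => m Km.
rewrite -(ler_pXn2r (n := 2)) ?nnegrE ?(ltW e0)// l2_normE.
have -> : (fun n => (u m - l') n * (u m - l') n) =
    (fun n => (u m n - l n) * (u m n - l n)).
  apply/funext => n.
  by have -> : (u m - l') n = u m n - l' n by []; rewrite l'E.
by case: (sqc _ _ (KP m Km)).
Qed.

End completeness.

(** * Hölder maps from refining tours *)

Section blocks.
Variables (R : realType) (n : nat) (o : nat -> nat).
Hypothesis o0 : o 0%N = 0%N.
Hypothesis oS : forall i, (i < n)%N -> (o i < o i.+1)%N.

Lemma blocks_le i j : (i <= j <= n)%N -> (o i <= o j)%N.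
Proof.
elim: j => [|j IH]; first by rewrite leqn0 => /andP[/eqP->].
rewrite leq_eqVlt => /andP[/orP[/eqP->//|ij] jn].
by rewrite (leq_trans (IH _))// ?(ltnW (oS _))// -ltnS ij ltnW.
Qed.

Lemma sum_blocks (F : nat -> R) i : (i <= n)%N ->
  \sum_(0 <= i' < i) \sum_(o i' <= j < o i'.+1) F j = \sum_(0 <= j < o i) F j.
Proof.
elim: i => [|i IH] lin; first by rewrite o0 !big_geq.
rewrite big_nat_recr//= IH 1?ltnW// [in RHS](@big_cat_nat _ _ _ (o i))//=.
by rewrite (blocks_le (i := i)) ?leqnSn.
Qed.

End blocks.

(** Level k of an ordered forest has the nodes 0, ..., n k - 1, and the children
    of node i are the consecutive nodes o k i, ..., o k i.+1 - 1 of the next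
    level. The nodes are given intervals, in order, such that children fill the
    interval of their parent and every node is at least as long as its base. *)
Section tree_positions.
Variables (R : realType) (n : nat -> nat) (o : nat -> nat -> nat).
Variables (base pay : nat -> nat -> R) (B : R).
Hypothesis o0 : forall k, o k 0%N = 0%N.
Hypothesis oS : forall k i, (i < n k)%N -> (o k i < o k i.+1)%N.
Hypothesis on : forall k, o k (n k) = n k.+1.
Hypothesis base_ge0 : forall k i, 0 <= base k i.
Hypothesis pay_ge0 : forall k i, 0 <= pay k i.
Hypothesis refine_base : forall k i, (i < n k)%N ->
  \sum_(o k i <= j < o k i.+1) base k.+1 j <= base k i + pay k i.
Hypothesis pay_sum : forall N,
  \sum_(0 <= k < N) \sum_(0 <= i < n k) pay k i <= B.

Let children_lt k i j : (i < n k)%N -> (j < o k i.+1)%N -> (j < n k.+1)%N.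
Proof.
move=> ik ji; rewrite -on (leq_trans ji)//.
by apply: (blocks_le (oS (k := k))); rewrite ik leqnn.
Qed.

Fixpoint pay_at (l k i : nat) : R :=
  if l is l'.+1 then \sum_(o k i <= j < o k i.+1) pay_at l' k.+1 j
  else pay k i.

Definition pay_upto (k i N : nat) : R := \sum_(0 <= l < N) pay_at l k i.

Lemma pay_at_ge0 l k i : 0 <= pay_at l k i.
Proof. by elim: l k i => [//|l IH] k i /=; apply: sumr_ge0 => j _. Qed.

(** The descendants, l levels down, of all nodes of a level are all the nodes l
    levels further down. *)
Lemma sum_pay_at l k :
  \sum_(0 <= i < n k) pay_at l k i = \sum_(0 <= i < n (l + k)%N) pay (l + k)%N i.
Proof.
elim: l k => [//|l IH] k /=.
by rewrite (sum_blocks (o0 k) (oS (k := k)))// on IH addnS.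
Qed.

Lemma pay_upto_le k i N : (i < n k)%N -> pay_upto k i N <= B.
Proof.
move=> ik; apply: le_trans (pay_sum (N + k)%N).
rewrite addnC (@big_cat_nat _ _ _ k)//= ?leq_addr//.
rewrite -[leLHS]add0r lerD//.
  by apply: sumr_ge0 => l _; apply: sumr_ge0.
rewrite -{2}[k]add0n big_addn addKn; apply: ler_sum => l _.
rewrite -sum_pay_at (bigD1_seq i)//= ?iota_uniq ?mem_index_iota//.
by rewrite lerDl sumr_ge0// => j _; exact: pay_at_ge0.
Qed.

Lemma pay_upto_nd k i : nondecreasing_seq (pay_upto k i).
Proof.
apply/nondecreasing_seqP => N.
by rewrite /pay_upto big_nat_recr//= lerDl pay_at_ge0.
Qed.

Lemma pay_upto_cvg k i : (i < n k)%N -> cvgn (pay_upto k i).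
Proof.
move=> ik; apply: nondecreasing_is_cvgn; first exact: pay_upto_nd.
by exists B => _ [N _ <-]; exact: pay_upto_le.
Qed.

(** A length that suffices for the node and for all its descendants. *)
Definition mass k i : R := base k i + limn (pay_upto k i).

Lemma base_le_mass k i : (i < n k)%N -> base k i <= mass k i.
Proof.
move=> ik; rewrite lerDl; apply: limr_ge; first exact: pay_upto_cvg.
by apply: nearW => N; apply: sumr_ge0 => l _; exact: pay_at_ge0.
Qed.

Lemma mass_ge0 k i : (i < n k)%N -> 0 <= mass k i.
Proof. by move=> ik; exact: le_trans (base_ge0 k i) (base_le_mass ik). Qed.

(** The payment of the node covers what its children have in base cost above the
    node, and all later payments are those of descendants of the children. *)
Lemma mass_children k i : (i < n k)%N ->
  \sum_(o k i <= j < o k i.+1) mass k.+1 j <= mass k i.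
Proof.
move=> ik; rewrite big_split/=.
suff H : \sum_(o k i <= j < o k i.+1) limn (pay_upto k.+1 j) <=
    limn (pay_upto k i) - pay k i.
  by rewrite (le_trans (lerD (refine_base ik) H))// /mass; lra.
pose S N := \sum_(o k i <= j < o k i.+1) pay_upto k.+1 j N.
have SE N : S N = pay_upto k i N.+1 - pay k i.
  rewrite /S /pay_upto exchange_big/= big_nat_recl//=.
  by rewrite addrC addKr.
have S_cvg : S @ \oo --> \sum_(o k i <= j < o k i.+1) limn (pay_upto k.+1 j).
  rewrite big_nat (_ : S = fun N => \sum_(o k i <= j < o k i.+1 |
    (o k i <= j < o k i.+1)%N) pay_upto k.+1 j N).
    apply: cvg_big => [|j /andP[_ ji]]; first exact: add_continuous.
    by apply: pay_upto_cvg; exact: children_lt ji.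
  by apply/funext => N; rewrite /S big_nat.
rewrite -(cvg_lim _ S_cvg)//; apply: limr_le; first by apply: cvgP; exact: S_cvg.
apply: nearW => N; rewrite SE lerD2r.
apply: nondecreasing_cvgn_le; first exact: pay_upto_nd.
exact: pay_upto_cvg.
Qed.

(** The masses of the children may leave a part of the interval of their parent
    unused; giving it to the first child makes the intervals fit exactly. *)
Fixpoint len (k i : nat) : R :=
  if k is k'.+1 then mass k i +
    \sum_(0 <= i' < n k' | o k' i' == i)
      (len k' i' - \sum_(o k' i' <= j < o k' i'.+1) mass k'.+1 j)
  else mass 0 i.

Lemma mass_le_len k i : (i < n k)%N -> mass k i <= len k i.
Proof.
elim: k i => [//|k IH] i ik; rewrite lerDl big_seq_cond.
apply: sumr_ge0 => j; rewrite mem_index_iota => /andP[/andP[_ jk] _].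
by rewrite subr_ge0 (le_trans (mass_children jk))// IH.
Qed.

Lemma len_ge0 k i : (i < n k)%N -> 0 <= len k i.
Proof. by move=> ik; exact: le_trans (mass_ge0 ik) (mass_le_len ik). Qed.

Let o_inj k i i' : (i < n k)%N -> (i' < n k)%N -> o k i = o k i' -> i = i'.
Proof.
move=> ik ik' e; apply/eqP; rewrite eqn_leq; apply/andP; split; rewrite leqNgt.
  apply/negP => ii'; suff : (o k i' < o k i)%N by rewrite e ltnn.
  by rewrite (leq_trans (oS ik'))// (blocks_le (oS (k := k)))// ii' ltnW.
apply/negP => ii'; suff : (o k i < o k i')%N by rewrite e ltnn.
by rewrite (leq_trans (oS ik))// (blocks_le (oS (k := k)))// ii' ltnW.
Qed.

Lemma len_children k i : (i < n k)%N ->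
  \sum_(o k i <= j < o k i.+1) len k.+1 j = len k i.
Proof.
move=> ik /=; rewrite big_split/=.
set M := \sum_(_ <= j < _) mass _ _.
rewrite (big_ltn (oS ik)) [X in _ + (_ + X)]big_nat [X in _ + (_ + X)]big1.
  rewrite addr0 big_mkcond (bigD1_seq i)//= ?iota_uniq ?mem_index_iota ?ik//.
  rewrite eqxx -/M big_seq_cond big1 => [|i']; first by ring.
  rewrite mem_index_iota => /andP[/andP[_ ik'] ii'].
  by case: ifPn => // /eqP/o_inj e; rewrite e// eqxx in ii'.
move=> j /andP[oj ji]; rewrite big_seq_cond big1// => i'.
rewrite mem_index_iota => /andP[/andP[_ ik'] /eqP e]; exfalso.
have [ii|ii] := leqP i' i.
  have := blocks_le (oS (k := k)) (i := i') (j := i).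
  by rewrite ii (ltnW ik) e leqNgt oj => /(_ isT).
have := blocks_le (oS (k := k)) (i := i.+1) (j := i').
by rewrite ii (ltnW ik') e leqNgt ji => /(_ isT).
Qed.

Definition pos (k i : nat) : R := \sum_(0 <= j < i) len k j.

Lemma pos0 k : pos k 0 = 0. Proof. by rewrite /pos big_geq. Qed.

Lemma posS k i : pos k i.+1 = pos k i + len k i.
Proof. by rewrite /pos big_nat_recr. Qed.

Lemma base_le_pos k i : (i < n k)%N -> base k i <= pos k i.+1 - pos k i.
Proof.
move=> ik; rewrite posS addrC addKr.
exact: le_trans (base_le_mass ik) (mass_le_len ik).
Qed.

Lemma pos_mono k i j : (i <= j <= n k)%N -> pos k i <= pos k j.
Proof.
move=> /andP[ij jk]; rewrite /pos (@big_cat_nat _ _ _ i _ j)//= lerDl big_seq.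
apply: sumr_ge0 => l; rewrite mem_index_iota => /andP[_ lj].
by rewrite len_ge0// (leq_trans lj).
Qed.

Lemma pos_children k i : (i <= n k)%N -> pos k.+1 (o k i) = pos k i.
Proof.
move=> ik; rewrite /pos -(sum_blocks (o0 k) (oS (k := k)))//.
rewrite big_nat [RHS]big_nat; apply: eq_bigr => j /andP[_ ji].
by rewrite len_children// (leq_trans ji).
Qed.

Lemma pos_end k : pos k (n k) <= \sum_(0 <= i < n 0%N) base 0 i + B.
Proof.
suff -> : pos k (n k) = \sum_(0 <= i < n 0%N) mass 0 i.
  rewrite big_split lerD2l/=.
  pose S N := \sum_(0 <= i < n 0%N) pay_upto 0 i N.
  have S_cvg : S @ \oo --> \sum_(0 <= i < n 0%N) limn (pay_upto 0 i).
    rewrite big_nat (_ : S = fun N => \sum_(0 <= j < n 0%N | (0 <= j < n 0%N)%N)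
      pay_upto 0 j N).
      apply: cvg_big => [|j /andP[_ ji]]; first exact: add_continuous.
      exact: pay_upto_cvg.
    by apply/funext => N; rewrite /S big_nat.
  rewrite -(cvg_lim _ S_cvg)//; apply: limr_le.
    by apply: cvgP; exact: S_cvg.
  apply: nearW => N; rewrite /S /pay_upto exchange_big/=.
  rewrite (le_trans _ (pay_sum N))//; apply: ler_sum => l _.
  by rewrite sum_pay_at addn0.
by elim: k => [//|k IH]; rewrite -on pos_children.
Qed.

(** Several nodes start at the same point when some have length 0; the last of
    them is the one with an interval to the right of the point. *)
Definition node_at (k : nat) (x : R) : nat :=
  \max_(i < n k | pos k i <= x) i.

Hypothesis n_gt0 : forall k, (0 < n k)%N.

Lemma node_atP k x : 0 <= x -> (node_at k x < n k)%N /\ pos k (node_at k x) <= x.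
Proof.
move=> x0; rewrite /node_at.
have h0 : (fun i : 'I_(n k) => pos k i <= x) (Ordinal (n_gt0 k)) by rewrite pos0.
by rewrite (bigop.bigmax_eq_arg (Ordinal (n_gt0 k)))//; case: arg_maxnP.
Qed.

Lemma node_at_max k x i : (i < n k)%N -> pos k i <= x -> (i <= node_at k x)%N.
Proof.
move=> ik ix; rewrite /node_at.
exact: (@leq_bigmax_cond _ (fun i : 'I_(n k) => pos k i <= x)
  (fun i => i : nat) (Ordinal ik)).
Qed.

(** The intervals of the children begin where the interval of the parent begins
    and stop where the next one begins. *)
Lemma node_at_child k x : 0 <= x ->
  (o k (node_at k x) <= node_at k.+1 x < o k (node_at k x).+1)%N.
Proof.
move=> x0; have [ik ix] := node_atP k x0.
set i := node_at k x in ik ix *.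
have [jk jx] := node_atP k.+1 x0.
apply/andP; split.
  apply: node_at_max; last by rewrite pos_children// ltnW.
  by rewrite (children_lt ik)// oS.
rewrite ltnNge; apply/negP => oj.
have [ek|ek] := eqVneq i.+1 (n k).
  by move: oj; rewrite ek on leqNgt jk.
have ik' : (i.+1 < n k)%N by rewrite ltn_neqAle ek.
have : pos k i.+1 <= x.
  rewrite -pos_children; last exact: ltnW.
  by rewrite (le_trans _ jx)// pos_mono// oj ltnW.
by move=> /(node_at_max ik'); rewrite -/i ltnn.
Qed.

(** Such a node has its whole interval between x and y. *)
Lemma between_nodes k x y i : 0 <= x -> 0 <= y ->
  (node_at k x < i < node_at k y)%N -> base k i <= y - x.
Proof.
move=> x0 y0 /andP[xi iy].
have [jk jy] := node_atP k y0; have ik := ltn_trans iy jk.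
rewrite (le_trans (base_le_pos ik))// lerB//.
  by rewrite (le_trans _ jy)// pos_mono// iy ltnW.
by rewrite ltW// ltNge; apply/negP => /(node_at_max ik); rewrite leqNgt xi.
Qed.

End tree_positions.
Section geometric_scales.
Variables (R : realType) (delta : nat -> R) (xi1 xi2 : R).
Hypothesis xi1_gt0 : 0 < xi1.
Hypothesis xi12 : xi1 <= xi2.
Hypothesis xi2_lt1 : xi2 < 1.
Hypothesis delta_gt0 : forall k, 0 < delta k.
Hypothesis delta_dec : forall k, delta k.+1 <= xi2 * delta k.
Hypothesis delta_lb : forall k, xi1 * delta k <= delta k.+1.

Lemma scale_small (e : R) : 0 < e -> exists N, forall k, (N <= k)%N -> delta k <= e.
Proof.
move=> e0.
have le_geo k : delta k <= delta 0 * xi2 ^+ k.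
  elim: k => [|k IH]; first by rewrite mulr1.
  have x0 : 0 <= xi2 by rewrite (le_trans (ltW xi1_gt0)).
  by rewrite (le_trans (delta_dec k))// exprS mulrCA ler_wpM2l.
have c0 : delta 0 * xi2 ^+ k @[k --> \oo] --> 0.
  apply: cvg_geometric.
  by rewrite ger0_norm// (le_trans (ltW xi1_gt0)).
have /cvgrPdist_le/(_ _ e0)[N _ NP] := c0.
exists N => k /NP; rewrite sub0r normrN => h.
by rewrite (le_trans (le_geo k))// (le_trans (ler_norm _)).
Qed.

Variables (X : normedModType R) (D : R).
Hypothesis D_ge0 : 0 <= D.
Hypothesis X_complete : seq_complete X.

(** The increments telescope: D delta_i is at most
    D / (1 - xi2) (delta_i - delta_{i+1}). *)
Lemma geometric_cauchy (u : nat -> X) k j :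
  (forall i, `|u i - u i.+1| <= D * delta i) -> (k <= j)%N ->
  `|u k - u j| <= D / (1 - xi2) * delta k.
Proof.
move=> uD /subnK <-; rewrite addnC; move: (j - k)%N => {}j.
have h1 : 0 < 1 - xi2 by rewrite subr_gt0.
suff : `|u k - u (k + j)%N| <= D / (1 - xi2) * (delta k - delta (k + j)%N).
  move=> /le_trans; apply; rewrite ler_wpM2l ?divr_ge0 ?(ltW h1)//.
  by rewrite gerBl ltW.
elim: j => [|j IH]; first by rewrite addn0 !subrr normr0 mulr0.
rewrite (le_trans (ler_distD (u (k + j)%N) _ _))//.
rewrite (le_trans (lerD IH (_ : _ <= D / (1 - xi2) *
  (delta (k + j)%N - delta (k + j).+1))))//; last by rewrite -mulrDr addnS; lra.
rewrite addnS (le_trans (uD _))// -mulrA ler_wpM2l// ler_pdivlMl//.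
by have := delta_dec (k + j)%N; lra.
Qed.

Lemma geometric_limit (u : nat -> X) :
  (forall i, `|u i - u i.+1| <= D * delta i) ->
  exists l, forall k, `|u k - l| <= D / (1 - xi2) * delta k.
Proof.
move=> uD; have C0 : 0 <= D / (1 - xi2) by rewrite divr_ge0// subr_ge0 ltW.
have h1 : 0 < D / (1 - xi2) + 1 by rewrite ltr_wpDl.
have [e e0|l lP] := X_complete (u := u).
  have [N NP] := scale_small (divr_gt0 e0 h1).
  have key m n : (N <= m)%N -> (m <= n)%N -> `|u m - u n| <= e.
    move=> Nm mn; rewrite (le_trans (geometric_cauchy uD mn))//.
    rewrite (le_trans (_ : _ <= (D / (1 - xi2) + 1) * delta m))//.
      by rewrite ler_wpM2r ?(ltW (delta_gt0 _))// lerDl.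
    by rewrite -ler_pdivlMl// mulrC NP.
  exists N => m n Nm Nn; have [mn|/ltnW nm] := leqP m n; first exact: key.
  by rewrite distrC; exact: key.
exists l => k; apply/ler_addgt0Pr => e e0; have [N NP] := lP e e0.
rewrite (le_trans (ler_distD (u (maxn k N)) _ _))// lerD//.
  by apply: geometric_cauchy => //; exact: leq_maxl.
by apply: NP; exact: leq_maxr.
Qed.

Variable s : R.
Hypothesis s_ge1 : 1 <= s.
Variable g : nat -> R -> X.
Hypothesis g_succ : forall k (x : R), 0 <= x -> `|g k x - g k.+1 x| <= D * delta k.
Hypothesis g_coarse : forall k (x y : R), 0 <= x -> 0 <= y -> `|x - y| < delta k `^ s ->
  `|g k x - g k y| <= D * delta k.
Hypothesis g_diam : forall x y : R, 0 <= x -> 0 <= y -> `|g 0 x - g 0 y| <= D * delta 0.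

(** For x and y at distance h, the maps are compared at the level k with
    delta_{k+1}^s <= h < delta_k^s: there g_k moves by at most D delta_k between
    x and y and is within D / (1 - xi2) delta_k of the limit. *)
Lemma holder_limit : exists f : R -> X,
  (forall k (x : R), 0 <= x -> `|g k x - f x| <= D / (1 - xi2) * delta k) /\
  (forall x y : R, 0 <= x -> 0 <= y -> `|f x - f y| <=
     (2 * (D / (1 - xi2)) + D) / xi1 * `|x - y| `^ s^-1).
Proof.
have s0 : 0 < s by rewrite (lt_le_trans ltr01).
have C0 : 0 <= D / (1 - xi2) by rewrite divr_ge0// subr_ge0 ltW.
have /choice[f fP] : forall x : R, exists l, 0 <= x ->
    forall k, `|g k x - l| <= D / (1 - xi2) * delta k.
  move=> x; have [x0|x0] := leP 0 x; last by exists 0.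
  have [l lP] := geometric_limit (fun k => g_succ k x0).
  by exists l.
exists f; split=> [k x x0|x y x0 y0]; first exact: fP.
have [->|xy] := eqVneq x y.
  by rewrite !subrr !normr0 powR0 ?invr_eq0 ?gt_eqF// mulr0.
set h : R := `|x - y|.
have h0 : 0 < h by rewrite normr_gt0 subr_eq0.
have [N0 N0P] : exists N, delta N `^ s <= h.
  have [N /(_ N (leqnn N)) NP] := scale_small (powR_gt0 s^-1 h0).
  exists N; rewrite -[leRHS](powRr1 (ltW h0)) -(mulVf (lt0r_neq0 s0)) powRrM.
  by rewrite ge0_ler_powR ?nnegrE ?powR_ge0// ltW.
have [N NP Nmin] := ex_minnP (ex_intro (fun N => delta N `^ s <= h) N0 N0P).
have NP' : delta N <= h `^ s^-1.
  rewrite -[leLHS](powRr1 (ltW (delta_gt0 N))) -(mulfV (lt0r_neq0 s0)) powRrM.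
  by rewrite ge0_ler_powR ?nnegrE ?powR_ge0 ?invr_ge0// ltW.
have [k [dk gk]] : exists k, delta k <= xi1^-1 * delta N /\
    `|g k x - g k y| <= D * delta k.
  case: N => [|k] in NP NP' Nmin *.
    exists 0%N; split; last exact: g_diam.
    rewrite ler_peMl ?ltW// invf_gt1// (le_lt_trans xi12)//.
  exists k; split; first by rewrite ler_pdivlMl.
  apply: g_coarse => //; rewrite ltNge; apply/negP => /Nmin.
  by rewrite ltnn.
rewrite (le_trans (_ : _ <= (2 * (D / (1 - xi2)) + D) * delta k))//.
  have := ler_distD (g k x) (f x) (f y); have := ler_distD (g k y) (g k x) (f y).
  have h1 := fP x x0 k; have h2 := fP y y0 k; rewrite distrC in h1.
  lra.
have E0 : 0 <= 2 * (D / (1 - xi2)) + D by rewrite addr_ge0// mulr_ge0.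
rewrite -mulrA ler_wpM2l// (le_trans dk)// ler_wpM2l// invr_ge0 ltW//.
Qed.

End geometric_scales.

Section flatten_blocks.
Variables (T : Type) (d : T) (P : seq (seq T)).

Definition offset (i : nat) : nat := sumn (shape (take i P)).

Lemma offset0 : offset 0 = 0%N. Proof. by rewrite /offset take0. Qed.

Lemma offsetS i : (i < size P)%N -> offset i.+1 = (offset i + size (nth [::] P i))%N.
Proof.
by move=> iP; rewrite /offset (take_nth [::])// /shape map_rcons sumn_rcons.
Qed.

Lemma offset_size : offset (size P) = size (flatten P).
Proof. by rewrite /offset take_size size_flatten. Qed.

Lemma nth_flatten_offset i j : (i < size P)%N -> (j < size (nth [::] P i))%N ->
  nth d (flatten P) (offset i + j) = nth d (nth [::] P i) j.
Proof.
move=> iP jP; rewrite -{1}(cat_take_drop i P) flatten_cat nth_cat.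
rewrite size_flatten -/(offset i) ltnNge leq_addr/= addKn.
by rewrite (drop_nth [::])//= nth_cat jP.
Qed.

Lemma sum_flatten_offset (R : realType) (F : T -> R) i : (i < size P)%N ->
  \sum_(offset i <= j < offset i.+1) F (nth d (flatten P) j) =
  \sum_(x <- nth [::] P i) F x.
Proof.
move=> iP; rewrite offsetS// -{1}[offset i]add0n big_addn addKn (big_nth d).
rewrite big_nat [RHS]big_nat; apply: eq_bigr => j /= jP.
by rewrite addnC nth_flatten_offset.
Qed.

End flatten_blocks.

(** L k is the tour of level k, cut by P k into the replacements of the nodes of
    the previous tour. *)
Section tours.
Variables (R : realType) (X : normedModType R) (delta : nat -> R) (xi1 xi2 D s : R).
Hypothesis xi1_gt0 : 0 < xi1.
Hypothesis xi12 : xi1 <= xi2.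
Hypothesis xi2_lt1 : xi2 < 1.
Hypothesis delta_gt0 : forall k, 0 < delta k.
Hypothesis delta_dec : forall k, delta k.+1 <= xi2 * delta k.
Hypothesis delta_lb : forall k, xi1 * delta k <= delta k.+1.
Hypothesis D_ge0 : 0 <= D.
Hypothesis s_ge1 : 1 <= s.
Hypothesis X_complete : seq_complete X.

Variables (T : eqType) (d : T) (src tgt : T -> X).
Variables (L : nat -> seq T) (P : nat -> seq (seq T)) (base pay : nat -> T -> R).
Variables (B0 B : R).
Hypothesis L0_gt0 : (0 < size (L 0))%N.
Hypothesis L_P : forall k, L k.+1 = flatten (P k).
Hypothesis P_size : forall k, size (P k) = size (L k).
Hypothesis P_gt0 : forall k, [::] \notin P k.
Hypothesis P_base : forall k i, (i < size (L k))%N ->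
  \sum_(e <- nth [::] (P k) i) base k.+1 e <=
  base k (nth d (L k) i) + pay k (nth d (L k) i).
Hypothesis P_src : forall k i e, (i < size (L k))%N -> e \in nth [::] (P k) i ->
  `|src (nth d (L k) i) - src e| <= D * delta k.
Hypothesis L_chain : forall k i, (i.+1 < size (L k))%N ->
  tgt (nth d (L k) i) = src (nth d (L k) i.+1).
Hypothesis L_diam : forall k e, e \in L k -> `|src e - tgt e| <= D * delta k.
Hypothesis L_base : forall k e, e \in L k -> src e <> tgt e -> delta k `^ s <= base k e.
Hypothesis L0_diam : forall e e', e \in L 0 -> e' \in L 0 ->
  `|src e - src e'| <= D * delta 0.
Hypothesis base_ge0 : forall k e, 0 <= base k e.
Hypothesis pay_ge0 : forall k e, 0 <= pay k e.
Hypothesis pay_sum : forall N, \sum_(0 <= k < N) \sum_(e <- L k) pay k e <= B.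
Hypothesis base_sum : \sum_(e <- L 0) base 0 e <= B0.
Hypothesis total_gt0 : 0 < B0 + B.

Let n k := size (L k).
Let o k := offset (P k).
Let nd k i := nth d (L k) i.
Let bs k i := base k (nd k i).
Let py k i := pay k (nd k i).

Let o0 k : o k 0 = 0%N. Proof. exact: offset0. Qed.

Let oS k i : (i < n k)%N -> (o k i < o k i.+1)%N.
Proof.
rewrite /n -P_size => ik; rewrite /o offsetS// -addn1 leq_add2l lt0n size_eq0.
by apply/negP => /eqP e; have /negP := P_gt0 k; apply; rewrite -e mem_nth.
Qed.

Let on k : o k (n k) = n k.+1.
Proof. by rewrite /o /n -P_size offset_size L_P. Qed.

Let n_gt0 k : (0 < n k)%N.
Proof.
elim: k => [//|k IH]; rewrite -on (leq_ltn_trans (leq0n (o k (n k).-1)))//.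
by rewrite -{2}(prednK IH) oS// prednK.
Qed.

Let refine k i : (i < n k)%N ->
  \sum_(o k i <= j < o k i.+1) bs k.+1 j <= bs k i + py k i.
Proof.
move=> ik; rewrite (le_trans _ (P_base ik))//.
by rewrite /bs /nd L_P sum_flatten_offset ?P_size.
Qed.

Let pysum N : \sum_(0 <= k < N) \sum_(0 <= i < n k) py k i <= B.
Proof.
rewrite (le_trans _ (pay_sum N))//; apply: ler_sum => k _.
by rewrite [leRHS](big_nth d).
Qed.

Let ps := pos n o bs py.
Let at_ := node_at n o bs py.

Let g k x := src (nd k (at_ k x)).

Let bs_ge0 k i : 0 <= bs k i. Proof. exact: base_ge0. Qed.

Let py_ge0 k i : 0 <= py k i. Proof. exact: pay_ge0. Qed.

Let mono k i j : (i <= j <= n k)%N -> ps k i <= ps k j.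
Proof. exact: pos_mono. Qed.

Let atP k x : 0 <= x -> (at_ k x < n k)%N /\ ps k (at_ k x) <= x.
Proof. by move=> x0; exact: node_atP. Qed.

Let g_succ k (x : R) : 0 <= x -> `|g k x - g k.+1 x| <= D * delta k.
Proof.
move=> x0; have [ik _] := atP k x0; apply: P_src => //.
have /andP[lo hi] : (o k (at_ k x) <= at_ k.+1 x < o k (at_ k x).+1)%N.
  exact: node_at_child.
have iP : (at_ k x < size (P k))%N by rewrite P_size.
rewrite /nd L_P -(subnKC lo) nth_flatten_offset//.
  by apply: mem_nth; rewrite ltn_subLR// -offsetS.
by rewrite ltn_subLR// -offsetS.
Qed.

(* A node too cheap for its level has equal ends, so a run of such nodes does not
   move. *)
Let skip k i j : (i < j)%N -> (j < n k)%N ->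
  (forall l, (i < l < j)%N -> bs k l < delta k `^ s) ->
  src (nd k j) = tgt (nd k i).
Proof.
move=> ij jk; elim: j ij jk => [//|j IH].
rewrite ltnS leq_eqVlt => /orP[/eqP<-|ij] jk H.
  by rewrite /nd L_chain.
rewrite -L_chain//; apply/esym; apply: contrapT => ne.
have jk' := ltnW jk.
have ji : src (nd k j) = tgt (nd k i).
  by apply: IH => // l /andP[il lj]; apply: H; rewrite il ltnW.
have ne' : src (nd k j) <> tgt (nd k j) by rewrite ji.
have jj : (i < j < j.+1)%N by rewrite ij ltnSn.
have := L_base (mem_nth d jk') ne'.
by have := H j jj; rewrite /bs /nd; lra.
Qed.

Let g_coarse k (x y : R) : 0 <= x -> 0 <= y -> `|x - y| < delta k `^ s ->
  `|g k x - g k y| <= D * delta k.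
Proof.
wlog ij : x y / (at_ k x <= at_ k y)%N.
  move=> W x0 y0 xy; have [h|/ltnW h] := leqP (at_ k x) (at_ k y); first exact: W.
  by rewrite distrC; apply: W => //; rewrite distrC.
move=> x0 y0 xy; move: ij; rewrite leq_eqVlt => /orP[/eqP e|ij].
  by rewrite /g e subrr normr0 mulr_ge0// ltW.
have [jk _] := atP k y0; have [ik _] := atP k x0.
rewrite /g (skip ij jk); first by rewrite L_diam// mem_nth.
move=> l lij; apply: le_lt_trans xy; rewrite distrC.
apply: le_trans (ler_norm _).
exact: (@between_nodes _ n o bs py).
Qed.

Let g_diam (x y : R) : 0 <= x -> 0 <= y -> `|g 0 x - g 0 y| <= D * delta 0.
Proof.
by move=> x0 y0; apply: L0_diam; apply: mem_nth;
  [have [] := atP 0 x0|have [] := atP 0 y0].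
Qed.

Let g_hits k e : e \in L k -> exists2 x : R, 0 <= x <= B0 + B & g k x = src e.
Proof.
move=> eL; pose i := index e (L k); have ik : (i < n k)%N by rewrite index_mem.
have <- : nd k i = e by rewrite /nd nth_index.
have x0 : 0 <= ps k i.
  by rewrite -(pos0 n o bs py k); apply: mono; rewrite leq0n (ltnW ik).
exists (ps k i).
  rewrite x0/=.
  have H1 : ps k i <= ps k (n k) by rewrite mono// (ltnW ik) leqnn.
  have : ps k (n k) <= \sum_(0 <= i < n 0%N) bs 0 i + B by exact: pos_end.
  have -> : \sum_(0 <= j < n 0%N) bs 0 j = \sum_(e <- L 0) base 0 e.
    by rewrite [RHS](big_nth d).
  by move/(le_trans H1); move: base_sum; lra.
have ge_i : (i <= at_ k (ps k i))%N by exact: node_at_max.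
have [jk jx] := atP k x0.
rewrite /g; set j := at_ k (ps k i) in ge_i jk jx *.
(* The nodes from i to j - 1 start at the same position as j, so they have
   length 0 and stay at the same point. *)
have flat l : (i <= l < j)%N -> bs k l < delta k `^ s.
  move=> /andP[il lj]; apply: le_lt_trans (powR_gt0 s (delta_gt0 k)).
  have lk := ltn_trans lj jk.
  have : bs k l <= ps k l.+1 - ps k l by exact: base_le_pos.
  have := @mono k l.+1 j; rewrite lj (ltnW jk) => /(_ isT).
  have := @mono k i l; rewrite il (ltnW lk) => /(_ isT).
  by move: jx; rewrite -/ps; lra.
move: ge_i; rewrite leq_eqVlt => /orP[/eqP<-//|ij].
rewrite (skip ij jk) => [|l /andP[il lj]]; last by rewrite flat// ltnW.
apply/esym; apply: contrapT => /(L_base (mem_nth d ik)).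
have ii : (i <= i < j)%N by rewrite leqnn.
by have := flat i ii; rewrite /bs /nd; lra.
Qed.

(** The limit is parametrized by time on [0, B0 + B] and rescaled to [0, 1]. A
    point p that every tour visits from level k0 on is a limit of values of the
    map, and the image of [0, 1] is closed. *)
Theorem tours_holder : exists f : R -> X,
  (forall x y : R, 0 <= x <= 1 -> 0 <= y <= 1 -> `|f x - f y| <=
     (2 * (D / (1 - xi2)) + D) / xi1 * (B0 + B) `^ s^-1 * `|x - y| `^ s^-1) /\
  (forall p k0, (forall k, (k0 <= k)%N -> exists2 e, e \in L k & src e = p) ->
     exists2 x : R, 0 <= x <= 1 & f x = p).
Proof.
have [f [fg fH]] := holder_limit xi1_gt0 xi12 xi2_lt1 delta_gt0 delta_dec
  delta_lb D_ge0 X_complete s_ge1 g_succ g_coarse g_diam.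
set H := (2 * (D / (1 - xi2)) + D) / xi1 in fH *.
have s0 : 0 < s by rewrite (lt_le_trans ltr01).
have C0 : 0 <= D / (1 - xi2) by rewrite divr_ge0// subr_ge0 ltW.
have H0 : 0 <= H by rewrite divr_ge0 ?(ltW xi1_gt0)// addr_ge0// mulr_ge0.
have M0 := total_gt0; set M := B0 + B in M0 *; set C := H * M `^ s^-1.
have Ch : 0 <= C by rewrite mulr_ge0 ?powR_ge0.
(* Extending by constants outside [0, 1] makes the map continuous on R. *)
pose clamp (x : R) : R := if x < 0 then 0 else if 1 < x then 1 else x.
have clamp01 x : 0 <= clamp x <= 1.
  by rewrite /clamp; case: ltP => ?; [|case: ltP => ?]; lra.
have clamp_id x : 0 <= x <= 1 -> clamp x = x.
  by move=> /andP[x0 x1]; rewrite /clamp !ltNge x0 x1.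
have clampB x y : `|clamp x - clamp y| <= `|x - y|.
  have := ler_norm (x - y); have := ler_norm (y - x); rewrite (distrC y x).
  move: `|x - y| => z; rewrite ler_norml /clamp.
  by do 4?[case: ltP => ?]; lra.
pose F x := f (M * clamp x).
have FH x y : `|F x - F y| <= C * `|x - y| `^ s^-1.
  have /andP[x0 x1] := clamp01 x; have /andP[y0 y1] := clamp01 y.
  rewrite (le_trans (fH _ _ (mulr_ge0 (ltW M0) x0)
    (mulr_ge0 (ltW M0) y0)))//.
  rewrite -mulrBr normrM (gtr0_norm M0) powRM ?normr_ge0 ?(ltW M0)//.
  rewrite mulrA ler_wpM2l// ge0_ler_powR ?nnegrE ?normr_ge0 ?invr_ge0//.
  exact: ltW.
exists F; split=> [x y _ _|p k0 hp]; first exact: FH.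
have Fc : continuous F.
  move=> x; apply/cvgrPdist_le => e e0.
  have C1 : 0 < C + 1 by rewrite ltr_wpDl.
  have r0 : 0 < (e / (C + 1)) `^ s by rewrite powR_gt0// divr_gt0.
  have : \forall y \near x, `|x - y| <= (e / (C + 1)) `^ s.
    have /cvgrPdist_le := @cvg_id _ (nbhs x); exact.
  apply: filterS => y yx.
  rewrite (le_trans (FH x y))// (le_trans (_ : _ <= (C + 1) * (e / (C + 1))))//.
    apply: ler_pM; rewrite ?powR_ge0//; first by rewrite lerDl.
    have -> : e / (C + 1) = ((e / (C + 1)) `^ s) `^ s^-1.
      by rewrite -powRrM mulfV ?lt0r_neq0// powRr1// ltW// divr_gt0.
    by rewrite ge0_ler_powR ?nnegrE ?powR_ge0 ?invr_ge0 ?normr_ge0 ?(ltW s0).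
  by rewrite mulrC divfK// lt0r_neq0.
have /compact_closed K : compact (F @` `[0, 1]).
  apply: continuous_compact; last exact: segment_compact.
  exact: continuous_subspaceT.
have : (F @` `[0, 1]) p.
  rewrite (closure_id (F @` `[0, 1])).1; last by apply: K; exact: norm_hausdorff.
  move=> U /nbhs_ballP[e /= e0 eU].
  have C1 : 0 < D / (1 - xi2) + 1 by rewrite ltr_wpDl.
  have [N NP] : exists N, forall k, (N <= k)%N -> delta k <= e / (D / (1 - xi2) + 1).
    by apply: (scale_small (xi1 := xi1) (xi2 := xi2)) => //; rewrite divr_gt0.
  have [e' e'L e'p] := hp (maxn k0 N) (leq_maxl _ _).
  have [x /andP[x0 xM] gx] := g_hits e'L.
  have xM01 : 0 <= x / M <= 1 by rewrite divr_ge0 ?(ltW M0)// ler_pdivrMr// mul1r.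
  have Fx : F (x / M) = f x by rewrite /F clamp_id// mulrC divfK// lt0r_neq0.
  exists (f x); split; first by exists (x / M); rewrite ?in_itv.
  apply: eU; rewrite -ball_normE /= -e'p -gx (le_lt_trans (fg _ _ x0))//.
  have := NP _ (leq_maxr k0 N).
  rewrite ler_pdivlMr ?ltr_wpDl// mulrC; apply: lt_le_trans.
  by rewrite ltr_pM2r ?delta_gt0// ltrDl.
by case=> x /=; rewrite in_itv/= => x01 <-; exists x.
Qed.
End tours.

(** * Separated sets close to a line *)

Section inner_product.
Context {R : realType} {X : innerProductType R}.
Implicit Types (x y z w : X) (l : line X).

Lemma innerDl x y z : inner (x + y) z = inner x z + inner y z.
Proof. by rewrite -[x in LHS]scale1r innerPl mul1r. Qed.

Lemma inner0l z : inner 0 z = 0.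
Proof. by apply: (addrI (inner 0 z)); rewrite -innerDl !addr0. Qed.

Lemma innerZl a x z : inner (a *: x) z = a * inner x z.
Proof. by rewrite -[a *: x]addr0 innerPl inner0l addr0. Qed.

Lemma innerNl x z : inner (- x) z = - inner x z.
Proof. by rewrite -scaleN1r innerZl mulN1r. Qed.

Lemma innerBl x y z : inner (x - y) z = inner x z - inner y z.
Proof. by rewrite innerDl innerNl. Qed.

Lemma innerBr x y z : inner z (x - y) = inner z x - inner z y.
Proof. by rewrite innerC innerBl !(innerC z). Qed.

Lemma innerDr x y z : inner z (x + y) = inner z x + inner z y.
Proof. by rewrite innerC innerDl !(innerC z). Qed.

Lemma innerZr a x z : inner z (a *: x) = a * inner z x.
Proof. by rewrite innerC innerZl innerC. Qed.

Lemma normB_cosine x y z :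
  `|x - z| ^+ 2 = `|x - y| ^+ 2 + `|z - y| ^+ 2 - 2 * inner (x - y) (z - y).
Proof.
rewrite -!inner_norm !(innerBl, innerBr).
rewrite (innerC y x) (innerC z x) (innerC z y); ring.
Qed.

(** This is how betweenness gives inequalities between distances. *)
Lemma obtuse x y z : inner (x - y) (z - y) < 0 -> `|x - y| < `|x - z|.
Proof.
move=> xyz; rewrite -(ltr_pXn2r (n := 2)) ?nnegrE// (normB_cosine x y z).
by have := sqr_ge0 `|z - y|; lra.
Qed.

Lemma cauchy_schwarz x y : `|inner x y| <= `|x| * `|y|.
Proof.
have key (u v : X) : inner u v <= `|u| * `|v|.
  have : `|u + v| ^+ 2 <= (`|u| + `|v|) ^+ 2.
    by rewrite ler_pXn2r ?nnegrE ?addr_ge0// ler_normD.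
  rewrite sqrrD -!inner_norm. rewrite innerDl !innerDr (innerC v u) mulr2n; lra.
rewrite ler_norml key andbT -lerNl -innerNl -(normrN x).
exact: key.
Qed.

Definition line_perp l x : X := (x - line_pt l) - line_pos l x *: line_dir l.

Lemma line_perp_dir l x : inner (line_perp l x) (line_dir l) = 0.
Proof.
by rewrite innerBl innerZl inner_norm line_dir1 expr1n mulr1 /line_pos subrr.
Qed.

Lemma line_decomp l x y : x - y =
  (line_pos l x - line_pos l y) *: line_dir l + (line_perp l x - line_perp l y).
Proof.
rewrite scalerBl /line_perp; set a := _ *: _; set b := _ *: _.
rewrite [RHS]addrACA -opprD [a + _]addrC [b + _]addrC !subrK.
by rewrite opprB addrA subrK.
Qed.

Lemma line_posB l x y : line_pos l x - line_pos l y = inner (x - y) (line_dir l).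
Proof. by rewrite /line_pos -innerBl opprB addrA subrK. Qed.

Lemma inner_decomp l x y z w : inner (x - y) (z - w) =
  (line_pos l x - line_pos l y) * (line_pos l z - line_pos l w) +
  inner (line_perp l x - line_perp l y) (line_perp l z - line_perp l w).
Proof.
have perp0 u v : inner (line_perp l u - line_perp l v) (line_dir l) = 0.
  by rewrite innerBl !line_perp_dir subrr.
rewrite (line_decomp l x y) (line_decomp l z w).
move: (perp0 x y) (perp0 z w).
move: (line_perp l x - _) (line_perp l z - _) => q1 q2 h1 h2.
rewrite innerDl !innerDr !innerZl !innerZr inner_norm line_dir1 expr1n mulr1.
by rewrite h1 [inner (line_dir l) _]innerC h2 !mulr0 addr0 add0r.
Qed.

Lemma perp_le_dist l x : `|line_perp l x| <= dist_line x l.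
Proof.
apply: lb_le_inf.
  exists `|x - line_pt l|, (line_pt l) => //.
  by exists 0; rewrite ?scale0r ?addr0.
move=> _ [_ [t _ <-] <-]; set y := line_pt l + _.
rewrite -(ler_pXn2r (n := 2)) ?nnegrE// -2!inner_norm (inner_decomp l x y x y).
have -> : line_perp l y = 0.
  rewrite /line_perp /line_pos /y [line_pt l + _]addrC addrK innerZl inner_norm.
  by rewrite line_dir1 expr1n mulr1 subrr.
by rewrite subr0 lerDr -expr2 sqr_ge0.
Qed.

Lemma norm_perp_le l x y :
  `|line_perp l x - line_perp l y| <= `|line_perp l x| + `|line_perp l y|.
Proof. exact: ler_normB. Qed.

Lemma line_pos_le l x y : `|line_pos l x - line_pos l y| <= `|x - y|.
Proof. by rewrite line_posB (le_trans (cauchy_schwarz _ _))// line_dir1 mulr1. Qed.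

End inner_product.

(** Two points of N are d apart or more but leave the line by at most d / 16 each:
    their difference is almost parallel to the line. *)
Section flat_set.
Context {R : realType} {X : innerProductType R} (l : line X) (N : set X) (d : R).
Hypothesis d_gt0 : 0 < d.
Hypothesis N_sep : forall x y, N x -> N y -> x <> y -> d <= `|x - y|.
Hypothesis N_near : forall x, N x -> dist_line x l <= 16^-1 * d.
Local Notation p := (line_pos l).

Let perp_small x y : N x -> N y -> `|line_perp l x - line_perp l y| <= 8^-1 * d.
Proof.
move=> xN yN; apply: le_trans (norm_perp_le _ _ _) _.
have := le_trans (perp_le_dist l x) (N_near xN).
by have := le_trans (perp_le_dist l y) (N_near yN); lra.
Qed.

Lemma flat_dist x y : N x -> N y -> `|x - y| <= 7 / 6 * `|p x - p y|.
Proof.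
move=> xN yN; have [->|/eqP xy] := eqVneq x y; first by rewrite !subrr !normr0 mulr0.
have xyd := N_sep xN yN xy.
have q := le_trans (perp_small xN yN) (ler_wpM2l (ltac:(lra) : 0 <= 8^-1 :> R) xyd).
have := inner_decomp l x y x y; rewrite !inner_norm => e.
have q2 : `|line_perp l x - line_perp l y| ^+ 2 <= (8^-1 * `|x - y|) ^+ 2.
  by rewrite ler_pXn2r ?nnegrE// mulr_ge0.
rewrite -(ler_pXn2r (n := 2)) ?nnegrE ?mulr_ge0//.
rewrite [leRHS]exprMn real_normK ?num_real//.
move: e q2 (sqr_ge0 (p x - p y)); rewrite exprMn -[(p x - p y) * _]expr2.
by move: (_ ^+ 2) (_ ^+ 2) (_ ^+ 2) => a b c; lra.
Qed.

Lemma flat_pos_neq x y : N x -> N y -> x <> y -> p x != p y.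
Proof.
move=> xN yN xy; apply/eqP => e; have := flat_dist xN yN.
rewrite e subrr normr0 mulr0 leNgt => /negP; apply.
exact: lt_le_trans d_gt0 (N_sep xN yN xy).
Qed.

(* The perpendicular parts contribute less to the inner product than the parts
   along the line. *)
Let sign_aux x y z : N x -> N y -> N z -> x <> y -> z <> y ->
  `|inner (x - y) (z - y) - (p x - p y) * (p z - p y)| <
  `|(p x - p y) * (p z - p y)|.
Proof.
move=> xN yN zN xy zy; rewrite (inner_decomp l) addrC addKr.
apply: le_lt_trans (cauchy_schwarz _ _) _; rewrite normrM.
have h1 := flat_dist xN yN; have h2 := flat_dist zN yN.
have := N_sep xN yN xy; have := N_sep zN yN zy => h3 h4.
have q1 : `|line_perp l x - line_perp l y| < `|p x - p y|.
  by have := perp_small xN yN; nlra.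
have q2 : `|line_perp l z - line_perp l y| < `|p z - p y|.
  by have := perp_small zN yN; nlra.
by apply: ltr_pM.
Qed.

(** Whether x and z lie on the same side of y can be read off from the inner
    product of x - y and z - y, without the line. Two lines close to the same points
    therefore agree on it. *)
Lemma flat_inner_gt0 x y z : N x -> N y -> N z -> x <> y -> z <> y ->
  (0 < inner (x - y) (z - y)) = (0 < (p x - p y) * (p z - p y)).
Proof.
move=> xN yN zN xy zy; have := sign_aux xN yN zN xy zy.
move: (inner _ _) (_ * _) => a b; rewrite ltr_norml.
have [b0|b0|<-] := ltgtP 0 b; last by rewrite normr0 oppr0 => /andP[h1 h2]; lra.
  by rewrite (gtr0_norm b0) => /andP[h1 h2]; apply/idP/idP; lra.
by rewrite (ltr0_norm b0) => /andP[h1 h2]; apply/idP/idP; lra.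
Qed.

Lemma flat_inner_lt0 x y z : N x -> N y -> N z -> x <> y -> z <> y ->
  (inner (x - y) (z - y) < 0) = ((p x - p y) * (p z - p y) < 0).
Proof.
move=> xN yN zN xy zy; have := sign_aux xN yN zN xy zy.
move: (inner _ _) (_ * _) => a b; rewrite ltr_norml.
have [b0|b0|<-] := ltgtP 0 b; last by rewrite normr0 oppr0 => /andP[h1 h2]; lra.
  by rewrite (gtr0_norm b0) => /andP[h1 h2]; apply/idP/idP; lra.
by rewrite (ltr0_norm b0) => /andP[h1 h2]; apply/idP/idP; lra.
Qed.

End flat_set.

(** * Sorted lists, chains of nodes and removal of duplicates *)

Section sorted_keys.
Context {R : realType} {T : eqType}.
Variable key : T -> R.
Local Notation lt_key := (fun x y => key x < key y).

Lemma lt_key_trans : transitive lt_key.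
Proof. by move=> y x z; exact: lt_trans. Qed.

Lemma sorted_split t l1 u l2 : sorted lt_key t -> t = l1 ++ u :: l2 ->
  (forall x, x \in l1 -> key x < key u) /\ (forall x, x \in l2 -> key u < key x).
Proof.
rewrite sorted_pairwise; last exact: lt_key_trans.
move=> st e; move: st; rewrite e pairwise_cat /=.
move=> /and3P[/allrelP a1 _ /andP[/allP a2 _]].
by split=> x xl; [apply: a1 => //; rewrite mem_head|exact: a2].
Qed.

(** Neighbours in a sorted list leave no room for a third key. *)
Lemma sorted_gap t l1 u u' l2 z : sorted lt_key t -> t = l1 ++ u :: u' :: l2 ->
  z \in t -> key u < key z -> key z < key u' -> False.
Proof.
move=> st e zt uz zu'.
have [a1 _] := sorted_split st e.
have [_ a2] : (forall x, x \in rcons l1 u -> key x < key u') /\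
    (forall x, x \in l2 -> key u' < key x).
  by apply: (sorted_split st); rewrite e cat_rcons.
move: zt; rewrite e mem_cat !inE => /orP[/a1|/or3P[/eqP zE|/eqP zE|/a2]].
- by rewrite ltNge ltW.
- by rewrite zE ltxx in uz.
- by rewrite zE ltxx in zu'.
- by rewrite ltNge ltW.
Qed.

End sorted_keys.

Section segment_sums.
Context {R : realType} {X : normedModType R}.
Implicit Types (f : R -> R) (t : seq X).

Definition segsum f t : R :=
  \sum_(i < (size t).-1) f `|t`_i.+1 - t`_i|.

Lemma segsum1 f x : segsum f [:: x] = 0.
Proof. by rewrite /segsum big_ord0. Qed.

Lemma segsum_cons f x y l : segsum f [:: x, y & l] = f `|x - y| + segsum f (y :: l).
Proof. by rewrite /segsum /= big_ord_recl /= distrC. Qed.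

Lemma segsum_rev f t : segsum f (rev t) = segsum f t.
Proof.
rewrite /segsum size_rev.
rewrite (reindex_inj rev_ord_inj)/=; apply: eq_bigr => i _.
have ni := ltn_ord i.
rewrite !nth_rev; [|lia|lia]; rewrite distrC.
by congr (f `|_`__ - _`__|); lia.
Qed.

Lemma segsum_ge0 f t : (forall x, 0 <= x -> 0 <= f x) -> 0 <= segsum f t.
Proof. by move=> f0; apply: sumr_ge0 => i _; rewrite f0. Qed.

End segment_sums.

(** [Edge u u' true] is traversed from u to u', [Edge u u' false] from u' to u; in
    both cases u is the vertex whose line orders the pair. [Loose v b] is the side
    b of v. *)
Inductive node (X : Type) :=
| Stop of X
| Loose of X & bool
| Edge of X & X & bool
| Bridge of X & X.

HB.instance Definition _ (X : Type) := gen_eqMixin (node X).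

Section nodes.
Context {X : Type}.
Implicit Types (e : node X) (l : seq (node X)).

Definition src e : X :=
  match e with
  | Stop v | Loose v _ => v
  | Edge u u' c => if c then u else u'
  | Bridge x _ => x
  end.

Definition tgt e : X :=
  match e with
  | Stop v | Loose v _ => v
  | Edge u u' c => if c then u' else u
  | Bridge _ y => y
  end.

Fixpoint chain (x : X) l (y : X) : Prop :=
  if l is e :: l' then x = src e /\ chain (tgt e) l' y else x = y.

Lemma chain_cat x y z l1 l2 : chain x l1 y -> chain y l2 z -> chain x (l1 ++ l2) z.
Proof. by elim: l1 x => [x ->//|e l1 IH] x /= [-> h] h2; split => //; exact: IH. Qed.

Lemma chain_nth d x l y i : chain x l y -> (i.+1 < size l)%N ->
  tgt (nth d l i) = src (nth d l i.+1).
Proof.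
elim: l x i => [//|e l IH] x [|i] /= [_ c] il; last exact: IH c il.
by case: l c il {IH} => [//|e' l] [].
Qed.

Definition payable e : bool :=
  match e with Stop _ | Edge _ _ _ => true | _ => false end.

(** A bridge between the same ends keeps a chain connected and is not more
    expensive than the node it replaces. *)
Definition strip e : node X := Bridge (src e) (tgt e).

(** The payments are bounded by sums over distinct vertices and pairs, so only
    the first occurrence of a stop or an edge is kept. *)
Fixpoint dedup (seen : seq (node X)) l : seq (node X) :=
  if l is e :: l' then
    (if payable e && (e \in seen) then strip e else e) :: dedup (e :: seen) l'
  else [::].

(** The same operation, keeping track of the replacement each node belongs to. *)
Fixpoint dedups (seen : seq (node X)) (P : seq (seq (node X))) : seq (seq (node X)) :=
  if P is c :: P' then dedup seen c :: dedups (catrev c seen) P' else [::].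

Lemma dedup_cat seen l1 l2 :
  dedup seen (l1 ++ l2) = dedup seen l1 ++ dedup (catrev l1 seen) l2.
Proof. by elim: l1 seen => [//|e l1 IH] seen /=; rewrite IH. Qed.

Lemma flatten_dedups seen P : flatten (dedups seen P) = dedup seen (flatten P).
Proof. by elim: P seen => [//|c P IH] seen /=; rewrite IH dedup_cat. Qed.

Lemma size_dedups seen P : size (dedups seen P) = size P.
Proof. by elim: P seen => [//|c P IH] seen /=; rewrite IH. Qed.

Lemma nth_dedups seen P i : (i < size P)%N ->
  exists seen', nth [::] (dedups seen P) i = dedup seen' (nth [::] P i).
Proof.
elim: P seen i => [//|c P IH] seen [|i] /= iP; first by exists seen.
exact: IH.
Qed.

Lemma dedup_eq0 seen l : (dedup seen l == [::]) = (l == [::]).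
Proof. by case: l. Qed.

Lemma chain_dedup x seen l y : chain x l y -> chain x (dedup seen l) y.
Proof.
elim: l x seen => [//|e l IH] x seen /= [-> c].
by case: ifP => _ /=; split => //; exact: IH.
Qed.

Lemma mem_dedup seen l e : e \in l -> e \notin seen -> e \in dedup seen l.
Proof.
elim: l seen => [//|e' l IH] seen; rewrite inE /=.
have [<- _ /negbTE es|ee' /= el es] := eqVneq e e'; first by rewrite es andbF mem_head.
by rewrite inE IH ?orbT// inE negb_or ee'.
Qed.

Lemma dedup_mem seen l e : e \in dedup seen l ->
  e \in l \/ exists2 e', e' \in l & payable e' /\ e = strip e'.
Proof.
elim: l seen => [//|e' l IH] seen /=; rewrite inE => /orP[/eqP->|/IH].
  case: ifP => [/andP[pe _]|_]; last by left; rewrite mem_head.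
  by right; exists e'; rewrite ?mem_head.
case=> [el|[e'' el h]]; first by left; rewrite inE el orbT.
by right; exists e''; rewrite ?inE ?el ?orbT.
Qed.

Lemma dedup_uniq seen l : uniq [seq e <- dedup seen l | payable e] /\
  (forall e, e \in dedup seen l -> payable e -> e \notin seen).
Proof.
elim: l seen => [//|e l IH] seen /=; have [u n] := IH (e :: seen).
case: (boolP (payable e && (e \in seen))) => [/andP[pe _]|np] /=.
  split=> // e'; rewrite inE => /orP[/eqP->//|/n h /h].
  by rewrite inE negb_or => /andP[].
split.
  case: ifP => //= pe; rewrite u andbT mem_filter pe /=; apply/negP => /n/(_ pe).
  by rewrite mem_head.
move=> e'; rewrite inE => /orP[/eqP-> pe|/n h /h]; last by rewrite inE negb_or => /andP[].
by move: np; rewrite pe.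
Qed.

Lemma sum_dedup (R : realType) (F : node X -> R) seen l :
  (forall e, e \in l -> payable e -> F (strip e) <= F e) ->
  \sum_(e <- dedup seen l) F e <= \sum_(e <- l) F e.
Proof.
elim: l seen => [|e l IH] seen Fl; first by rewrite !big_nil.
rewrite /= !big_cons lerD ?IH//; last by move=> e' el; apply: Fl; rewrite inE el orbT.
by case: ifP => [/andP[pe _]|//]; rewrite Fl ?mem_head.
Qed.

End nodes.

(** D bounds the jumps of the tours and c1 the cost of a spoke of a star, both
    relative to the scale; c2 r0^s (1 + S) bounds the length of the parameter
    interval. *)
Definition holder_const (R : realType) (s Cstar xi1 xi2 : R) : R :=
  let A := Astar Cstar xi2 in
  let D := 28 * A / xi1 in
  let c1 := 2 * ((14 * A) `^ s / 2) + 4 * Cstar in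
  let c2 := 6 * (14 * A) `^ s + 2 * c1 * (2 + (1 + 5 * Cstar)) in
  (2 * (D / (1 - xi2)) + D) / xi1 * c2 `^ s^-1.

(** * The order around a good vertex *)

Section construction.
Context {R : realType} {X : innerProductType R}.
Variables (s Cstar xi1 xi2 : R) (x0 : X) (r0 : R).
Variables (V : nat -> set X) (rho : nat -> R).
Variables (alpha : nat -> X -> R) (ell : nat -> X -> line X) (alpha0 : R).
Hypothesis hs : 1 <= s.
Hypothesis hC : 1 <= Cstar.
Hypothesis hxi1 : 0 < xi1.
Hypothesis hxi12 : xi1 <= xi2.
Hypothesis hxi2 : xi2 < 1.
Hypothesis hr0 : 0 < r0.
Hypothesis nets : flat_nets Cstar xi1 xi2 x0 r0 V rho alpha ell.
Hypothesis halpha0 : 0 < alpha0 <= 16^-1.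

Local Notation A := (Astar Cstar xi2).
Local Notation flat k := (Flat Cstar xi2 r0 V rho alpha ell alpha0 k).
Local Notation Vbtw := (Vbetween Cstar xi2 r0 V rho ell).

Let d k := rho k * r0.
Let p k v := line_pos (ell k v).
Let good k v := alpha k v < alpha0.

Lemma d_gt0 k : 0 < d k.
Proof. by rewrite mulr_gt0// (rho_gt0 nets). Qed.
Local Hint Resolve d_gt0 : core.

Lemma d_dec k : d k.+1 <= xi2 * d k.
Proof.
have [_ /(_ k)/andP[_ h]] := nets_V0 nets.
by rewrite /d mulrA ler_pM2r.
Qed.

Lemma d_lb k : xi1 * d k <= d k.+1.
Proof.
have [_ /(_ k)/andP[h _]] := nets_V0 nets.
by rewrite /d mulrA ler_pM2r.
Qed.

Lemma dS_le k : d k.+1 <= d k.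
Proof. by rewrite (le_trans (d_dec k))// ger_pMl// ltW. Qed.

Lemma C_le_A : Cstar <= A.
Proof. by rewrite /Astar ler_pdivlMr ?subr_gt0//; move: hxi1 hxi12 hC; nra. Qed.

Lemma A_ge1 : 1 <= A.
Proof. exact: le_trans hC C_le_A. Qed.
Local Hint Resolve A_ge1 C_le_A : core.

Lemma A_gt0 : 0 < A. Proof. exact: lt_le_trans ltr01 A_ge1. Qed.

Lemma Ad_gt0 k : 0 < A * d k. Proof. exact: mulr_gt0 A_gt0 (d_gt0 k). Qed.
Local Hint Resolve Ad_gt0 : core.

Lemma Ad_ge k : Cstar * d k <= A * d k.
Proof. by rewrite ler_pM2r. Qed.

Lemma d_le_Cd k : d k <= Cstar * d k.
Proof. by rewrite ler_peMl// ltW. Qed.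

Lemma near_ballE k (v x : X) :
  Defs.near_ball Cstar xi2 r0 rho k v x <-> `|v - x| < 14 * (A * d k).
Proof. by rewrite /Defs.near_ball -ball_normE /= /d !mulrA. Qed.

Lemma V_sep k v w : V k v -> V k w -> v <> w -> d k <= `|v - w|.
Proof. exact: (nets_V3 nets). Qed.

Lemma V_sub k : V k `<=` V k.+1. Proof. exact: (nets_V2 nets). Qed.

(* Points near v whose distance to the line at (k, v) is under control. *)
Let nbh k v : set X := [set x | V k.+1 x /\ `|v - x| < 30 * (A * d k)].

Lemma nbh_self k v : V k v -> nbh k v v.
Proof.
move=> vk; split; first exact: V_sub.
by rewrite subrr normr0 mulr_gt0.
Qed.

Lemma nbh_sep k v x y : nbh k v x -> nbh k v y -> x <> y -> d k.+1 <= `|x - y|.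
Proof. by move=> [xV _] [yV _]; exact: V_sep. Qed.

Lemma nbh_near k v : V k v -> good k v -> forall x, nbh k v x ->
  dist_line x (ell k v) <= 16^-1 * d k.+1.
Proof.
move=> vk gv x [xV xv]; have [al0 al] := nets_V5 nets vk.
have xb : (V k.+1 `&` ball v (30 * A * rho k * r0)) x.
  by split => //; rewrite -ball_normE /=; move: xv; rewrite /d !mulrA.
apply: le_trans (al x xb) _.
rewrite -mulrA ler_wpM2r ?(ltW (d_gt0 _))//; have /andP[_ h] := halpha0.
exact: le_trans (ltW gv) h.
Qed.

Section good_vertex.
Variables (k : nat) (v : X).
Hypothesis vk : V k v.
Hypothesis gv : good k v.

Lemma nbh_dist x y : nbh k v x -> nbh k v y -> `|x - y| <= 7 / 6 * `|p k v x - p k v y|.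
Proof. exact: (flat_dist (@nbh_sep k v) (nbh_near vk gv)). Qed.

Lemma nbh_pos_neq x y : nbh k v x -> nbh k v y -> x <> y -> p k v x != p k v y.
Proof. exact: (flat_pos_neq (d_gt0 k.+1) (@nbh_sep k v) (nbh_near vk gv)). Qed.

Lemma nbh_gt0 x y z : nbh k v x -> nbh k v y -> nbh k v z -> x <> y -> z <> y ->
  (0 < inner (x - y) (z - y)) = (0 < (p k v x - p k v y) * (p k v z - p k v y)).
Proof. exact: (flat_inner_gt0 (d_gt0 k.+1) (@nbh_sep k v) (nbh_near vk gv)). Qed.

Lemma nbh_lt0 x y z : nbh k v x -> nbh k v y -> nbh k v z -> x <> y -> z <> y ->
  (inner (x - y) (z - y) < 0) = ((p k v x - p k v y) * (p k v z - p k v y) < 0).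
Proof. exact: (flat_inner_lt0 (d_gt0 k.+1) (@nbh_sep k v) (nbh_near vk gv)). Qed.

End good_vertex.

Let side k v y : bool := p k v v < p k v y.

Lemma same_side k v x y : V k v -> good k v -> nbh k v x -> nbh k v y ->
  x <> v -> y <> v -> (side k v x == side k v y) = (0 < inner (x - v) (y - v)).
Proof.
move=> vk gv xN yN xv yv; have vN := nbh_self vk.
rewrite (nbh_gt0 vk gv)// /side.
have := nbh_pos_neq vk gv xN vN xv; have := nbh_pos_neq vk gv yN vN yv.
rewrite !neq_lt; set px := p k v x; set py := p k v y; set pv := p k v v.
move=> /orP[h|h] /orP[h'|h']; rewrite ?h ?h' ?(lt_gtF h) ?(lt_gtF h') ?eqxx;
  apply/esym; apply/idP => //=; rewrite -?leNgt; nra.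
Qed.

(* The lists along which walks go: points of V_{k+1}, in the order of the line at
   (k, a) or in the reverse order, that miss no point lying between two of
   them. *)
Let track k a (t : seq X) : Prop :=
  [/\ forall x, x \in t -> V k.+1 x /\ `|a - x| < 14 * (A * d k),
      forall u u' z, u \in t -> u' \in t -> nbh k a z ->
        p k a u < p k a z -> p k a z < p k a u' -> z \in t &
      exists c : R, (c = 1 \/ c = -1) /\
        sorted (fun x y => c * p k a x < c * p k a y) t].

Section tracks.
Variables (k : nat) (a : X) (t : seq X).
Hypothesis ak : V k a.
Hypothesis ga : good k a.
Hypothesis tt : track k a t.

Lemma track_nbh x : x \in t -> nbh k a x.
Proof.
move=> xt; have [h _ _] := tt; have [xV ax] := h x xt; split => //.
by rewrite (lt_trans ax)// ltr_pM2r //; lra.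
Qed.

Lemma track_rev : track k a (rev t).
Proof.
have [h1 h2 [c [hc st]]] := tt; split.
- by move=> x; rewrite mem_rev; exact: h1.
- by move=> u u' z; rewrite !mem_rev; exact: h2.
- exists (- c); split; first by case: hc => ->; [right|left]; rewrite ?opprK.
  by rewrite rev_sorted; apply: sub_sorted st => x y; rewrite !mulNr ltrN2.
Qed.

(** A point that separates u from u' on the line at (k+1, u) would also do so on
    the line at (k, a), against the completeness of the track. *)
Lemma track_flat l1 u u' l2 : t = l1 ++ u :: u' :: l2 -> good k.+1 u ->
  `|u - u'| < 14 * (A * d k.+1) -> flat k.+1 (u, u').
Proof.
move=> e gu uu'; have [h1 h2 [c [hc st]]] := tt.
have ut : u \in t by rewrite e mem_cat mem_head orbT.
have u't : u' \in t by rewrite e mem_cat !inE eqxx !orbT.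
have [[uV au] [u'V _]] := (h1 _ ut, h1 _ u't).
have [_ lt_uu'] := sorted_split (key := fun x => c * p k a x) st e.
have {}lt_uu' := lt_uu' u' (mem_head _ _).
have uNu' : u <> u' by move=> euu'; rewrite euu' ltxx in lt_uu'.
have uN w : V k.+1 w -> `|u - w| < 14 * (A * d k.+1) -> nbh k.+1 u w.
  move=> wV uw; split; first exact: V_sub.
  by rewrite (lt_trans uw)// ltr_pM2r //; lra.
have gap w : V k.+1 w -> `|u - w| < 14 * (A * d k.+1) -> w <> u -> w <> u' ->
    0 <= (p k.+1 u u - p k.+1 u w) * (p k.+1 u u' - p k.+1 u w).
  move=> wV uw wu wu'; rewrite leNgt; apply/negP.
  rewrite -(nbh_lt0 uV gu)//; try by [exact: nbh_self|exact: uN|exact/nesym].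
  have wN : nbh k a w.
    split => //; rewrite (le_lt_trans (ler_distD u _ _))//.
    have h : A * d k.+1 <= A * d k by rewrite ler_pM2l ?A_gt0// dS_le.
    by have := Ad_gt0 k; nlra.
  rewrite (nbh_lt0 ak ga)//; try by [exact: track_nbh|exact/nesym].
  move=> hneg; have ltw : c * p k a u < c * p k a w /\ c * p k a w < c * p k a u'.
    by move: hneg lt_uu'; case: hc => ->; nra.
  apply: (sorted_gap (key := fun x => c * p k a x) st e _ ltw.1 ltw.2).
  by case: hc ltw => ->; rewrite ?mulN1r ?mul1r ?ltrN2 => -[? ?];
    [apply: (h2 u u')|apply: (h2 u' u)].
rewrite /Flat /=; split => //.
- by apply/andP; split; [exact: V_sep|move: uu'; rewrite /d !mulrA].
- have u'N : nbh k.+1 u u' by exact: uN.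
  have := nbh_pos_neq uV gu (nbh_self uV) u'N uNu'; rewrite neq_lt => /orP[h|h].
    right; split => //; first by split => //; apply/near_ballE.
    move=> w [wV /near_ballE uw] ltw; have [->//|/eqP wu'] := eqVneq w u'.
    have wu : w <> u by move=> wu; rewrite wu ltxx in ltw.
    have := gap w wV uw wu wu'; rewrite /p in h *; nra.
  left; split => //; first by split => //; apply/near_ballE.
  move=> w [wV /near_ballE uw] ltw; have [->//|/eqP wu'] := eqVneq w u'.
  have wu : w <> u by move=> wu; rewrite wu ltxx in ltw.
  have := gap w wV uw wu wu'; rewrite /p in h *; nra.
Qed.

Lemma track_neq l1 u u' l2 : t = l1 ++ u :: u' :: l2 -> u <> u'.
Proof.
move=> e euu'; have [_ _ [c [_ st]]] := tt.
have [_ lt] := sorted_split (key := fun x => c * p k a x) st e.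
by have := lt u' (mem_head _ _); rewrite euu' ltxx.
Qed.

Lemma track_between l1 u v w l2 : t = l1 ++ u :: v :: w :: l2 ->
  inner (u - v) (w - v) < 0.
Proof.
move=> e; have [_ _ [c [hc st]]] := tt.
have [_ lu] := sorted_split (key := fun x => c * p k a x) st e.
have [_ lv] := sorted_split (key := fun x => c * p k a x) st
  (etrans e (esym (cat_rcons _ _ _))).
have {}lu := lu v (mem_head _ _); have {}lv := lv w (mem_head _ _).
have [ut vt wt] : [/\ u \in t, v \in t & w \in t].
  by rewrite e !mem_cat !inE !eqxx !orbT.
rewrite (nbh_lt0 ak ga); try exact: track_nbh.
- by move: lu lv; case: hc => ->; nra.
- by move=> uv; rewrite uv ltxx in lu.
- by move=> wv; rewrite wv ltxx in lv.
Qed.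

Lemma track_head a0 y l z : t = a0 :: y :: l -> z \in y :: l ->
  0 < inner (y - a0) (z - a0).
Proof.
move=> e zl; have [_ _ [c [hc st]]] := tt.
have [_ la] := sorted_split (key := fun x => c * p k a x) (l1 := [::]) st e.
have {}la0 := la y (mem_head _ _); have {}laz := la z zl.
have [a0t yt zt] : [/\ a0 \in t, y \in t & z \in t].
  by rewrite e; split; rewrite in_cons ?zl ?mem_head ?eqxx ?orbT.
rewrite (nbh_gt0 ak ga); try exact: track_nbh.
- by move: la0 laz; case: hc => ->; nra.
- by move=> uv; rewrite uv ltxx in la0.
- by move=> wv; rewrite wv ltxx in laz.
Qed.

(** Each segment is at most 7/6 times its projection, and the projections
    telescope. *)
Lemma track_segsum x l : t = x :: l ->
  segsum id t <= 7 / 6 * `|p k a (last x l) - p k a x|.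
Proof.
have [_ _ [c [hc st]]] := tt.
suff H y m : (forall z, z \in y :: m -> nbh k a z) ->
    path (fun u v => c * p k a u < c * p k a v) y m ->
    segsum id (y :: m) <= 7 / 6 * (c * (p k a (last y m) - p k a y)).
  move=> e; move: st; rewrite e /= => st.
  rewrite (le_trans (H x l _ st))//; first by move=> z; rewrite -e; exact: track_nbh.
  rewrite ler_pM2l; last by lra.
  rewrite (le_trans (ler_norm _))// normrM.
  by case: hc => ->; rewrite ?normrN normr1 mul1r.
elim: m y => [|z m IH] y nb /=; first by rewrite segsum1 subrr !mulr0.
move=> /andP[yz zm]; rewrite segsum_cons.
have := IH z (fun w wz => nb w (mem_behead (s := y :: z :: m) wz)) zm.
have : `|y - z| <= 7 / 6 * (c * (p k a z - p k a y)).
  rewrite (le_trans (nbh_dist ak ga _ _))//; try by [apply: nb; rewrite !inE eqxx ?orbT].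
  rewrite ler_pM2l; last by lra.
  by rewrite ler_norml; move: yz; case: hc => ->; lra.
by move: (segsum _ _) => S; nlra.
Qed.

End tracks.

Lemma head_min (T : eqType) (key : T -> R) (t : seq T) a :
  sorted (fun x y => key x < key y) t -> a \in t ->
  (forall x, x \in t -> key a <= key x) -> exists l, t = a :: l.
Proof.
case: t => [//|h l] st; rewrite inE => /orP[/eqP->|al] am; first by exists l.
have [_ lt] := sorted_split (l1 := [::]) st erefl.
by have := am h (mem_head _ _); rewrite leNgt lt.
Qed.

(** * Points between two flat neighbours, and points on one side of a vertex *)

Section sort_track.
Variables (k : nat) (a : X) (S : set X) (c : R).
Hypothesis ak : V k a.
Hypothesis ga : good k a.
Hypothesis hc : c = 1 \/ c = -1.
Hypothesis S_near : forall x, S x -> V k.+1 x /\ `|a - x| < 14 * (A * d k).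
Hypothesis S_convex : forall u u' z, S u -> S u' -> nbh k a z ->
  p k a u < p k a z -> p k a z < p k a u' -> S z.

Let t := sort (fun x y => c * p k a x <= c * p k a y) (fset_set S).

Lemma finite_in_V : finite_set S.
Proof.
by apply: sub_finite_set (nets_finite nets k.+1) => x /S_near [].
Qed.

Lemma mem_sort_track x : x \in t <-> S x.
Proof.
rewrite mem_sort in_fset_set; first by split => [/set_mem|/mem_set].
apply: finite_in_V.
Qed.

Lemma sort_strict : sorted (fun x y => c * p k a x < c * p k a y) t.
Proof.
have le_trans' : transitive (fun x y => c * p k a x <= c * p k a y).
  by move=> y x z; exact: le_trans.
have u_t : uniq t by rewrite sort_uniq; exact: fset_uniq.
have : sorted (fun x y => c * p k a x <= c * p k a y) t.
  by apply: sort_sorted => x y; exact: le_total.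
have tS : forall x, x \in t -> nbh k a x.
  move=> x /mem_sort_track /S_near[xV xa]; split => //.
  by rewrite (lt_trans xa)// ltr_pM2r//; lra.
rewrite !sorted_pairwise//; last exact: lt_key_trans.
move: u_t tS; elim: (t) => [//|x l IH] /=.
move=> /andP[xl ul] tS /andP[/allP h hl]; apply/andP; split; last first.
  by apply: IH => // y yl; apply: tS; rewrite inE yl orbT.
apply/allP => y yl; rewrite lt_neqAle h// andbT.
have : p k a x != p k a y.
  apply: (nbh_pos_neq ak ga); [exact: tS (mem_head _ _)| |].
    by apply: tS; rewrite inE yl orbT.
  by move=> xy; rewrite xy yl in xl.
by apply: contra => /eqP; case: hc => ->; rewrite ?mulN1r ?mul1r;
  [|move/oppr_inj] => ->.
Qed.

Lemma sort_track : track k a t.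
Proof.
split.
- by move=> x /mem_sort_track; exact: S_near.
- move=> u u' z /mem_sort_track uS /mem_sort_track u'S zN h h'.
  by apply/mem_sort_track; exact: S_convex u'S zN h h'.
- by exists c; split => //; exact: sort_strict.
Qed.

End sort_track.

Lemma radiusE k : 14 * A * rho k * r0 = 14 * (A * d k).
Proof. by rewrite /d; ring. Qed.

Lemma flat_nbh k a b : flat k (a, b) -> [/\ V k a, V k b, good k a & nbh k a b].
Proof.
move=> [ak bk /andP[_ ab] ga _]; split => //; split; first exact: V_sub.
by move: ab; rewrite radiusE => /lt_trans; apply; rewrite ltr_pM2r//; lra.
Qed.

Lemma flat_lt k a b : flat k (a, b) -> `|a - b| < 14 * (A * d k).
Proof. by move=> [_ _ /andP[_ ab] _ _]; rewrite -radiusE. Qed.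

Lemma flat_ge k a b : flat k (a, b) -> d k <= `|a - b|.
Proof. by move=> [_ _ /andP[]]. Qed.

Lemma flat_neq k a b : flat k (a, b) -> a <> b.
Proof. by move=> f e; have := flat_ge f; rewrite e subrr normr0 leNgt d_gt0. Qed.

Lemma between_dist k a b z : V k a -> good k a -> nbh k a b -> nbh k a z ->
  z <> a -> z <> b -> (p k a a - p k a z) * (p k a b - p k a z) < 0 ->
  `|a - z| < `|a - b|.
Proof.
move=> ak ga bN zN za zb; rewrite -(nbh_lt0 ak ga)//; try exact/nesym.
  exact: obtuse.
exact: nbh_self.
Qed.

Definition enum_pair k a b : seq X := line_enum (ell k a) (Vbtw k a b) a b.

Lemma Vbtw_near k a b x : Vbtw k a b x -> V k.+1 x /\ `|a - x| < 14 * (A * d k).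
Proof. by move=> [[xV /near_ballE xa] _]. Qed.

(** A point that projects between a and b is nearer to a than b is, so the ball
    in the definition of V_{k+1}(a, b) does not cut it off. *)
Lemma Vbtw_convex k a b u u' z : flat k (a, b) -> Vbtw k a b u -> Vbtw k a b u' ->
  nbh k a z -> p k a u < p k a z -> p k a z < p k a u' -> Vbtw k a b z.
Proof.
move=> f [_ bu] [_ bu'] zN uz zu'; have [ak bk ga bN] := flat_nbh f.
have bz : between (ell k a) a b z.
  move: bu bu'; rewrite /between => /andP[h _] /andP[_ h'].
  by rewrite (le_trans h (ltW uz)) (le_trans (ltW zu') h').
split => //; split; first by case: zN.
apply/near_ballE; have [->|/eqP za] := eqVneq z a.
  by rewrite subrr normr0 mulr_gt0.
have [->|/eqP zb] := eqVneq z b; first exact: flat_lt.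
apply: lt_trans (between_dist ak ga bN zN za zb _) (flat_lt f).
have := nbh_pos_neq ak ga zN (nbh_self ak) za.
have := nbh_pos_neq ak ga zN bN zb.
move: bz; rewrite /between -/(p k a) !neq_lt.
move: (p k a a) (p k a b) (p k a z) => qa qb qz.
by have [ab|ab] := leP qa qb => /andP[h h'] /orP[] h1 /orP[] h2; nra.
Qed.

Lemma enum_pair_track k a b : flat k (a, b) ->
  [/\ track k a (enum_pair k a b),
      forall x, x \in enum_pair k a b <-> Vbtw k a b x &
      exists m, enum_pair k a b = a :: rcons m b].
Proof.
move=> f; have [ak bk ga bN] := flat_nbh f.
set S := Vbtw k a b.
have Sn x : S x -> V k.+1 x /\ `|a - x| < 14 * (A * d k) := @Vbtw_near k a b x.
have Sc u u' z : S u -> S u' -> nbh k a z ->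
  p k a u < p k a z -> p k a z < p k a u' -> S z := @Vbtw_convex k a b u u' z f.
have c1 : (1 : R) = 1 \/ (1 : R) = -1 by left.
have T := sort_track ak ga c1 Sn Sc; have M x := mem_sort_track 1 Sn x.
have O := sort_strict ak ga c1 Sn.
have E : sort (fun x y => 1 * p k a x <= 1 * p k a y) (fset_set S) =
    sort (fun x y => p k a x <= p k a y) (fset_set S).
  by congr (sort _ _); apply/funext => x; apply/funext => y; rewrite !mul1r.
rewrite E in T O.
have {}M x : x \in sort (fun x y => p k a x <= p k a y) (fset_set S) <-> S x.
  by rewrite -E; exact: M.
have aS : S a.
  split; last by rewrite /between ge_min le_max !lexx.
  by split; [exact: V_sub|apply/near_ballE; rewrite subrr normr0 mulr_gt0].
have bS : S b.
  split; last by rewrite /between ge_min le_max !lexx !orbT.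
  by split; [case: bN|apply/near_ballE; exact: flat_lt].
have : exists2 c : R, sorted (fun x y => c * p k a x < c * p k a y) (enum_pair k a b) &
    forall x, S x -> c * p k a a <= c * p k a x /\ c * p k a x <= c * p k a b.
  rewrite /enum_pair /line_enum -/(p k a) -/S; case: ifPn => ab.
    exists 1 => // x [_]; rewrite /between -/(p k a) !mul1r.
    by rewrite (min_l ab) (max_r ab) => /andP[].
  exists (-1).
    by rewrite rev_sorted; apply: sub_sorted O => x y; rewrite !mulN1r !mul1r ltrN2.
  move=> x [_]; rewrite -ltNge in ab; rewrite /between -/(p k a) !mulN1r !lerN2.
  by rewrite (min_r (ltW ab)) (max_l (ltW ab)) => /andP[].
have mem x : x \in enum_pair k a b <-> S x.
  by rewrite /enum_pair /line_enum -/(p k a) -/S; case: ifPn => _; rewrite ?mem_rev.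
move=> [c st bd]; split => //.
  rewrite /enum_pair /line_enum -/(p k a) -/S; case: ifPn => _ //.
  exact: track_rev.
have [l el] : exists l, enum_pair k a b = a :: l.
  apply: (head_min (key := fun x => c * p k a x)) => //; first exact/mem.
  by move=> x /mem/bd[].
have [l' el'] : exists l, rev (enum_pair k a b) = b :: l.
  apply: (head_min (key := fun x => - (c * p k a x))) => //.
  - by rewrite rev_sorted; apply: sub_sorted st => x y; rewrite ltrN2.
  - by rewrite mem_rev; exact/mem.
  - by move=> x; rewrite mem_rev => /mem/bd[_]; rewrite lerN2.
have := congr1 rev el'; rewrite revK rev_cons el.
case: (rev l') => [[ab _]|h m [_ ->]]; last by exists m.
by case: (flat_neq f).
Qed.

(* The radius is the distance within which every new point has a parent. *)
Let rayset k v b : set X := [set w | [/\ V k.+1 w, `|v - w| < Cstar * d k.+1 &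
  w = v \/ (w <> v /\ side k v w = b)]].
Definition ray k v b : seq X :=
  let c : R := if b then 1 else -1 in
  sort (fun x y => c * p k v x <= c * p k v y) (fset_set (rayset k v b)).

Lemma CdS_lt k : Cstar * d k.+1 < 14 * (A * d k).
Proof.
have h1 := C_le_A; have h2 := dS_le k; have h3 := d_gt0 k; have h4 := A_gt0.
have : Cstar * d k.+1 <= A * d k.
  by apply: ler_pM => //; rewrite ltW// (lt_le_trans ltr01).
by have := Ad_gt0 k; lra.
Qed.

Lemma ray_track k v b : V k v -> good k v ->
  [/\ track k v (ray k v b),
      forall x, x \in ray k v b <-> rayset k v b x &
      exists l, ray k v b = v :: l].
Proof.
move=> vk gv; set c : R := if b then 1 else -1; set S := rayset k v b.
have c1 : c = 1 \/ c = -1 by rewrite /c; case: ifPn; [left|right].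
have Sn x : S x -> V k.+1 x /\ `|v - x| < 14 * (A * d k).
  by move=> [xV xv _]; split => //; exact: lt_trans (CdS_lt k).
have vS : S v.
  split; [exact: V_sub| |by left]; rewrite subrr normr0 mulr_gt0//.
  exact: lt_le_trans hC.
have SN x : S x -> nbh k v x.
  by move=> /Sn[xV xv]; split => //; rewrite (lt_trans xv)// ltr_pM2r//; lra.
have key x : S x -> x <> v -> c * p k v v < c * p k v x.
  move=> xS xv; have := nbh_pos_neq vk gv (SN _ xS) (nbh_self vk) xv.
  case: xS => _ _ [//|[_ sd]]; rewrite /c -sd /side; case: ifPn => [h _|].
    by rewrite !mul1r.
  by rewrite -leNgt => h1 h2; rewrite !mulN1r ltrN2 lt_neqAle h2.
have Sc u u' z : S u -> S u' -> nbh k v z ->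
    p k v u < p k v z -> p k v z < p k v u' -> S z.
  move=> uS u'S zN uz zu'; have [->//|/eqP zv] := eqVneq z v.
  have [w [wS [h1 h2]]] : exists w, S w /\
      (c * p k v v < c * p k v z /\ c * p k v z < c * p k v w).
    have ku : c * p k v v <= c * p k v u.
      by have [->//|/eqP uv] := eqVneq u v; rewrite ltW// key.
    have ku' : c * p k v v <= c * p k v u'.
      by have [->//|/eqP uv] := eqVneq u' v; rewrite ltW// key.
    by move: ku ku'; rewrite /c; case: ifPn => _ h1 h2;
      [exists u'|exists u]; split => //; lra.
  have wz : w <> z by move=> e; rewrite e ltxx in h2.
  have wv : w <> v by move=> e; rewrite e in h2; have := lt_trans h1 h2; rewrite ltxx.
  split; first by case: zN.
    case: (wS) => _ wC _; apply: lt_trans wC.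
    apply: (between_dist vk gv (SN _ wS) zN zv (nesym wz)).
    by move: h1 h2; case: c1 => ->; nra.
  right; split => //; move: h1; rewrite /side /c; case: ifPn => [_|_].
    by rewrite !mul1r.
  by rewrite !mulN1r ltrN2 => /lt_gtF.
have T := sort_track vk gv c1 Sn Sc; have M x := mem_sort_track c Sn x.
split => //; apply: (head_min (key := fun x => c * p k v x)).
- exact: sort_strict vk gv c1 Sn.
- exact/M.
- by move=> x /M xS; have [->//|/eqP xv] := eqVneq x v; rewrite ltW// key.
Qed.

(** * Nodes, costs and walks *)

(* Four loose sides, two at each end of a gap, cost 2 (14 A d)^s. *)
Let loose_cost : R := (14 * A) `^ s / 2.

(* All points of a track are within 28 A d k of each other; dividing by xi1
   expresses this at the scale of the next level. *)
Let D : R := 28 * A / xi1.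

Definition base k (e : node X) : R :=
  match e with
  | Stop _ => 0
  | Loose _ _ => loose_cost * d k `^ s
  | Edge u u' _ => 3 * `|u - u'| `^ s
  | Bridge x y => `|x - y| * d k `^ (s - 1)
  end.

Definition wf k (e : node X) : Prop :=
  match e with
  | Stop v => V k v
  | Loose v _ => V k v /\ good k v
  | Edge u u' _ => flat k (u, u')
  | Bridge x y => `|x - y| <= D * d k /\ (x = y \/ d k <= `|x - y|)
  end.

(** Both sides of a good vertex are declared loose when it is not known which of
    them are covered. *)
Definition sides k v : seq (node X) :=
  if good k v then [:: Loose v true; Loose v false] else [::].

Definition far k (u u' : X) : bool := 14 * (A * d k) <= `|u - u'|.

Definition edge k (u u' : X) : node X :=
  if `[< flat k (u, u') >] then Edge u u' true
  else if `[< flat k (u', u) >] then Edge u' u false else Bridge u u'.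

Definition step k (u u' : X) : seq (node X) :=
  (if far k u u' then sides k u else [::]) ++ edge k u u' ::
  (if far k u u' then sides k u' else [::]) ++ [:: Stop u'].

Arguments sides : simpl never.
Arguments edge : simpl never.
Arguments step : simpl never.

Fixpoint walk k x (l : seq X) : seq (node X) :=
  if l is y :: l' then step k x y ++ walk k y l' else [::].

Definition walk_of k (t : seq X) : seq (node X) :=
  if t is x :: l then walk k x l else [::].

Lemma s_gt0 : 0 < s. Proof. exact: lt_le_trans hs. Qed.
Local Hint Resolve s_gt0 : core.

Lemma D_ge : 28 * A <= D.
Proof.
rewrite /D ler_pdivlMr// ger_pMr ?(le_trans hxi12 (ltW hxi2))//.
by rewrite mulr_gt0 ?A_gt0.
Qed.

Lemma D_gt0 : 0 < D. Proof. by rewrite (lt_le_trans _ D_ge)// mulr_gt0 ?A_gt0. Qed.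

Lemma Dd_ge k : 28 * (A * d k) <= D * d k.
Proof. by rewrite mulrA ler_pM2r// D_ge. Qed.

Lemma DdS_ge k : 28 * (A * d k) <= D * d k.+1.
Proof.
rewrite /D [leRHS]mulrAC ler_pdivlMr//.
by have := ler_wpM2l (ltW A_gt0) (d_lb k); lra.
Qed.

Lemma loose_cost_gt0 : 0 < loose_cost.
Proof. by rewrite divr_gt0// powR_gt0// mulr_gt0 ?A_gt0. Qed.

Lemma base_ge0 k e : 0 <= base k e.
Proof.
case: e => [v|v b|u u' b|x y] //=; rewrite mulr_ge0 ?powR_ge0//.
by rewrite ltW ?loose_cost_gt0.
Qed.

Lemma bridge_le k (x : R) : d k <= x -> x * d k `^ (s - 1) <= x `^ s.
Proof.
move=> dx; have x_ge0 : 0 <= x := le_trans (ltW (d_gt0 k)) dx.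
rewrite -(mulr_powRB1 x_ge0 s_gt0) ler_wpM2l// ge0_ler_powR// ?subr_ge0// nnegrE//.
exact: ltW.
Qed.

Lemma bridge_ge k (x : R) : d k <= x -> d k `^ s <= x * d k `^ (s - 1).
Proof.
by move=> dx; rewrite -(mulr_powRB1 (ltW (d_gt0 k)) s_gt0) ler_wpM2r// powR_ge0.
Qed.

Lemma edge_src k u u' : src (edge k u u') = u.
Proof. by rewrite /edge; case: asboolP => // _; case: asboolP. Qed.

Lemma edge_tgt k u u' : tgt (edge k u u') = u'.
Proof. by rewrite /edge; case: asboolP => // _; case: asboolP. Qed.

Lemma chain_sides k v : chain v (sides k v) v.
Proof. by rewrite /sides; case: ifP. Qed.

Lemma step_chain k u u' : chain u (step k u u') u'.
Proof.
apply: (@chain_cat _ _ u); first by case: ifP => // _; exact: chain_sides.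
split; first by rewrite edge_src.
rewrite edge_tgt; apply: (@chain_cat _ _ u'); last by [].
by case: ifP => // _; exact: chain_sides.
Qed.

Lemma walk_chain k x l : chain x (walk k x l) (last x l).
Proof.
by elim: l x => [//|y l IH] x /=; apply: chain_cat (IH y); exact: step_chain.
Qed.

Lemma sides_base k v : \sum_(e <- sides k v) base k e <= (14 * (A * d k)) `^ s.
Proof.
rewrite mulrA powRM ?(ltW (d_gt0 k))//; last by rewrite mulr_ge0 ?(ltW A_gt0).
rewrite /sides; case: ifP => _; rewrite ?big_nil ?mulr_ge0 ?powR_ge0//.
by rewrite !big_cons big_nil /= /loose_cost; lra.
Qed.

Lemma edge_base k (u u' : X) : d k <= `|u - u'| ->
  base k (edge k u u') <= 3 * `|u - u'| `^ s.
Proof.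
move=> du; rewrite /edge; case: asboolP => // _; case: asboolP => /= _.
  by rewrite distrC.
by have := bridge_le du; have := powR_ge0 `|u - u'| s; lra.
Qed.

(** At a gap the pair cannot be flat; the bridge costs at most |u - u'|^s and the
    loose sides at most 2 (14 A d)^s <= 2 |u - u'|^s. *)
Lemma step_base k (u u' : X) : d k <= `|u - u'| ->
  \sum_(e <- step k u u') base k e <= 3 * `|u - u'| `^ s.
Proof.
move=> du; rewrite /step; case: ifPn => [f|_]; last first.
  by rewrite /= !big_cons big_nil /= !addr0 edge_base.
have nf v w : `|v - w| = `|u - u'| -> ~ flat k (v, w).
  by move=> e /flat_lt; rewrite e ltNge => /negP.
rewrite big_cat big_cons big_cat big_cons big_nil /= /edge.
rewrite asboolF; last exact: nf.
rewrite asboolF; last by apply: nf; rewrite distrC.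
have f' : (14 * (A * d k)) `^ s <= `|u - u'| `^ s.
  by apply: ge0_ler_powR; rewrite ?nnegrE ?(ltW s_gt0)// mulr_ge0// ltW.
have := sides_base k u; have := sides_base k u'; have := bridge_le du.
by rewrite /=; lra.
Qed.

Lemma walk_base k (x : X) l : path (fun u v => d k <= `|u - v|) x l ->
  \sum_(e <- walk k x l) base k e <= 3 * segsum (fun r => r `^ s) (x :: l).
Proof.
elim: l x => [|y l IH] x /=; first by rewrite big_nil segsum1 mulr0.
move=> /andP[xy yl]; rewrite big_cat segsum_cons mulrDr lerD ?IH//.
exact: step_base.
Qed.

Lemma step_wf k u u' : V k u -> V k u' -> u <> u' -> `|u - u'| <= D * d k ->
  forall e, e \in step k u u' -> wf k e.
Proof.
move=> uk u'k uu' ud e.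
have sd v : V k v -> e \in sides k v -> wf k e.
  by move=> vk; rewrite /sides; case: ifP => // gv; rewrite !inE => /orP[] /eqP ->.
rewrite /step mem_cat inE mem_cat inE => /or4P[|/eqP->||/eqP->//].
- by case: ifP => // _; exact: sd.
- rewrite /edge; case: asboolP => // _; case: asboolP => //= _.
  by split => //; right; exact: V_sep.
- by case: ifP => // _; exact: sd.
Qed.

Lemma walk_mem k x l e : e \in walk k x l ->
  exists u u' l1 l2, x :: l = l1 ++ u :: u' :: l2 /\ e \in step k u u'.
Proof.
elim: l x => [//|y l IH] x /=; rewrite mem_cat => /orP[h|/IH].
  by exists x, y, [::], l.
by move=> [u [u' [l1 [l2 [-> h]]]]]; exists u, u', (x :: l1), l2.
Qed.

Lemma step_walk k t l1 u u' l2 : t = l1 ++ u :: u' :: l2 ->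
  {subset step k u u' <= walk_of k t}.
Proof.
elim: l1 t => [|x l1 IH] t -> e he /=; first by rewrite mem_cat he.
have := IH _ erefl e he; case: (l1 ++ _) => [//|y m] /= h.
by rewrite mem_cat h orbT.
Qed.

Lemma walk_visits k x l y : y \in l -> Stop y \in walk k x l.
Proof.
elim: l x => [//|z l IH] x; rewrite inE => /orP[/eqP->|yl] /=.
  by rewrite mem_cat /step mem_cat inE mem_cat mem_head !orbT.
by rewrite mem_cat IH ?orbT.
Qed.

(** No point on side b of v will be missed: it is searched either from v itself or
    by an edge leaving v on that side. *)
Definition cov k (L : seq (node X)) v b : Prop :=
  Loose v b \in L \/
  exists u c, (Edge v u c \in L \/ Edge u v c \in L) /\ side k v u = b.

Lemma cov_sub k L L' v b : (forall e, payable e \/ (exists w c, e = Loose w c) ->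
  e \in L -> e \in L') -> cov k L v b -> cov k L' v b.
Proof.
move=> LL' [h|[u [c [h e]]]]; first by left; apply: LL' => //; right; exists v, b.
by right; exists u, c; split => //; case: h => h; [left|right]; apply: LL' => //; left.
Qed.

(** A step of a walk covers the facing sides of its two ends, by an edge or by
    loose sides. *)
Section track_cover.
Variables (k : nat) (a : X) (t : seq X) (L : seq (node X)).
Hypothesis ak : V k a.
Hypothesis ga : good k a.
Hypothesis tt : track k a t.

Lemma step_cov_edge u u' b : {subset step k.+1 u u' <= L} ->
  flat k.+1 (u, u') \/ flat k.+1 (u', u) ->
  (b = side k.+1 u u' -> cov k.+1 L u b) /\ (b = side k.+1 u' u -> cov k.+1 L u' b).
Proof.
move=> uL fl; have eL : edge k.+1 u u' \in L.
  by apply: uL; rewrite /step mem_cat mem_head orbT.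
have [[c h]|[c h]] : (exists c, Edge u u' c \in L) \/ (exists c, Edge u' u c \in L).
- move: eL; rewrite /edge; case: asboolP => [_ h|nf]; first by left; exists true.
  by case: asboolP => [_ h|nf']; [right; exists false|case: fl].
- by split=> ->; right; [exists u'|exists u]; exists c; split => //; [left|right].
- by split=> ->; right; [exists u'|exists u]; exists c; split => //; [right|left].
Qed.

Lemma step_cov_far u u' w b : {subset step k.+1 u u' <= L} -> far k.+1 u u' ->
  w = u \/ w = u' -> good k.+1 w -> cov k.+1 L w b.
Proof.
move=> uL f wE gw; left; apply: uL; rewrite /step f mem_cat inE mem_cat.
have sw : Loose w b \in sides k.+1 w by rewrite /sides gw !inE; case: b; rewrite eqxx ?orbT.
by case: wE => <-; rewrite sw ?orbT.
Qed.

Lemma track_cov_left l1 u u' l2 b : t = l1 ++ u :: u' :: l2 ->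
  {subset step k.+1 u u' <= L} \/ {subset step k.+1 u' u <= L} -> good k.+1 u ->
  (`|u - u'| < 14 * (A * d k.+1) -> b = side k.+1 u u') -> cov k.+1 L u b.
Proof.
move=> e st gu hb.
have [f|nf] := leP (14 * (A * d k.+1)) `|u - u'|.
  case: st => st; apply: (step_cov_far (u := _) (u' := _) b st) => //.
  - by left.
  - by rewrite /far distrC.
  - by right.
have fl := track_flat ak ga tt e gu nf.
case: st => st.
  by have [h _] := step_cov_edge b st (or_introl fl); apply/h/hb.
by have [_ h] := step_cov_edge b st (or_intror fl); apply/h/hb.
Qed.

End track_cover.

(** * The replacement of a node *)

Lemma seq_argmin (T : eqType) (f : T -> R) (l : seq T) x : x \in l ->
  exists2 m, m \in l & forall y, y \in l -> f m <= f y.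
Proof.
elim: l x => [//|z l IH] x _; case: l IH => [|w l] IH.
  by exists z; rewrite ?mem_head// => y; rewrite inE => /eqP->.
have [m ml mm] := IH w (mem_head _ _).
have [zm|mz] := leP (f z) (f m).
  exists z; rewrite ?mem_head// => y; rewrite inE => /orP[/eqP->//|/mm].
  exact: le_trans.
exists m; first by rewrite inE ml orbT.
by move=> y; rewrite inE => /orP[/eqP->|/mm//]; exact: ltW.
Qed.

Definition nearest k (w : X) : X :=
  xget w [set v | V k v /\ forall u, V k u -> `|w - v| <= `|w - u|].

Lemma nearestP k w : V k.+1 w -> [/\ V k (nearest k w),
  forall u, V k u -> `|w - nearest k w| <= `|w - u| &
  `|w - nearest k w| < Cstar * d k.+1].
Proof.
move=> wV; have [v0 v0k] := nets_nonempty nets k.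
have mem v : (v \in fset_set (V k)) = (v \in V k).
  by rewrite in_fset_set//; exact: nets_finite nets k.
have [v vV vm] : exists2 v, v \in fset_set (V k) &
    forall u, u \in fset_set (V k) -> `|w - v| <= `|w - u|.
  apply: (@seq_argmin _ (fun v => `|w - v|) (fset_set (V k)) v0).
  by rewrite mem; exact/mem_set.
have [vk nm] : [set v | V k v /\ forall u, V k u -> `|w - v| <= `|w - u|] (nearest k w).
  apply: xgetPex; exists v; split; first by move: vV; rewrite mem => /set_mem.
  by move=> u uk; apply: vm; rewrite mem; exact/mem_set.
split => //; have [v' v'k wv'] := nets_V4 nets wV.
by apply: le_lt_trans (nm _ v'k) _; rewrite /d mulrA.
Qed.

Lemma nearest_id k w : V k w -> nearest k w = w.
Proof.
move=> wk; have [_ /(_ w wk) + _] := nearestP (V_sub wk).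
by rewrite subrr normr0 normr_le0 subr_eq0 => /eqP.
Qed.

Definition children k v : seq X :=
  [seq w <- (fset_set (V k.+1) : seq X) | (nearest k w == v) && (w != v)].

Lemma childrenP k v w : w \in children k v <->
  [/\ V k.+1 w, nearest k w = v & w <> v].
Proof.
rewrite mem_filter in_fset_set; last exact: nets_finite nets k.+1.
split=> [/andP[/andP[/eqP h /eqP h'] /set_mem]//|[wV -> /eqP wv]].
by rewrite eqxx wv mem_set.
Qed.

Definition spoke k v w : seq (node X) :=
  Bridge v w :: Stop w :: sides k w ++ [:: Bridge w v].

Arguments spoke : simpl never.

Definition star k v (ws : seq X) : seq (node X) :=
  Stop v :: sides k v ++ flatten [seq spoke k v w | w <- ws].

(** Whether the orientation of the line changes from level k to level k+1. Without
    points near v at level k+1 nothing has to agree, and the value is false. *)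
Definition flip k v : bool := `[< exists y, [/\ V k.+1 y, y <> v,
  `|v - y| < 14 * (A * d k.+1) & side k v y <> side k.+1 v y] >].

(** The last point of a ray is covered towards its predecessor y, and loose on the
    other side. *)
Definition tip k (t : seq X) : seq (node X) :=
  if t is z :: y :: _ then if good k z then [:: Loose z (~~ side k z y)] else [::]
  else [::].

(** The number of pieces that makes their length at least d (k+1), and at most
    twice that; the maximum is for bridges of length 0. *)
Definition pieces k (x y : X) : nat := maxn 1 (Num.truncn (`|x - y| / d k.+1)).

Definition mark (x y : X) n i : X := x + (i%:R / n%:R) *: (y - x).

Definition subdivide k (x y : X) : seq (node X) :=
  let n := pieces k x y in
  [seq Bridge (mark x y n i) (mark x y n i.+1) | i <- iota 0 n].

Definition refine k (e : node X) : seq (node X) :=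
  match e with
  | Stop v => if good k v then [:: Stop v] else star k.+1 v (children k v)
  | Loose v b =>
    let t := ray k v b in
    if t is _ :: _ :: _ then
      walk_of k.+1 t ++ tip k.+1 (rev t) ++ walk_of k.+1 (rev t)
    else if good k.+1 v then [:: Loose v (b (+) flip k v)] else [:: Bridge v v]
  | Edge a b c =>
    walk_of k.+1 (if c then enum_pair k a b else rev (enum_pair k a b))
  | Bridge x y => subdivide k x y
  end.

Definition pay k (e : node X) : R :=
  match e with
  | Stop v => if good k v then 0
            else \sum_(e' <- star k.+1 v (children k v)) base k.+1 e'
  | Edge a b _ => 3 * (tau Cstar xi2 r0 V rho ell s k a b * `|a - b| `^ s)
  | _ => 0
  end.

Let refines k (e : node X) (l : seq (node X)) : Prop :=
  [/\ l <> [::], chain (src e) l (tgt e),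
      forall e', e' \in l -> wf k.+1 e' /\ `|src e - src e'| <= D * d k &
      \sum_(e' <- l) base k.+1 e' <= base k e + pay k e].

Lemma step_src k u u' e : e \in step k u u' -> src e = u \/ src e = u'.
Proof.
have sd v : e \in sides k v -> src e = v.
  by rewrite /sides; case: ifP => // gv; rewrite !inE => /orP[] /eqP ->.
rewrite /step mem_cat inE mem_cat inE => /or4P[|/eqP->||/eqP->].
- by case: ifP => // _ /sd; left.
- by rewrite edge_src; left.
- by case: ifP => // _ /sd; right.
- by right.
Qed.

Lemma track_walk k a t e : V k a -> good k a -> track k a t ->
  e \in walk_of k.+1 t -> wf k.+1 e /\ src e \in t.
Proof.
move=> ak ga tt; case: t tt => [//|x l] tt /walk_mem[u [u' [l1 [l2 [eq he]]]]].
have [ut u't] : u \in x :: l /\ u' \in x :: l.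
  by rewrite eq !mem_cat !inE !eqxx !orbT.
have [tn _ _] := tt; have [[uV ua] [u'V u'a]] := (tn _ ut, tn _ u't).
split; last by case: (step_src he) => ->.
apply: (step_wf uV u'V (track_neq tt eq) _ he).
apply: le_trans (DdS_ge k); rewrite (le_trans (ler_distD a _ _))//.
by rewrite distrC in ua; nlra.
Qed.

Lemma track_walk_base k a t : V k a -> good k a -> track k a t ->
  \sum_(e <- walk_of k.+1 t) base k.+1 e <= 3 * segsum (fun r => r `^ s) t.
Proof.
move=> ak ga tt; case: t tt => [|x l] tt.
  by rewrite big_nil mulr_ge0// segsum_ge0// => r _; exact: powR_ge0.
apply: walk_base.
suff H y m l1 : x :: l = l1 ++ y :: m -> path (fun u v => d k.+1 <= `|u - v|) y m.
  exact: (H x l [::]).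
elim: m y l1 => [//|z m IH] y l1 e /=; apply/andP; split; last first.
  by apply: (IH z (rcons l1 y)); rewrite cat_rcons.
have [yt zt] : y \in x :: l /\ z \in x :: l by rewrite e !mem_cat !inE !eqxx !orbT.
have [tn _ _] := tt; have [[yV _] [zV _]] := (tn _ yt, tn _ zt).
exact: V_sep (track_neq tt e).
Qed.

(** Each term r^s is at most r M^(s-1). *)
Lemma segsum_pow (t : seq X) M : segsum id t <= M ->
  segsum (fun r => r `^ s) t <= M `^ s.
Proof.
move=> tM; have s1 : 0 <= s - 1 by rewrite subr_ge0.
have term (i : 'I_(size t).-1) : `|t`_i.+1 - t`_i| <= M.
  apply: le_trans tM; rewrite /segsum (bigD1 i)//= lerDl; exact: sumr_ge0.
have M0 : 0 <= M by apply: le_trans tM; exact: sumr_ge0.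
rewrite -(mulr_powRB1 M0 s_gt0).
apply: (@le_trans _ _ (segsum id t * M `^ (s - 1))); last by rewrite ler_wpM2r// powR_ge0.
rewrite /segsum mulr_suml; apply: ler_sum => i _.
rewrite -(mulr_powRB1 (normr_ge0 _) s_gt0) ler_wpM2l// ge0_ler_powR// nnegrE//.
Qed.

Lemma walk_nil k t : walk_of k t = [::] -> (size t <= 1)%N.
Proof.
case: t => [//|x [//|y l]] /=; rewrite /step.
by case: (if _ then _ else _).
Qed.

(** The definition of the variation excess says that the sum over the walk is at
    most (1 + tau) |a - b|^s. *)
Lemma refine_Edge k a b c : wf k (Edge a b c) ->
  refines k (Edge a b c) (refine k (Edge a b c)).
Proof.
move=> /= f; have [ak bk ga bN] := flat_nbh f.
have [tt mem [m em]] := enum_pair_track f.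
set t := if c then _ else _.
have tt' : track k a t by rewrite /t; case: (c) => //; exact: track_rev.
have [tn _ _] := tt'; have fl := flat_lt f.
split.
- move=> /walk_nil; rewrite /t; case: (c); rewrite ?size_rev em /= size_rcons//.
- rewrite /t; case: (c); rewrite em.
    by have := walk_chain k.+1 a (rcons m b); rewrite last_rcons.
  rewrite rev_cons rev_rcons /=.
  by have := walk_chain k.+1 b (rcons (rev m) a); rewrite last_rcons.
- move=> e he; have [we /tn[_ ea]] := track_walk ak ga tt' he; split => //.
  apply: le_trans (Dd_ge k); have := Ad_gt0 k => Ad.
  case: (c) => /=; first by nlra.
  rewrite (le_trans (ler_distD a _ _))//; rewrite distrC in fl; nlra.
- rewrite (le_trans (track_walk_base ak ga tt'))//.
  have -> : segsum (fun r => r `^ s) t = segsum (fun r => r `^ s) (enum_pair k a b).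
    by rewrite /t; case: (c) => //; rewrite segsum_rev.
  have p0 : 0 < `|a - b| `^ s.
    by rewrite powR_gt0// normr_gt0 subr_eq0; apply/eqP; exact: flat_neq f.
  rewrite /base /pay /tau -/(enum_pair k a b) divfK ?gt_eqF// -mulrDr ler_pM2l//.
  rewrite -lerBlDl le_max; apply/orP; left; rewrite lerD2r.
  by rewrite /segsum.
Qed.

Lemma rev_cons_last (T : Type) (x : T) l :
  exists m, rev (x :: l) = last x l :: m /\ last (last x l) m = x.
Proof.
elim/last_ind: l => [|l z _]; first by exists [::].
by exists (rcons (rev l) x); rewrite last_rcons rev_cons rev_rcons last_rcons.
Qed.

Lemma tip_chain k z m : chain z (tip k (z :: m)) z.
Proof. by case: m => [//|y m] /=; case: ifP. Qed.

Lemma tip_mem k z m e : e \in tip k (z :: m) -> good k z /\ exists b, e = Loose z b.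
Proof.
case: m => [//|y m] /=; case: ifP => // gz; rewrite inE => /eqP ->.
by split => //; eexists.
Qed.

Lemma tip_base k t : \sum_(e <- tip k t) base k e <= loose_cost * d k `^ s.
Proof.
have h : 0 <= loose_cost * d k `^ s by rewrite mulr_ge0 ?powR_ge0// ltW// loose_cost_gt0.
case: t => [|z [|y t]] /=; rewrite ?big_nil//.
by case: ifP; rewrite ?big_nil ?big_cons ?big_nil ?addr0.
Qed.

Lemma powR_dS k : d k.+1 `^ s <= xi2 * d k `^ s.
Proof.
have x2 : 0 < xi2 := lt_le_trans hxi1 hxi12.
apply: (@le_trans _ _ ((xi2 * d k) `^ s)).
  apply: ge0_ler_powR; rewrite ?nnegrE ?(ltW s_gt0) ?(ltW (d_gt0 _))//.
    by rewrite mulr_ge0// ltW.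
  exact: d_dec.
by apply: ge1r_powRZ; rewrite ?x2 ?(ltW hxi2) ?(ltW (d_gt0 _)).
Qed.

(** The ray is walked twice at rate 3, and has length at most 7/6 Cstar d (k+1).
    The scale decreases by a factor xi2 at least, which releases the fraction
    1 - xi2 of the cost of the loose side; as A = Cstar / (1 - xi2) and
    14 = 12 * 7/6, this is enough. *)
Lemma ray_budget k :
  6 * (7 / 6 * (Cstar * d k.+1)) `^ s + loose_cost * d k.+1 `^ s <=
  loose_cost * d k `^ s.
Proof.
have C0 : 0 < Cstar := lt_le_trans ltr01 hC.
have x1 : 0 < 1 - xi2 by rewrite subr_gt0.
have dk := powR_dS k; have dk' : d k.+1 `^ s <= d k `^ s.
  by apply: ge0_ler_powR; rewrite ?nnegrE ?(ltW s_gt0) ?(ltW (d_gt0 _)) ?dS_le.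
set X1 := d k.+1 `^ s in dk dk' *; set X0 := d k `^ s in dk dk' *.
have X1_ge0 : 0 <= X1 by exact: powR_ge0.
have -> : (7 / 6 * (Cstar * d k.+1)) `^ s = (7 / 6 * Cstar) `^ s * X1.
  by rewrite mulrA powRM ?(ltW (d_gt0 _))// mulr_ge0// ltW.
have A14 : 12 * (7 / 6 * Cstar) `^ s <= (1 - xi2) * (14 * A) `^ s.
  have -> : 14 * A = (1 - xi2)^-1 * (12 * (7 / 6 * Cstar)).
    by rewrite /Astar; field; rewrite gt_eqF.
  have y0 : 0 <= 7 / 6 * Cstar by rewrite mulr_ge0// ltW.
  have i0 : 0 <= (1 - xi2)^-1 by rewrite invr_ge0 ltW.
  have m0 : 0 <= 12 * (7 / 6 * Cstar) by rewrite mulr_ge0.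
  rewrite (powRM s i0 m0) (powRM s (ltac:(lra) : (0 : R) <= 12) y0).
  have h12 : (12 : R) <= 12 `^ s by apply: le1r_powR => //; lra.
  have h1 : (1 - xi2)^-1 <= (1 - xi2)^-1 `^ s.
    apply: le1r_powR => //; rewrite invf_ge1//; have : 0 < xi2 := lt_le_trans hxi1 hxi12.
    by lra.
  have h2 : 1 <= (1 - xi2) * (1 - xi2)^-1 `^ s.
    by have := ler_wpM2l (ltW x1) h1; rewrite mulfV ?gt_eqF.
  have h3 := powR_ge0 (7 / 6 * Cstar) s.
  rewrite (le_trans (ler_wpM2r h3 h12))// [leRHS]mulrA ler_peMl//.
  by rewrite mulr_ge0// powR_ge0.
rewrite /loose_cost; set a := (14 * A) `^ s in A14 *.
set b := (7 / 6 * Cstar) `^ s in A14 *.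
have a0 : 0 <= a by exact: powR_ge0.
have h1 := ler_wpM2r X1_ge0 A14.
have h2 := ler_wpM2l (mulr_ge0 (ltW x1) a0) dk'.
have h3 := ler_wpM2l a0 dk; lra.
Qed.

Lemma refine_Loose k v b : wf k (Loose v b) ->
  refines k (Loose v b) (refine k (Loose v b)).
Proof.
move=> /= [vk gv]; have [tt mem [l el]] := ray_track b vk gv.
have vV := V_sub vk.
have Dk : 0 <= D * d k by rewrite mulr_ge0 ?(ltW D_gt0)// ltW.
have pS : loose_cost * d k.+1 `^ s <= loose_cost * d k `^ s.
  rewrite ler_pM2l ?loose_cost_gt0//.
  by apply: ge0_ler_powR; rewrite ?nnegrE ?(ltW s_gt0) ?(ltW (d_gt0 _)) ?dS_le.
rewrite el; case: l el => [|y l] el.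
  case: ifP => gv'; split => //=.
  - by move=> e; rewrite inE => /eqP ->; split => //=; rewrite subrr normr0.
  - by rewrite big_cons big_nil /= !addr0.
  - move=> e; rewrite inE => /eqP ->; split => /=; last by rewrite subrr normr0.
    by split; [rewrite subrr normr0 mulr_ge0 ?(ltW D_gt0)// ltW|left].
  - rewrite big_cons big_nil /= subrr normr0 mul0r !addr0.
    by rewrite mulr_ge0 ?powR_ge0// ltW// loose_cost_gt0.
rewrite -el; have tt' := track_rev tt.
have [m [er em]] := rev_cons_last v (y :: l).
have dist x : x \in ray k v b -> `|v - x| < Cstar * d k.+1.
  by move=> /mem[].
have Cd : Cstar * d k.+1 <= D * d k.
  rewrite ltW// (lt_le_trans (CdS_lt k))// (le_trans _ (Dd_ge k))//.
  by rewrite ler_wpM2r//; [exact: ltW|lra].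
split.
- by rewrite el /= /step; case: (if _ then _ else _).
- rewrite /= el; apply: chain_cat; first exact: walk_chain.
  rewrite er; apply: chain_cat; first exact: tip_chain.
  by rewrite -{3}em; exact: walk_chain.
- move=> e; rewrite !mem_cat => /or3P[he|he|he].
  + have [we /dist/ltW h] := track_walk vk gv tt he; split => //=.
    exact: le_trans Cd.
  + move: he; rewrite el er => /tip_mem[gz [c ->]] /=.
    have zt : last v (y :: l) \in ray k v b by rewrite -mem_rev el er mem_head.
    split; last by rewrite (le_trans (ltW (dist _ zt))).
    by split => //; have /mem[] := zt.
  + have [we] := track_walk vk gv tt' he.
    rewrite mem_rev => /dist/ltW h; split => //=.
    exact: le_trans Cd.
- have tS : segsum id (ray k v b) <= 7 / 6 * (Cstar * d k.+1).
    rewrite (le_trans (track_segsum vk gv tt el))// ler_pM2l; last by lra.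
    rewrite (le_trans (line_pos_le _ _ _))// distrC ltW// dist//.
    by rewrite el mem_last.
  have := segsum_pow tS; have := track_walk_base vk gv tt.
  have := track_walk_base vk gv tt'; rewrite segsum_rev.
  have := tip_base k.+1 (rev (ray k v b)); have := ray_budget k.
  rewrite !big_cat /= addr0.
  set B1 := \sum_(i <- walk_of _ _) _; set B2 := \sum_(i <- tip _ _) _.
  set B3 := \sum_(i <- walk_of _ _) _; set S := segsum _ _.
  by set Q := (7 / 6 * _) `^ s; lra.
Qed.

Lemma markE0 (x y : X) n : mark x y n 0 = x.
Proof. by rewrite /mark mul0r scale0r addr0. Qed.

Lemma markEn (x y : X) n : (0 < n)%N -> mark x y n n = y.
Proof.
move=> n0; rewrite /mark divff ?scale1r ?pnatr_eq0 -?lt0n//.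
by rewrite addrC subrK.
Qed.

Lemma mark_dist (x y : X) n i : (0 < n)%N ->
  `|mark x y n i - mark x y n i.+1| = `|x - y| / n%:R.
Proof.
move=> n0; rewrite /mark opprD addrACA subrr add0r -scalerBl -mulrBl.
rewrite -[i.+1]addn1 natrD opprD addrA subrr add0r mulN1r scaleNr normrN normrZ.
by rewrite normfV normr_nat distrC mulrC.
Qed.

Lemma chain_map_iota (f : nat -> X) n i :
  chain (f i) [seq Bridge (f j) (f j.+1) | j <- iota i n] (f (i + n)%N).
Proof.
elim: n i => [|n IH] i /=; first by rewrite addn0.
by split => //; rewrite -addSnnS; exact: IH.
Qed.

(** The length is shared equally, and the power of the scale decreases. *)
Lemma refine_Bridge k x y : wf k (Bridge x y) ->
  refines k (Bridge x y) (refine k (Bridge x y)).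
Proof.
move=> /= [xyD xyd]; rewrite /subdivide; set n := pieces k x y.
have n0 : (0 < n)%N by rewrite leq_max.
have nR : (0 : R) < n%:R by rewrite ltr0n.
have d1 := d_gt0 k.+1.
have q0 : 0 <= `|x - y| / d k.+1 by rewrite divr_ge0// ltW.
have small : `|x - y| / n%:R <= 2 * d k.+1.
  rewrite ler_pdivrMr//.
  have := truncnS_gt (`|x - y| / d k.+1); rewrite ltr_pdivrMr// => h.
  rewrite (le_trans (ltW h))// mulrAC ler_pM2r// -natrM ler_nat.
  rewrite /n /pieces; move: (Num.truncn _) => m; lia.
have D2 : 2 * d k.+1 <= D * d k.+1.
  by rewrite ler_pM2r// (le_trans _ D_ge)//; have := A_ge1; lra.
have sp : 0 < d k.+1 `^ (s - 1) by exact: powR_gt0.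
split.
- by case: (n) n0.
- by have := chain_map_iota (mark x y n) n 0; rewrite markE0 add0n markEn.
- move=> e /mapP[i]; rewrite mem_iota add0n => /andP[_ i_n] ->; split; last first.
    rewrite /= /mark opprD addrA subrr add0r normrN normrZ distrC.
    rewrite (le_trans _ xyD)// ler_piMl//.
    rewrite ger0_norm ?divr_ge0// ler_pdivrMr// mul1r ler_nat ltnW//.
  rewrite /= mark_dist//; split; first exact: le_trans D2.
  case: xyd => [e0|xyd]; first by left; rewrite e0 /mark !subrr !scaler0.
  right; rewrite ler_pdivlMr//.
  have n_eq : n = Num.truncn (`|x - y| / d k.+1).
    rewrite /n /pieces; apply/maxn_idPr; rewrite truncn_gt0.
    by rewrite ler_pdivlMr// mul1r (le_trans (dS_le k)).
  rewrite n_eq mulrC -ler_pdivlMr// truncn_le; exact: q0.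
- rewrite /refine /subdivide -/n big_map /=.
  rewrite (eq_bigr (fun=> `|x - y| / n%:R * d k.+1 `^ (s - 1))); last first.
    by move=> i _; rewrite mark_dist.
  rewrite big_const_seq count_predT size_iota iter_addr !addr0.
  have -> : `|x - y| / n%:R * d k.+1 `^ (s - 1) *+ n = `|x - y| * d k.+1 `^ (s - 1).
    by rewrite -[LHS]mulr_natr; field; rewrite gt_eqF.
  rewrite ler_wpM2l//.
  by apply: ge0_ler_powR; rewrite ?nnegrE ?(ltW (d_gt0 _)) ?dS_le// subr_ge0.
Qed.

(* One spoke has length at most 2 Cstar d and is walked twice, and its end may have
   two loose sides. *)
Let star_cost : R := 2 * loose_cost + 4 * Cstar.

Lemma sides_base_loose k v : \sum_(e <- sides k v) base k e <= 2 * loose_cost * d k `^ s.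
Proof.
have h : 0 <= loose_cost * d k `^ s by rewrite mulr_ge0 ?powR_ge0// ltW// loose_cost_gt0.
rewrite /sides; case: ifP => _; rewrite ?big_nil ?big_cons ?big_nil /=; lra.
Qed.

Lemma star_cost_gt0 : 0 < star_cost.
Proof. by have := loose_cost_gt0; have := hC; rewrite /star_cost; lra. Qed.

Lemma star_base k v ws : (forall w, w \in ws -> `|v - w| <= 2 * Cstar * d k) ->
  \sum_(e <- star k v ws) base k e <= star_cost * d k `^ s * (1 + (size ws)%:R).
Proof.
move=> hw; rewrite /star big_cons. rewrite big_cat /= add0r mulrDr mulr1.
have X0 : 0 <= d k `^ s by exact: powR_ge0.
apply: lerD.
  have := sides_base_loose k v; rewrite /star_cost; have : 0 <= Cstar * d k `^ s.
    by rewrite mulr_ge0//; have := hC; lra.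
  by lra.
elim: ws hw => [|w ws IH] hw; first by rewrite big_nil mulr0.
rewrite map_cons -cat1s flatten_cat big_cat [flatten [:: _]]/= cats0.
rewrite mulrSr mulrDr mulr1 [leRHS]addrC; apply: lerD; last first.
  by apply: IH => u uw; apply: hw; rewrite inE uw orbT.
rewrite /spoke !big_cons big_cat big_cons big_nil /= addr0 add0r (distrC w v).
have := sides_base_loose k w; rewrite /star_cost.
have : `|v - w| * d k `^ (s - 1) <= 2 * Cstar * d k `^ s.
  rewrite -(mulr_powRB1 (ltW (d_gt0 k)) s_gt0) mulrA ler_wpM2r ?powR_ge0//.
  exact: hw (mem_head _ _).
by move: (_ * d k `^ (s - 1)) (\sum_(_ <- _) _) => a b'; lra.
Qed.

Lemma star_chain k v ws : chain v (star k v ws) v.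
Proof.
split => //=; apply: chain_cat; first exact: chain_sides.
elim: ws => [//|w ws IH]; rewrite /=; split => //; split => //=.
rewrite -catA; apply: chain_cat; first exact: chain_sides.
by split.
Qed.

Lemma star_mem k v ws e : V k v -> (forall w, w \in ws ->
    [/\ V k w, v <> w & `|v - w| <= 2 * Cstar * d k]) ->
  e \in star k v ws -> wf k e /\ (src e = v \/ src e \in ws).
Proof.
have sd u : V k u -> e \in sides k u -> wf k e /\ src e = u.
  by move=> uk; rewrite /sides; case: ifP => // gu; rewrite !inE => /orP[] /eqP ->.
have Cd : 2 * Cstar * d k <= D * d k.
  by apply: le_trans (Dd_ge k); have := Ad_ge k; have := Ad_gt0 k; lra.
move=> vk hw; rewrite /star inE mem_cat => /or3P[/eqP->|/sd[]//|].
- by split => //; left.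
- by move=> we ->; split => //; left.
move=> /flattenP[l /mapP[w ww ->]]; have [wk vw vwd] := hw _ ww.
have vw_d := V_sep vk wk vw.
rewrite /spoke 2!inE mem_cat inE => /or4P[/eqP->|/eqP->|/sd[]//|/eqP->] /=.
- by split; [split; [exact: le_trans Cd|right]|left].
- by split => //; right.
- by move=> we ->; split => //; right.
- by split; [rewrite distrC; split; [exact: le_trans Cd|right]|right].
Qed.

Lemma refine_Stop k v : wf k (Stop v) -> refines k (Stop v) (refine k (Stop v)).
Proof.
move=> /= vk; have Dk : 0 <= D * d k by rewrite mulr_ge0 ?(ltW D_gt0)// ltW.
case: ifPn => gv; split => //=.
- move=> e; rewrite inE => /eqP -> /=; split; first exact: V_sub.
  by rewrite subrr normr0.
- by rewrite gv big_cons big_nil /= !addr0.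
- exact: star_chain.
- have CC : Cstar * d k.+1 <= 2 * Cstar * d k.+1.
    by rewrite ler_pM2r//; have := hC; lra.
  have ch w : w \in children k v -> [/\ V k.+1 w, v <> w & `|v - w| < Cstar * d k.+1].
    move=> /childrenP[wV nw wv]; split => //; first exact/nesym.
    by have [_ _] := nearestP wV; rewrite nw distrC.
  have ch' w : w \in children k v ->
      [/\ V k.+1 w, v <> w & `|v - w| <= 2 * Cstar * d k.+1].
    by move=> /ch[h1 h2 h3]; split => //; apply: le_trans CC; exact: ltW.
  move=> e he; have [we se] := star_mem (V_sub vk) ch' he.
  split => //; case: se => [->|/ch[_ _ h]]; first by rewrite subrr normr0.
  apply: le_trans (Dd_ge k); apply: le_trans (ltW h) _.
  by have := CdS_lt k; have := Ad_gt0 k; lra.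
- by rewrite (negbTE gv) add0r.
Qed.

Lemma refineP k e : wf k e -> refines k e (refine k e).
Proof.
case: e => [v|v b|u u' c|x y]; [exact: refine_Stop|exact: refine_Loose|
  exact: refine_Edge|exact: refine_Bridge].
Qed.

(** * No point is missed *)

Section coverage.
Variables (k : nat) (L : seq (node X)).
Hypothesis L_wf : forall e, e \in L -> wf k e.
Hypothesis L_Stop : forall v, V k v -> Stop v \in L.
Hypothesis L_cov : forall v b, V k v -> good k v -> cov k L v b.

Let L' := flatten [seq refine k e | e <- L].

Lemma mem_refined e e' : e \in L -> e' \in refine k e -> e' \in L'.
Proof. by move=> eL he; apply/flattenP; exists (refine k e) => //; exact: map_f. Qed.

Lemma Cd2_lt j : 2 * (Cstar * d j) < 14 * (A * d j).
Proof. by have := Ad_ge j; have := Ad_gt0 j; lra. Qed.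

Lemma nbhS j v y : V j.+1 y -> `|v - y| < 14 * (A * d j.+1) ->
  nbh j v y /\ nbh j.+1 v y.
Proof.
move=> yV vy; have h : A * d j.+1 <= A * d j by rewrite ler_pM2l ?A_gt0// dS_le.
have h1 := Ad_gt0 j; have h2 := Ad_gt0 j.+1.
by split; split => //; [nlra|exact: V_sub|nlra].
Qed.

(** Two points near v are on the same side of v for the line of level k exactly if
    they are for the line of level k+1, so one point decides for all. *)
Lemma flipP v y : V k v -> good k v -> good k.+1 v -> V k.+1 y -> y <> v ->
  `|v - y| < 14 * (A * d k.+1) -> side k.+1 v y = side k v y (+) flip k v.
Proof.
move=> vk gv gv' yV yv vy; have [yN yN'] := nbhS yV vy.
rewrite /flip; case: asboolP => [[z [zV zv vz zs]]|nz].
  have [zN zN'] := nbhS zV vz; have vV := V_sub vk.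
  have := same_side vk gv yN zN yv zv; have := same_side vV gv' yN' zN' yv zv.
  by move=> <-; move: zs; do 4!case: (side _ _ _) => //.
rewrite addbF; apply: contrapT => ne; apply: nz; exists y; split => //.
exact/nesym.
Qed.

(** If the side of w is not loose at v, the nearest point of V_k, it is covered by
    an edge to some u. Then w is between v and u: otherwise u would be between v
    and w, hence nearer to w than v. *)
Lemma located w : V k.+1 w -> nearest k w <> w -> good k (nearest k w) ->
  (exists2 b, Loose (nearest k w) b \in L & w \in ray k (nearest k w) b) \/
  (exists a b c, [/\ Edge a b c \in L, w \in enum_pair k a b, w <> a & w <> b]).
Proof.
move=> wV nw gv; have [vk vmin vw] := nearestP wV.
set v := nearest k w in nw gv vk vmin vw *.
rewrite distrC in vw; have wv : w <> v by exact/nesym.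
case: (L_cov (side k v w) vk gv) => [h|[u [c [h su]]]].
  left; exists (side k v w) => //.
  have [_ mem _] := ray_track (side k v w) vk gv.
  by apply/mem; split => //; right.
right.
have wN : nbh k v w.
  by split => //; rewrite (lt_trans (lt_trans vw (CdS_lt k)))// ltr_pM2r//; lra.
have [uk vu vu14] : [/\ V k u, v <> u & `|v - u| < 14 * (A * d k)].
  case: h => /L_wf /= f; have [h1 h2 _ _] := flat_nbh f; have h3 := flat_neq f.
    by split => //; exact: flat_lt.
  by split => //; [exact/nesym|rewrite distrC; exact: flat_lt].
have uN : nbh k v u.
  by split; [exact: V_sub|rewrite (lt_trans vu14)// ltr_pM2r//; lra].
have wu : w <> u by move=> e; apply: nw; rewrite /v e; apply: nearest_id.
have btw : inner (v - w) (u - w) < 0.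
  have vN := nbh_self vk.
  have := same_side vk gv wN uN wv (nesym vu); rewrite su eqxx => /esym.
  rewrite (nbh_gt0 vk gv)//; last exact/nesym.
  have : ~ inner (w - u) (v - u) < 0.
    by move=> /obtuse; rewrite ltNge vmin.
  rewrite (nbh_lt0 vk gv)// => /negP; rewrite -leNgt.
  rewrite (nbh_lt0 vk gv)//; try exact/nesym.
  have := nbh_pos_neq vk gv wN uN wu; rewrite neq_lt.
  move: (p k v v) (p k v w) (p k v u) => qv qw qu /orP[] ? ? ?;
    by case: (ltP qv qw) => ?; case: (ltP qv qu) => ?; nra.
have main a b : flat k (a, b) -> (a = v /\ b = u) \/ (a = u /\ b = v) ->
    [/\ w \in enum_pair k a b, w <> a & w <> b].
  move=> f ab; have [ak bk ga bN] := flat_nbh f.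
  have [_ mem _] := enum_pair_track f.
  have [wa wb] : w <> a /\ w <> b by case: ab => -[-> ->].
  have btw' : inner (a - w) (b - w) < 0 by case: ab => -[-> ->] //; rewrite innerC.
  have wa14 : `|a - w| < 14 * (A * d k).
    by apply: lt_trans (flat_lt f); exact: obtuse.
  have wN' : nbh k a w.
    by split => //; rewrite (lt_trans wa14)// ltr_pM2r//; lra.
  split => //; apply/mem; split.
    by split => //; apply/near_ballE.
  move: btw'; rewrite (nbh_lt0 ak ga)//; try by [exact: nbh_self|exact/nesym].
  rewrite /between -/(p k a); move: (p k a a) (p k a b) (p k a w) => qa qb qw.
  by case: (leP qa qb) => ? ?; apply/andP; split; nra.
case: h => h; have /= f := L_wf h; [exists v, u, c|exists u, v, c];
  have [] := main _ _ f; try by [left|right]; by split.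
Qed.

Lemma walk_of_visits j t x l y : t = x :: l -> y \in t -> y <> x ->
  Stop y \in walk_of j t.
Proof.
by move=> -> /=; rewrite inE => /orP[/eqP->//|yl] _; exact: walk_visits.
Qed.

Lemma refine_ray v b y l : ray k v b = v :: y :: l ->
  refine k (Loose v b) = walk_of k.+1 (ray k v b) ++ tip k.+1 (rev (ray k v b)) ++
    walk_of k.+1 (rev (ray k v b)).
Proof. by move=> /= ->. Qed.

(** A new point is a child of its nearest point if that one is bad, and otherwise
    is found by [located]. *)
Lemma discovered w : V k.+1 w -> Stop w \in L'.
Proof.
move=> wV; have [vk vmin vw] := nearestP wV.
have [nw|/eqP nw] := eqVneq (nearest k w) w.
  rewrite nw in vk; apply: (mem_refined (L_Stop vk)) => /=.
  by case: ifP => _; rewrite ?mem_head// /star mem_head.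
have [gv|bv] := boolP (good k (nearest k w)); last first.
  apply: (mem_refined (L_Stop vk)) => /=; rewrite (negbTE bv) /star inE mem_cat.
  apply/orP; right; apply/orP; right; apply/flattenP.
  exists (spoke k.+1 (nearest k w) w); last by rewrite /spoke 2!inE eqxx orbT.
  by apply: map_f; apply/childrenP; split => //; exact/nesym.
case: (located wV nw gv) => [[b bL wr]|[a [b [c [eL we wa wb]]]]].
  have [_ _ [l el]] := ray_track b vk gv.
  case: l el => [|y l] el; first by move: wr; rewrite el inE => /eqP/esym.
  apply: (mem_refined bL); rewrite (refine_ray el) mem_cat.
  by rewrite (walk_of_visits _ el) //; exact/nesym.
have [_ _ [m em]] := enum_pair_track (L_wf eL : flat k (a, b)).
apply: (mem_refined eL) => /=; case: c {eL}.
  by rewrite (walk_of_visits _ em).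
have er : rev (enum_pair k a b) = b :: rcons (rev m) a by rewrite em rev_cons rev_rcons.
by rewrite (walk_of_visits _ er)// mem_rev.
Qed.

Section cover_track.
Variables (a : X) (t : seq X).
Hypothesis ak : V k a.
Hypothesis ga : good k a.
Hypothesis tt : track k a t.
Hypothesis t_sub : {subset walk_of k.+1 t <= L'} \/ {subset walk_of k.+1 (rev t) <= L'}.

Lemma consecutive_rev l1 u u' l2 : t = l1 ++ u :: u' :: l2 ->
  rev t = rev l2 ++ u' :: u :: rev l1.
Proof. by move=> ->; rewrite rev_cat !rev_cons -!cats1 -!catA. Qed.

Lemma consecutive_step l1 u u' l2 : t = l1 ++ u :: u' :: l2 ->
  {subset step k.+1 u u' <= L'} \/ {subset step k.+1 u' u <= L'}.
Proof.
move=> e; case: t_sub => h; [left|right] => x hx; apply: h.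
  exact: step_walk e _ hx.
exact: step_walk (consecutive_rev e) _ hx.
Qed.

Lemma cov_next l1 u u' l2 b : t = l1 ++ u :: u' :: l2 -> good k.+1 u ->
  (`|u - u'| < 14 * (A * d k.+1) -> b = side k.+1 u u') -> cov k.+1 L' u b.
Proof.
move=> e gu hb; exact: (track_cov_left ak ga tt e (consecutive_step e) gu hb).
Qed.

Lemma cov_prev l1 u u' l2 b : t = l1 ++ u' :: u :: l2 -> good k.+1 u ->
  (`|u - u'| < 14 * (A * d k.+1) -> b = side k.+1 u u') -> cov k.+1 L' u b.
Proof.
move=> e gu hb.
apply: (track_cov_left ak ga (track_rev tt) (consecutive_rev e) _ gu hb).
by case: (consecutive_step e); [right|left].
Qed.

(** The two neighbours of v on the track are on different sides of it, by
    [track_between]; a gap on one side makes both sides loose. *)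
Lemma cov_interior l1 u v u' l2 b : t = l1 ++ u :: v :: u' :: l2 ->
  good k.+1 v -> cov k.+1 L' v b.
Proof.
move=> e gv; have e' : t = rcons l1 u ++ v :: u' :: l2 by rewrite cat_rcons.
have [tn _ _] := tt.
have mem x : x \in [:: u; v; u'] -> V k.+1 x.
  move=> xi; case: (tn x) => //; move: xi.
  by rewrite e mem_cat !inE => /or3P[] ->; rewrite ?orbT.
have [uV vV u'V] : [/\ V k.+1 u, V k.+1 v & V k.+1 u'].
  by split; apply: mem; rewrite !inE eqxx ?orbT.
have [f|nf] := leP (14 * (A * d k.+1)) `|v - u|.
  by apply: (cov_prev e gv) => h; have := lt_le_trans h f; rewrite ltxx.
have [bu|bu] := eqVneq b (side k.+1 v u); first by apply: (cov_prev e gv).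
apply: (cov_next e' gv) => nf'.
have [_ uN] := nbhS uV nf; have [_ u'N] := nbhS u'V nf'.
have uv : u <> v := track_neq tt e; have vu' : v <> u' := track_neq tt e'.
have := same_side vV gv uN u'N uv (nesym vu').
rewrite [RHS]ltNge (ltW (track_between ak ga tt e))/=.
by move: bu; case: b; case: (side _ _ u); case: (side _ _ u').
Qed.

End cover_track.

(** A vertex present at level k inherits the cover of each side from level k. A
    new one gets it from its bad parent, from its neighbours on the walk that
    found it, or from the tip of a ray. *)
Lemma covered v b : V k.+1 v -> good k.+1 v -> cov k.+1 L' v b.
Proof.
move=> vV gv'.
have Sb : Loose v b \in sides k.+1 v by rewrite /sides gv' !inE; case: b; rewrite eqxx ?orbT.
have [vk|nvk] := pselect (V k v).
  have [gv|bv] := boolP (good k v); last first.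
    left; apply: (mem_refined (L_Stop vk)) => /=.
    by rewrite (negbTE bv) /star inE mem_cat Sb orbT.
  case: (L_cov (b (+) flip k v) vk gv) => [h|[u [c [h su]]]].
    have [tt mem [l el]] := ray_track (b (+) flip k v) vk gv.
    case: l el => [|y l] el.
      left; apply: (mem_refined h) => /=; rewrite el gv' inE.
      by rewrite -addbA addbb addbF.
    have yr : y \in ray k v (b (+) flip k v) by rewrite el !inE eqxx orbT.
    have [yV _] := (mem y).1 yr; case=> [|[yv sy]].
      by move=> yv; have := track_neq tt (el : _ = [::] ++ v :: y :: l); rewrite yv.
    apply: (cov_next vk gv tt _ (el : _ = [::] ++ v :: y :: l) gv').
      left => x hx; apply: (mem_refined h); rewrite (refine_ray el) mem_cat.
      by rewrite hx.
    by move=> vy; rewrite (flipP vk gv gv' yV yv vy) sy -addbA addbb addbF.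
  have main a b' : flat k (a, b') -> Edge a b' c \in L ->
      (a = v /\ b' = u) \/ (a = u /\ b' = v) -> cov k.+1 L' v b.
    move=> f eL ab; have [ak bk ga bN] := flat_nbh f.
    have [tt mem [m em]] := enum_pair_track f.
    have sub : {subset walk_of k.+1 (enum_pair k a b') <= L'} \/
        {subset walk_of k.+1 (rev (enum_pair k a b')) <= L'}.
      case: (c) eL => eL; [left|right] => x hx; exact: (mem_refined eL).
    have f14 := flat_lt f.
    have near y : y \in enum_pair k a b' -> nbh k v y.
      move=> /mem/Vbtw_near[yV ay]; split => //; have := Ad_gt0 k => Ad.
      case: ab => -[av bu]; first by subst a; nlra.
      subst b'; rewrite (le_lt_trans (ler_distD a _ _))//.
      by rewrite distrC in f14; nlra.
    have end_ y : y \in enum_pair k a b' -> y <> v -> 0 < inner (y - v) (u - v) ->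
        `|v - y| < 14 * (A * d k.+1) -> b = side k.+1 v y.
      move=> yt yv yu vy; have [yV _] := Vbtw_near ((mem y).1 yt).
      rewrite (flipP vk gv gv' yV yv vy).
      have uN : nbh k v u.
        apply: near; case: ab => -[av bu].
          by rewrite -bu em inE mem_rcons mem_head orbT.
        by rewrite -av em mem_head.
      have uv : u <> v.
        by move=> uv; case: (flat_neq f); case: ab => -[-> ->]; rewrite uv.
      have := same_side vk gv (near _ yt) uN yv uv; rewrite yu su => /eqP ->.
      by rewrite -addbA addbb addbF.
    case: ab => -[av bu].
      have [y [l el]] : exists y l, rcons m b' = y :: l.
        by case: (m) => [|y m']; [exists b', [::]|exists y, (rcons m' b')].
      rewrite el in em; subst a b'.
      apply: (cov_next ak ga tt sub (em : _ = [::] ++ v :: y :: l) gv').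
      apply: end_; first by rewrite em !inE eqxx orbT.
        exact: nesym (track_neq tt (em : _ = [::] ++ v :: y :: l)).
      by apply: (track_head ak ga tt em); rewrite -el mem_rcons mem_head.
    have [y [l el]] : exists y l, rcons (rev m) a = y :: l.
      by case: (rev m) => [|y m']; [exists a, [::]|exists y, (rcons m' a)].
    have er : rev (enum_pair k a b') = b' :: y :: l by rewrite em rev_cons rev_rcons -el.
    have er' : enum_pair k a b' = rev l ++ y :: b' :: [::].
      by rewrite -[LHS]revK er !rev_cons -!cats1 -!catA.
    subst a b'.
    apply: (cov_prev ak ga tt sub er' gv').
    apply: end_; first by rewrite er' mem_cat mem_head orbT.
      exact: (track_neq tt er').
    by apply: (track_head ak ga (track_rev tt) er); rewrite -el mem_rcons mem_head.
  case: h => h; have /= f := L_wf h; [apply: (main v u f h)|apply: (main u v f h)].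
    by left.
  by right.
have [qk qmin qv] := nearestP vV.
have nq : nearest k v <> v by move=> e; rewrite e in qk.
have [gq|bq] := boolP (good k (nearest k v)); last first.
  left; apply: (mem_refined (L_Stop qk)) => /=; rewrite (negbTE bq) /star inE mem_cat.
  apply/orP; right; apply/orP; right; apply/flattenP.
  exists (spoke k.+1 (nearest k v) v); last by rewrite /spoke 2!inE mem_cat Sb !orbT.
  by apply: map_f; apply/childrenP; split => //; exact/nesym.
case: (located vV nq gq) => [[b' bL vr]|[a [b' [c [eL ve va vb]]]]].
  have [tt mem [l el]] := ray_track b' qk gq.
  move: vr; rewrite el inE => /orP[/eqP/esym//|vl].
  have [y [m lm]] : exists y m, l = y :: m by case: (l) vl => // y m _; exists y, m.
  have sub : {subset walk_of k.+1 (ray k (nearest k v) b') <= L'} \/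
      {subset walk_of k.+1 (rev (ray k (nearest k v) b')) <= L'}.
    left => x hx; apply: (mem_refined bL); rewrite lm in el.
    by rewrite (refine_ray el) mem_cat hx.
  have [l1 [u [l2 et]]] : exists l1 u l2,
      ray k (nearest k v) b' = l1 ++ u :: v :: l2.
    case/splitPr: vl el => m1 m2 ->; case/lastP: m1 => [|m1 u].
      by exists [::], (nearest k v), m2.
    by exists (nearest k v :: m1), u, m2; rewrite cat_rcons.
  case: l2 et => [|u' l2] et; last exact: (cov_interior qk gq tt sub _ et gv').
  have [bu|bu] := eqVneq b (side k.+1 v u).
    by apply: (cov_prev qk gq tt sub et gv').
  left; apply: (mem_refined bL); rewrite lm in el; rewrite (refine_ray el).
  rewrite mem_cat mem_cat; apply/orP; right; apply/orP; left.
  have -> : rev (ray k (nearest k v) b') = v :: u :: rev l1.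
    by rewrite et rev_cat !rev_cons.
  rewrite /= gv' inE; apply/eqP; congr Loose.
  by move: bu; clear; case: b; case: (side _ _ _).
have f : flat k (a, b') := L_wf eL; have [ak _ ga _] := flat_nbh f.
have [tt mem [m em]] := enum_pair_track f.
have sub : {subset walk_of k.+1 (enum_pair k a b') <= L'} \/
    {subset walk_of k.+1 (rev (enum_pair k a b')) <= L'}.
  by case: (c) eL => eL; [left|right] => x hx; exact: (mem_refined eL).
have vm : v \in m.
  by move: ve; rewrite em inE mem_rcons inE => /or3P[/eqP//|/eqP//|].
case/splitPr: vm em => m1 m2 em.
have [l1 [u eu]] : exists l1 u, a :: m1 = rcons l1 u.
  by case/lastP: m1 {em} => [|m1 u]; [exists [::], a|exists (a :: m1), u].
have [u' [l2 eu']] : exists u' l2, rcons m2 b' = u' :: l2.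
  by case: m2 {em} => [|y m']; [exists b', [::]|exists y, (rcons m' b')].
apply: (cov_interior ak ga tt sub _ _ gv').
by rewrite em rcons_cat /= -cat_cons eu eu' cat_rcons.
Qed.

End coverage.

(** * The payments *)

Lemma sum_le_subset (T : eqType) (F : T -> R) (l l' : seq T) :
  (forall x, 0 <= F x) -> uniq l -> {subset l <= l'} ->
  \sum_(x <- l) F x <= \sum_(x <- l') F x.
Proof.
move=> F0; elim: l l' => [|x l IH] l' /=; first by rewrite big_nil sumr_ge0.
move=> /andP[xl ul] ll'; have xl' : x \in l' by apply: ll'; rewrite mem_head.
rewrite big_cons (big_rem x xl')/= lerD2l; apply: IH => // y yl.
have yx : y != x by apply: contraNneq xl => <-.
have : y \in x :: rem x l'.
  by rewrite -(perm_mem (perm_to_rem xl')) ll'// inE yl orbT.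
by rewrite inE (negbTE yx).
Qed.

Let near_max : R := 1 + 5 * Cstar.

(** The points are d k apart and close to a line: their projections fill an
    interval of length 4 Cstar d k. *)
Lemma few_near_good k w (l : seq X) : V k w -> good k w -> uniq l ->
  (forall x, x \in l -> V k x /\ `|w - x| <= 2 * (Cstar * d k)) ->
  (size l)%:R <= near_max.
Proof.
move=> wk gw ul hl; set t := sort (fun x y => p k w x <= p k w y) l.
have ht x : x \in t -> V k x /\ `|w - x| <= 2 * (Cstar * d k).
  by rewrite mem_sort; exact: hl.
have hN x : x \in t -> nbh k w x.
  move=> /ht[xV wx]; split; first exact: V_sub.
  by have := Cd2_lt k; have := Ad_gt0 k; lra.
have st : sorted (fun x y => p k w x <= p k w y) t.
  by apply: sort_sorted => x y; exact: le_total.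
have ut : uniq t by rewrite sort_uniq.
have -> : size l = size t by rewrite size_sort.
have lenS y m : (forall z, z \in y :: m -> V k z /\ nbh k w z) -> uniq (y :: m) ->
    path (fun x y => p k w x <= p k w y) y m ->
    (size m)%:R * d k <= 7 / 6 * (p k w (last y m) - p k w y).
  elim: m y => [|z m IH] y hm /= u; first by rewrite mul0r subrr mulr0.
  move=> /andP[yz zm].
  have [yV yN] := hm y (mem_head _ _).
  have [zV zN] : V k z /\ nbh k w z by apply: hm; rewrite !inE eqxx orbT.
  have yz' : y <> z.
    by move=> e; move: u; rewrite e inE eqxx.
  have h1 := V_sep yV zV yz'.
  have h2 : `|y - z| <= 7 / 6 * (p k w z - p k w y).
    have h := nbh_dist wk gw zN yN.
    rewrite (ger0_norm (x := p k w z - _)) ?subr_ge0// in h.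
    by rewrite distrC.
  have h3 : (size m)%:R * d k <= 7 / 6 * (p k w (last z m) - p k w z).
    apply: IH => //; last by case/andP: u.
    by move=> x xm; apply: hm; rewrite inE xm orbT.
  have e : (size m).+1%:R * d k = ((size m)%:R * d k : R) + d k :> R.
    by rewrite mulrSr mulrDl mul1r.
  rewrite e (le_trans (lerD h3 (le_trans h1 h2)))// -mulrDr addrA subrK//.
case: t st ut ht hN lenS => [|y m] st ut ht hN lenS.
  by rewrite /= mulr0n /near_max; have := hC; lra.
have h := lenS y m (fun z zy => conj (ht z zy).1 (hN z zy)) ut st.
have [_ hy] := ht y (mem_head _ _); have [_ hz] := ht _ (mem_last y m).
have h4 : p k w (last y m) - p k w y <= 4 * (Cstar * d k).
  apply: le_trans (ler_norm _) _; apply: le_trans (line_pos_le _ _ _) _.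
  rewrite (le_trans (ler_distD w _ _))// distrC; nlra.
have e : (size m).+1%:R * d k = ((size m)%:R * d k : R) + d k :> R.
  by rewrite mulrSr mulrDl mul1r.
rewrite -(ler_pM2r (d_gt0 k)) /= e /near_max; move: h; rewrite /= => h.
have := d_le_Cd k; have := d_gt0 k.
have : 0 < Cstar * d k by rewrite mulr_gt0// (lt_le_trans _ hC).
by lra.
Qed.

Let bad_part k (ws : seq X) := [seq w <- ws | ~~ good k w].

(** Either some point is good, and then there are few points, or all are bad. *)
Lemma size_le_bad k (ws : seq X) : uniq ws -> (forall x, x \in ws -> V k x) ->
  (forall x y, x \in ws -> y \in ws -> `|x - y| <= 2 * (Cstar * d k)) ->
  (size ws)%:R <= near_max + (size (bad_part k ws))%:R.
Proof.
move=> u wV wd; have [/hasP[w wws gw]|] := boolP (has (good k) ws).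
  apply: le_trans (few_near_good (wV _ wws) gw u _) _; last by rewrite lerDl.
  by move=> x xw; split; [exact: wV|exact: wd].
rewrite -all_predC => /all_filterP aE; rewrite /bad_part.
have -> : [seq w <- ws | ~~ good k w] = ws := aE.
by rewrite lerDr /near_max; have := hC; lra.
Qed.

Definition verts k : seq X := fset_set (V k).

Lemma mem_verts k x : x \in verts k <-> V k x.
Proof.
rewrite /verts in_fset_set; last exact: nets_finite nets k.
by split => [/set_mem|/mem_set].
Qed.

Lemma uniq_verts k : uniq (verts k). Proof. exact: fset_uniq. Qed.

Let bads k := bad_part k (verts k).

Lemma uniq_children k v : uniq (children k v).
Proof. by rewrite filter_uniq// uniq_verts. Qed.

Lemma size_children k v : (size (children k v))%:R <=
  near_max + (size (bad_part k.+1 (children k v)))%:R.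
Proof.
apply: size_le_bad; first exact: uniq_children.
  by move=> x /childrenP[].
have near x : x \in children k v -> `|x - v| < Cstar * d k.+1.
  by move=> /childrenP[xV nx _]; have [_ _] := nearestP xV; rewrite nx.
move=> x y /near xv /near yv; rewrite (le_trans (ler_distD v _ _))//.
by rewrite (distrC v y); nlra.
Qed.

(** A vertex has only one nearest point at the previous level. *)
Lemma sum_bad_children k :
  \sum_(v <- bads k) (size (bad_part k.+1 (children k v)))%:R <=
  (size (bads k.+1))%:R :> R.
Proof.
rewrite -natr_sum ler_nat.
pose P v w := ~~ good k.+1 w && ((nearest k w == v) && (w != v)).
have E v : size (bad_part k.+1 (children k v)) = (\sum_(w <- verts k.+1) P v w)%N.
  rewrite /bad_part /children -filter_predI size_filter -sum1_count big_mkcond /=.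
  by apply: eq_bigr => w _; rewrite /P; case: (_ && _).
rewrite (eq_bigr _ (fun v _ => E v)) exchange_big /=.
have -> : size (bads k.+1) = (\sum_(w <- verts k.+1) ~~ good k.+1 w)%N.
  rewrite /bads /bad_part size_filter -sum1_count big_mkcond /=.
  by apply: eq_bigr => w _; case: (~~ _).
apply: leq_sum => w _; rewrite /P; case: (~~ good k.+1 w); last by rewrite big1.
have ub : uniq (bads k) by rewrite filter_uniq// uniq_verts.
apply: (@leq_trans (\sum_(v <- bads k) (v == nearest k w))%N).
  by apply: leq_sum => v _ /=; rewrite eq_sym; case: (v == _) => //=; case: (_ != _).
by rewrite -big_mkcond sum1_count count_uniq_mem// leq_b1.
Qed.

Lemma finite_flat k : finite_set (flat k).
Proof.
apply: (@sub_finite_set _ _ (V k `*` V k)).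
  by move=> [a b] /flat_nbh[ak bk _ _]; split.
by apply: finite_setX; exact: nets_finite nets k.
Qed.

Definition tau_level k : R :=
  \sum_(q \in flat k) tau Cstar xi2 r0 V rho ell s k q.1 q.2 * rho k `^ s.

Definition bad_level k : R :=
  \sum_(v \in V k `&` [set v | alpha0 <= alpha k v]) rho k `^ s.

Lemma tau_ge0 k a b : 0 <= tau Cstar xi2 r0 V rho ell s k a b.
Proof. by rewrite /tau divr_ge0 ?powR_ge0// le_max lexx orbT. Qed.

Lemma tau_levelE k : tau_level k = \sum_(q <- fset_set (flat k))
  tau Cstar xi2 r0 V rho ell s k q.1 q.2 * rho k `^ s.
Proof. by rewrite /tau_level fsbig_finite//; exact: finite_flat. Qed.

Lemma tau_level_ge0 k : 0 <= tau_level k.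
Proof.
by rewrite tau_levelE sumr_ge0// => q _; rewrite mulr_ge0 ?powR_ge0// tau_ge0.
Qed.

Lemma bads_le k : (size (bads k))%:R * rho k `^ s <= bad_level k.
Proof.
rewrite /bad_level fsbig_finite/=; last first.
  by apply: sub_finite_set (nets_finite nets k) => x [].
have -> : (size (bads k))%:R * rho k `^ s = \sum_(v <- bads k) rho k `^ s.
  by rewrite big_const_seq count_predT iter_addr addr0 mulr_natl.
apply: (@sum_le_subset _ (fun=> rho k `^ s)) => [x||]; first exact: powR_ge0.
  by rewrite filter_uniq// uniq_verts.
move=> x; rewrite mem_filter => /andP[bx /mem_verts xk].
rewrite in_fset_set; last by apply: sub_finite_set (nets_finite nets k) => y [].
by apply/mem_set; split => //=; rewrite leNgt.
Qed.

Lemma bad_level_ge0 k : 0 <= bad_level k.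
Proof. by apply: le_trans (bads_le k); rewrite mulr_ge0 ?powR_ge0. Qed.

Lemma d_pow k : d k `^ s = r0 `^ s * rho k `^ s.
Proof. by rewrite /d mulrC powRM// ltW// (rho_gt0 nets). Qed.

Lemma pay_ge0 k e : 0 <= pay k e.
Proof.
case: e => [v|//|a b c|//] /=.
  by case: ifP => // _; apply: sumr_ge0 => e _; exact: base_ge0.
by rewrite mulr_ge0// mulr_ge0 ?powR_ge0 ?tau_ge0.
Qed.

Lemma pay_Stop k v : good k v = false ->
  pay k (Stop v) <= star_cost * d k.+1 `^ s *
    (1 + near_max + (size (bad_part k.+1 (children k v)))%:R).
Proof.
move=> /= ->; have CC : Cstar * d k.+1 <= 2 * Cstar * d k.+1.
  by rewrite ler_pM2r//; have := hC; lra.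
apply: le_trans (star_base _) _.
  move=> w /childrenP[wV nw _]; apply: le_trans CC; rewrite ltW// distrC.
  by have [_ _] := nearestP wV; rewrite nw.
rewrite ler_wpM2l ?mulr_ge0 ?powR_ge0 ?(ltW star_cost_gt0)//.
by rewrite -addrA lerD2l size_children.
Qed.

Lemma sum_pay_Stop k : \sum_(v <- verts k) pay k (Stop v) <=
  star_cost * r0 `^ s * ((1 + near_max) * bad_level k + bad_level k.+1).
Proof.
have X0 : 0 <= star_cost * d k.+1 `^ s by rewrite mulr_ge0 ?powR_ge0 ?(ltW star_cost_gt0).
have -> : \sum_(v <- verts k) pay k (Stop v) = \sum_(v <- bads k) pay k (Stop v).
  rewrite /bads /bad_part big_filter [RHS]big_mkcond /=; apply: eq_bigr => v _.
  by case: ifP.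
apply: (@le_trans _ _ (\sum_(v <- bads k) star_cost * d k.+1 `^ s *
    (1 + near_max + (size (bad_part k.+1 (children k v)))%:R))).
  rewrite big_seq [leRHS]big_seq; apply: ler_sum => v.
  by rewrite mem_filter => /andP[/negbTE bv _]; exact: pay_Stop.
rewrite -mulr_sumr big_split/=.
have n0 : 0 <= 1 + near_max by rewrite /near_max; have := hC; lra.
have h1 : \sum_(v <- bads k) (1 + near_max) = (1 + near_max) * (size (bads k))%:R.
  by rewrite big_const_seq count_predT iter_addr addr0 mulr_natr.
apply: le_trans (ler_wpM2l X0 (lerD (lexx _) (sum_bad_children k))) _.
rewrite h1 -!mulrA ler_wpM2l ?(ltW star_cost_gt0)//.
rewrite mulrDr [leRHS]mulrDr; apply: lerD.
  apply: (@le_trans _ _ (d k `^ s * ((1 + near_max) * (size (bads k))%:R))).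
    rewrite ler_wpM2r ?mulr_ge0//.
    by apply: ge0_ler_powR; rewrite ?nnegrE ?(ltW s_gt0) ?(ltW (d_gt0 _)) ?dS_le.
  rewrite d_pow -mulrA ler_wpM2l ?powR_ge0// mulrCA ler_wpM2l//.
  by rewrite mulrC bads_le.
by rewrite d_pow -mulrA ler_wpM2l ?powR_ge0// mulrC bads_le.
Qed.

Lemma sum_pay_Edge k c : \sum_(q <- fset_set (flat k)) pay k (Edge q.1 q.2 c) <=
  3 * ((14 * A) `^ s * r0 `^ s) * tau_level k.
Proof.
rewrite tau_levelE mulr_sumr big_seq [leRHS]big_seq; apply: ler_sum => -[a b].
rewrite in_fset_set; last exact: finite_flat.
move=> /set_mem f /=; rewrite -[leRHS]mulrA ler_pM2l//.
move: (tau_ge0 k a b); move: (tau _ _ _ _ _ _ _ _ _ _) => T T0.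
rewrite [leRHS]mulrC -[leRHS]mulrA ler_wpM2l//.
apply: (@le_trans _ _ ((14 * (A * d k)) `^ s)).
  apply: ge0_ler_powR; rewrite ?nnegrE ?(ltW s_gt0)//; last exact: ltW (flat_lt f).
  by rewrite mulr_ge0// ltW.
rewrite mulrA powRM ?(ltW (d_gt0 _))//; last by rewrite mulr_ge0// ltW// A_gt0.
by rewrite d_pow; lra.
Qed.

(** Each stop and each directed edge occurs once in L, so the payments are bounded
    by sums over the vertices and twice over the flat pairs. *)
Lemma pay_level k L : (forall e, e \in L -> wf k e) ->
  uniq [seq e <- L | payable e] ->
  \sum_(e <- L) pay k e <= 6 * ((14 * A) `^ s * r0 `^ s) * tau_level k +
    star_cost * r0 `^ s * ((1 + near_max) * bad_level k + bad_level k.+1).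
Proof.
move=> Lwf uL.
have -> : \sum_(e <- L) pay k e = \sum_(e <- [seq e <- L | payable e]) pay k e.
  rewrite big_filter [RHS]big_mkcond /=; apply: eq_bigr => e _.
  by case: e.
pose F : seq (X * X) := fset_set (flat k).
pose l' := [seq Stop v | v <- verts k] ++ ([seq Edge q.1 q.2 true | q <- F] ++
  [seq Edge q.1 q.2 false | q <- F]).
apply: (@le_trans _ _ (\sum_(e <- l') pay k e)).
  apply: sum_le_subset => //; first exact: pay_ge0.
  move=> e; rewrite mem_filter => /andP[pe /Lwf].
  rewrite !mem_cat; case: e pe => [v|//|a b c|//] _ /= h.
    by apply/orP; left; apply: map_f; exact/mem_verts.
  have abF : (a, b) \in F.
    by rewrite in_fset_set; [exact: mem_set|exact: finite_flat].
  apply/orP; right; case: c; apply/orP; [left|right];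
    exact: (map_f (fun q => Edge q.1 q.2 _) abF).
rewrite !big_cat /= !big_map addrC; apply: lerD; last exact: sum_pay_Stop.
have h1 := sum_pay_Edge k true; have h2 := sum_pay_Edge k false.
apply: le_trans (lerD h1 h2) _; lra.
Qed.

(** * The sequence of tours *)

Definition center : X := xget 0 (V 0%N).

Lemma center_V : V 0%N center.
Proof. by apply: xgetPex; exact: nets_nonempty nets 0%N. Qed.

Definition others : seq X := [seq w <- verts 0 | w != center].

Lemma V0_dist x y : V 0%N x -> V 0%N y -> `|x - y| <= 2 * Cstar * d 0.
Proof.
have [rho0 _] := nets_V0 nets; rewrite /d rho0 mul1r => /(nets_V1 nets) + /(nets_V1 nets).
rewrite -ball_normE /= => h1 h2; rewrite (le_trans (ler_distD x0 _ _))// distrC.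
by nlra.
Qed.

Fixpoint tour k : seq (node X) :=
  dedup [::] (if k is k'.+1 then flatten [seq refine k' e | e <- tour k']
              else star 0 center others).

Let tour_pieces k : seq (seq (node X)) := dedups [::] [seq refine k e | e <- tour k].

Lemma tourS k : tour k.+1 = flatten (tour_pieces k).
Proof. by rewrite flatten_dedups. Qed.

Lemma strip_wf k e : wf k e -> payable e ->
  wf k (strip e) /\ base k (strip e) <= base k e.
Proof.
have Dk : 0 <= D * d k by rewrite mulr_ge0 ?(ltW D_gt0)// ltW.
case: e => [v|//|a b c|//] /= h _.
  by rewrite /strip /= subrr normr0 mul0r; split => //; split => //; left.
have dk := flat_ge h; have dk' : d k <= `|b - a| by rewrite distrC.
have lt14 : `|a - b| <= D * d k.
  by apply: le_trans (Dd_ge k); have := flat_lt h; have := Ad_gt0 k; nlra.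
have := bridge_le dk; have := powR_ge0 `|a - b| s.
rewrite /strip; case: c => /= h1 h2; split.
- by split => //; right.
- by lra.
- by rewrite distrC; split => //; right; rewrite distrC.
- by rewrite distrC; lra.
Qed.

Lemma dedup_wf k seen l : (forall e, e \in l -> wf k e) ->
  forall e, e \in dedup seen l -> wf k e.
Proof.
move=> lw e /dedup_mem[/lw//|[e' /lw we' [pe' ->]]].
by case: (strip_wf we' pe').
Qed.

Lemma tour_inv k : [/\ forall e, e \in tour k -> wf k e,
  forall v, V k v -> Stop v \in tour k &
  forall v b, V k v -> good k v -> cov k (tour k) v b].
Proof.
have sub l : forall e : node X, e \in l -> e \in dedup [::] l.
  by move=> e el; apply: mem_dedup.
elim: k => [|k [IHw IHv IHc]].
  have ow w : w \in others ->
      [/\ V 0%N w, center <> w & `|center - w| <= 2 * Cstar * d 0].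
    rewrite mem_filter => /andP[/eqP wc /mem_verts w0]; split => //; first exact/nesym.
    by apply: V0_dist => //; exact: center_V.
  split.
  - by apply: dedup_wf => e /(star_mem center_V ow)[].
  - move=> v v0; apply: (sub (star 0 center others)).
    have [->|vc] := eqVneq v center; first by rewrite /star mem_head.
    rewrite /star inE mem_cat; apply/orP; right; apply/orP; right; apply/flattenP.
    exists (spoke 0 center v); last by rewrite /spoke 2!inE eqxx orbT.
    by apply: map_f; rewrite mem_filter vc; exact/mem_verts.
  - move=> v b v0 gv; left; apply: (sub (star 0 center others)).
    have Sb : Loose v b \in sides 0 v by rewrite /sides gv !inE; case: b; rewrite eqxx ?orbT.
    have [vc|vc] := eqVneq v center; first by rewrite /star inE mem_cat -vc Sb orbT.
    rewrite /star inE mem_cat; apply/orP; right; apply/orP; right; apply/flattenP.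
    exists (spoke 0 center v); last by rewrite /spoke 2!inE mem_cat Sb !orbT.
    by apply: map_f; rewrite mem_filter vc; exact/mem_verts.
split.
- apply: dedup_wf => e /flattenP[l /mapP[e' /IHw we' ->]].
  by have [_ _ + _] := refineP we' => h /h[].
- by move=> v vV; apply: (sub (flatten _)); exact: discovered.
- move=> v b vV gv.
  apply: (@cov_sub _ (flatten [seq refine k e | e <- tour k])); last exact: covered.
  by move=> e _; exact: sub.
Qed.

Lemma tour_uniq k : uniq [seq e <- tour k | payable e].
Proof. by case: k => [|k]; exact: (dedup_uniq _ _).1. Qed.

Lemma tour_chain k : chain center (tour k) center.
Proof.
elim: k => [|k IH]; apply: chain_dedup; first exact: star_chain.
have [tw _ _] := tour_inv k.
suff H l x y : (forall e, e \in l -> wf k e) -> chain x l y ->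
    chain x (flatten [seq refine k e | e <- l]) y by exact: H.
elim: l x => [//|e l IHl] x lw /= [-> h].
apply: chain_cat (IHl _ _ h); last by move=> e' el; apply: lw; rewrite inE el orbT.
by have [] := refineP (lw e (mem_head _ _)).
Qed.

Lemma tour_piece k i : (i < size (tour k))%N ->
  exists seen, nth [::] (tour_pieces k) i =
    dedup seen (refine k (nth (Stop center) (tour k) i)).
Proof.
move=> ik; have [|seen ->] := @nth_dedups _ [::] [seq refine k e | e <- tour k] i.
  by rewrite size_map.
by exists seen; rewrite (nth_map (Stop center)).
Qed.

Lemma tour_refines k i : (i < size (tour k))%N ->
  let e := nth (Stop center) (tour k) i in refines k e (refine k e).
Proof.
move=> ik; apply: refineP; have [tw _ _] := tour_inv k.
by apply: tw; exact: mem_nth.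
Qed.

Lemma tour_gt0 : (0 < size (tour 0))%N.
Proof. by rewrite /tour /star /=. Qed.

Lemma tour_pieces_size k : size (tour_pieces k) = size (tour k).
Proof. by rewrite size_dedups size_map. Qed.

Lemma tour_pieces_neq0 k : [::] \notin tour_pieces k.
Proof.
apply/negP => /(nthP [::])[i]; rewrite tour_pieces_size => ik.
have [seen ->] := tour_piece ik => /eqP; rewrite dedup_eq0 => /eqP.
by have [h _ _ _] := tour_refines ik.
Qed.

Lemma tour_base k i : (i < size (tour k))%N ->
  \sum_(e <- nth [::] (tour_pieces k) i) base k.+1 e <=
  base k (nth (Stop center) (tour k) i) + pay k (nth (Stop center) (tour k) i).
Proof.
move=> ik; have [seen ->] := tour_piece ik; have [_ _ hw hb] := tour_refines ik.
apply: le_trans hb; apply: sum_dedup => e /hw[we _] pe.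
by have [] := strip_wf we pe.
Qed.

Lemma tour_src k i e : (i < size (tour k))%N -> e \in nth [::] (tour_pieces k) i ->
  `|src (nth (Stop center) (tour k) i) - src e| <= D * d k.
Proof.
move=> ik; have [seen ->] := tour_piece ik; have [_ _ hw _] := tour_refines ik.
by move=> /dedup_mem[/hw[]//|[e' /hw[_ h] [_ ->]]].
Qed.

Lemma tour_diam k e : e \in tour k -> `|src e - tgt e| <= D * d k.
Proof.
have [tw _ _] := tour_inv k => /tw.
have Dk : 0 <= D * d k by rewrite mulr_ge0 ?(ltW D_gt0)// ltW.
case: e => [v|v b|a b c|x y] /=; rewrite ?subrr ?normr0//; last by case.
move=> f; have h : `|a - b| <= D * d k.
  by apply: le_trans (Dd_ge k); have := flat_lt f; have := Ad_gt0 k; nlra.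
by case: c => //; rewrite distrC.
Qed.

Lemma tour_long k e : e \in tour k -> src e <> tgt e -> d k `^ s <= base k e.
Proof.
have [tw _ _] := tour_inv k => /tw.
case: e => [v _|v b _|a b c|x y] //=.
  move=> f _; apply: (@le_trans _ _ (`|a - b| `^ s)).
    apply: ge0_ler_powR; rewrite ?nnegrE ?(ltW s_gt0) ?(ltW (d_gt0 _))//.
    exact: flat_ge.
  by have := powR_ge0 `|a - b| s; lra.
by move=> [_ [//|xyd]] _; exact: bridge_ge.
Qed.

Lemma tour0_mem e : e \in tour 0 -> V 0%N (src e).
Proof.
have key e' : e' \in star 0 center others -> V 0%N (src e').
  move=> /(star_mem center_V)[|_ [->|]]; last 2 first.
  - exact: center_V.
  - by rewrite mem_filter => /andP[_ /mem_verts].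
  move=> w; rewrite mem_filter => /andP[/eqP wc /mem_verts w0].
  by split => //; [exact/nesym|apply: V0_dist => //; exact: center_V].
by move=> /dedup_mem[/key//|[e' /key h [_ ->]]].
Qed.

Lemma tour0_diam e e' : e \in tour 0 -> e' \in tour 0 ->
  `|src e - src e'| <= D * d 0.
Proof.
move=> /tour0_mem h /tour0_mem h'; apply: le_trans (V0_dist h h') _.
by apply: le_trans (Dd_ge 0); have := Ad_ge 0; have := Ad_gt0 0; lra.
Qed.

(** * The Hölder constant *)

Let SV := S_sum Cstar xi2 r0 V rho alpha ell s alpha0.
Hypothesis SV_fin : (SV < +oo)%E.
Let S := fine SV.

Lemma partial_sums N M :
  \sum_(0 <= k < N) tau_level k + \sum_(0 <= k < M) bad_level k <= S.
Proof.
have t0 n : (0 <= (tau_level n)%:E)%E by rewrite lee_fin tau_level_ge0.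
have b0 n : (0 <= (bad_level n)%:E)%E by rewrite lee_fin bad_level_ge0.
have SVE : SV = (\sum_(0 <= k <oo) (tau_level k)%:E +
    \sum_(0 <= k <oo) (bad_level k)%:E)%E by [].
have S0 : (0 <= SV)%E.
  by rewrite SVE adde_ge0//; apply: nneseries_ge0.
rewrite -lee_fin /S fineK ?ge0_fin_numE// SVE EFinD -!sumEFin.
by apply: leeD; apply: nneseries_lim_ge.
Qed.

Lemma S_ge0 : 0 <= S.
Proof. by have := partial_sums 0 0; rewrite !big_geq// addr0. Qed.

Lemma near_max_gt0 : 0 < near_max. Proof. by rewrite /near_max; have := hC; lra. Qed.

Let B0 := star_cost * r0 `^ s * ((1 + near_max) * (1 + S)).
Let B := (6 * (14 * A) `^ s + star_cost * (2 + near_max)) * (r0 `^ s * S).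

(** The bad children at level k are counted in the bad vertices of level k+1, so
    the second sum in S is used at two consecutive levels. *)
Lemma tour_pay N : \sum_(0 <= k < N) \sum_(e <- tour k) pay k e <= B.
Proof.
set Q := (14 * A) `^ s; set r := r0 `^ s.
have Q0 : 0 <= Q by exact: powR_ge0.
have r_ge0 : 0 <= r by exact: powR_ge0.
apply: (@le_trans _ _ (\sum_(0 <= k < N) (6 * (Q * r) * tau_level k +
    star_cost * r * ((1 + near_max) * bad_level k + bad_level k.+1)))).
  apply: ler_sum => k _; have [tw _ _] := tour_inv k.
  exact: pay_level tw (tour_uniq k).
rewrite big_split/= -!mulr_sumr big_split/= -mulr_sumr.
have bS : \sum_(0 <= k < N) bad_level k.+1 <= S.
  have := partial_sums 0 N.+1; rewrite big_geq// add0r big_nat_recl//=.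
  by have := bad_level_ge0 0; lra.
have tb := partial_sums N N; have t0 : 0 <= \sum_(0 <= k < N) tau_level k.
  by apply: sumr_ge0 => k _; exact: tau_level_ge0.
have b0 : 0 <= \sum_(0 <= k < N) bad_level k.
  by apply: sumr_ge0 => k _; exact: bad_level_ge0.
have tS : \sum_(0 <= k < N) tau_level k <= S by lra.
have bS' : \sum_(0 <= k < N) bad_level k <= S by lra.
have -> : B = 6 * (Q * r) * S + star_cost * r * ((1 + near_max) * S + S).
  by rewrite /B -/Q -/r; ring.
apply: lerD; first by rewrite ler_wpM2l// mulr_ge0// mulr_ge0.
rewrite ler_wpM2l ?mulr_ge0 ?(ltW star_cost_gt0)//; apply: lerD => //.
by rewrite ler_wpM2l//; have := near_max_gt0; lra.
Qed.

Lemma tour_base0 : \sum_(e <- tour 0) base 0 e <= B0.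
Proof.
have ow w : w \in others ->
    [/\ V 0%N w, center <> w & `|center - w| <= 2 * Cstar * d 0].
  rewrite mem_filter => /andP[/eqP wc /mem_verts w0]; split => //; first exact/nesym.
  by apply: V0_dist => //; exact: center_V.
apply: (@le_trans _ _ (\sum_(e <- star 0 center others) base 0 e)).
  apply: sum_dedup => e /(star_mem center_V ow)[we _] pe.
  by have [] := strip_wf we pe.
apply: le_trans (star_base _) _; first by move=> w /ow[].
have [rho0 _] := nets_V0 nets.
have -> : d 0 = r0 by rewrite /d rho0 mul1r.
rewrite /B0 ler_wpM2l ?mulr_ge0 ?powR_ge0 ?(ltW star_cost_gt0)//.
have uo : uniq others by rewrite filter_uniq// uniq_verts.
have h : (size others)%:R <= near_max + (size (bad_part 0 others))%:R.
  apply: size_le_bad => //; first by move=> x /ow[].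
  by move=> x y /ow[xV _ _] /ow[yV _ _]; rewrite mulrA; exact: V0_dist.
have h' : (size (bad_part 0 others))%:R <= (size (bads 0))%:R :> R.
  rewrite ler_nat; apply: uniq_leq_size; first by rewrite filter_uniq.
  by move=> x; rewrite !mem_filter => /and3P[-> _ ->].
have h2 := bads_le 0; rewrite rho0 powR1 mulr1 in h2.
have := partial_sums 0 1; rewrite big_geq// add0r big_nat1 => h3.
have := S_ge0; have := near_max_gt0; move: h h' h2 h3.
by move: (_%:R) (_%:R) (_%:R) (bad_level 0) => q1 q2 q3 q4; nra.
Qed.

Hypothesis X_complete : seq_complete X.

(** The length of the parameter interval is at most c2 r0^s (1 + S). Its s-th root
    is of order r0 (1 + S)^(1/s), at most r0 (1 + S). *)
Theorem flat_nets_holder : exists (f : R -> X) (H : R),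
  [/\ \bigcup_k V k `<=` f @` `[0, 1],
      forall x y : R, 0 <= x <= 1 -> 0 <= y <= 1 ->
        `|f x - f y| <= H * `|x - y| `^ s^-1 &
      H <= holder_const s Cstar xi1 xi2 * r0 * (1 + S)].
Proof.
have r0s : 0 < r0 `^ s by exact: powR_gt0.
have S0 := S_ge0; have n0 := near_max_gt0; have c0 := star_cost_gt0.
have B0_gt0 : 0 < B0 by rewrite !mulr_gt0//; lra.
have B_ge0 : 0 <= B.
  rewrite mulr_ge0 ?mulr_ge0 ?(ltW r0s)// addr_ge0 ?mulr_ge0 ?powR_ge0 ?(ltW c0)//.
  by lra.
have tot : 0 < B0 + B by lra.
have [f [fH fV]] := tours_holder hxi1 hxi12 hxi2 d_gt0 d_dec d_lb (ltW D_gt0) hs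
  X_complete tour_gt0 tourS tour_pieces_size tour_pieces_neq0 tour_base tour_src
  (fun k i => chain_nth (Stop center) (tour_chain k)) tour_diam tour_long tour0_diam
  base_ge0 pay_ge0 tour_pay tour_base0 tot.
exists f, ((2 * (D / (1 - xi2)) + D) / xi1 * (B0 + B) `^ s^-1); split => //.
  move=> v [k0 _ vk0]; have [k|x x01 <-] := fV v k0.
    move=> k0k; exists (Stop v) => //; have [_ tv _] := tour_inv k; apply: tv.
    by move: k0k => /subnK <-; elim: (k - k0)%N => [//|j IH]; exact: V_sub IH.
  by exists x => //; rewrite /= in_itv.
rewrite /holder_const -/D -/loose_cost -/star_cost -/near_max.
set c2 := 6 * _ + _; set E := (_ + D) / xi1.
have E0 : 0 <= E.
  have D0 := ltW D_gt0.
  have D1 : 0 <= D / (1 - xi2) by rewrite divr_ge0// subr_ge0 ltW.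
  by rewrite divr_ge0 ?(ltW hxi1)// addr_ge0// mulr_ge0.
suff : (B0 + B) `^ s^-1 <= c2 `^ s^-1 * (r0 * (1 + S)).
  by move=> /(ler_wpM2l E0); rewrite !mulrA.
have s1 : 0 <= s^-1 by rewrite invr_ge0 ltW.
have Q0 : 0 <= (14 * A) `^ s by exact: powR_ge0.
have c20 : 0 <= c2 by rewrite /c2; nra.
have bound : B0 + B <= c2 * (r0 `^ s * (1 + S)).
  have e : c2 * (r0 `^ s * (1 + S)) - (B0 + B) = r0 `^ s * (6 * (14 * A) `^ s +
      star_cost * (3 + near_max) + star_cost * (1 + 0) * S).
    by rewrite /B0 /B /c2; ring.
  by rewrite -subr_ge0 e mulr_ge0 ?(ltW r0s)//; nra.
have S1 : 1 <= 1 + S by lra.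
apply: (@le_trans _ _ ((c2 * (r0 `^ s * (1 + S))) `^ s^-1)).
  by apply: ge0_ler_powR; rewrite ?nnegrE ?(ltW tot)// !mulr_ge0 ?(ltW r0s)//; lra.
rewrite powRM//; last by rewrite mulr_ge0 ?(ltW r0s)//; lra.
rewrite ler_wpM2l ?powR_ge0// powRM ?(ltW r0s)//; last by lra.
rewrite -powRrM mulfV ?gt_eqF// powRr1 ?(ltW hr0)// ler_wpM2l ?(ltW hr0)//.
by rewrite ler1_powR// invf_le1.
Qed.

End construction.

Theorem theorem5p1 (R : realType) (s Cstar xi1 xi2 : R)
    (hs : 1 <= s) (hC : 1 <= Cstar)
    (hxi1 : 0 < xi1) (hxi12 : xi1 <= xi2) (hxi2 : xi2 < 1) :
  exists C : R,
    forall X : innerProductType R,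
      X = l2 R :> innerProductType R \/
      (exists2 N : nat, (2 <= N)%N & X = euclid R N :> innerProductType R) ->
    forall (x0 : X) (r0 : R) (V : nat -> set X) (rho : nat -> R)
      (alpha : nat -> X -> R) (ell : nat -> X -> line X),
      0 < r0 ->
      flat_nets Cstar xi1 xi2 x0 r0 V rho alpha ell ->
    forall alpha0 : R,
      0 < alpha0 <= alpha1 Cstar xi1 xi2 ->
      let SV := S_sum Cstar xi2 r0 V rho alpha ell s alpha0 in
      (SV < +oo)%E ->
      exists (f : R -> X) (H : R),
        [/\ \bigcup_k V k `<=` f @` `[0, 1],
            forall x y : R, 0 <= x <= 1 -> 0 <= y <= 1 ->
              `|f x - f y| <= H * `|x - y| `^ s^-1 &
            H <= C * r0 * (1 + fine SV)].
Proof.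
exists (holder_const s Cstar xi1 xi2) => X hX x0 r0 V rho alpha ell r0_gt0 nets.
move=> alpha0 /andP[alpha0_gt0 alpha0_le] SV SV_fin.
have X_complete : seq_complete X.
  by case: hX => [->|[N _ ->]]; [exact: l2_complete|exact: euclid_complete].
apply: (flat_nets_holder hs hC hxi1 hxi12 hxi2 r0_gt0 nets _ SV_fin X_complete).
by rewrite alpha0_gt0 (le_trans alpha0_le)// ge_min lexx.
Qed.
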